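(* In the setting of the context, assume the following conditions. [C1] $\displaystyle\sup_{(\theta,\tau)\in\Xi}|\mathcal Y_T(\theta,\tau)-\mathcal Y(\theta)|\xrightarrow{P}0$; and with probability $1$, $\mathcal Y(\theta)<0$ for any $\theta\in\Theta$ with $\theta\ne\theta^*$. [C2] For some $\tau_0\in\mathcal T$, $\displaystyle\sup_{\tau\in\mathcal T}\big|\mathfrak a_T\partial_\theta\mathcal H_T(\theta^*,\tau)-\mathfrak a_T\partial_\theta\mathcal H_T(\theta^*,\tau_0)\big|\xrightarrow{P}0$ and $$\Big(\mathfrak a_T\partial_\theta\mathcal H_T(\theta^*,\tau_0),\ (\mathfrak a_{i,T}\xi_{i,T})_{i\in\mathcal J_1},\ (\mathfrak a_{k,T}^{q_k\rho_k}\xi_{k,T})_{k\in\mathcal J_0}\Big)\xrightarrow{d_s(\mathcal G)}\Big(\Delta(\theta^* ),(c_i)_{i\in\mathcal J_1},(d_k)_{k\in\mathcal J_0}\Big)$$ in $\mathbb R^{\mathsf p}\times\mathbb R^{|\mathcal J_1|}\times\mathbb R^{|\mathcal J_0|}$. Also, for any positive sequence $\delta_T\to0$, $$\sup_{(\theta,\tau)\in\overline{\mathcal N}\times\mathcal T,\ |\theta-\theta^*|<\delta_T}\big\|\mathfrak a_T\partial_\theta^2\mathcal H_T(\theta,\tau)\mathfrak a_T+\Gamma(\theta^* )\big\|\xrightarrow{P}0.$$ [C3] $\Gamma(\theta^* )$ is almost surely positive definite. [C4] For each $i\in\mathcal J_1$, $\xi_{i,T}\,\mathfrak b_T^{-1}\xrightarrow{P}0$.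 [C5] For any $k\in\mathcal J_0$, if $\rho_k>1$, then $d_k>0$ a.s. [A3] $\displaystyle U\supset\bigcap_{N=1}^\infty\overline{\bigcup_{T\ge N}U_T}$. [A4] For the continuous random field $$\mathbb Z(u)=\exp\Big\{\Delta(\theta^* )[bu]-\frac12\Gamma(\theta^* )\big[(bu)^{\otimes2}\big]-\sum_{i\in\mathcal J_1}c_i\frac{d}{dx}p_i(\theta_i^* )u_i-\sum_{k\in\mathcal J_0}d_k|u_k|^{q_k}\Big\}\quad(u\in\mathbb R^{\mathsf p}),$$ there exists a $U$-valued random variable $\hat u$ such that with probability $1$, $\mathbb Z(\hat u)=\sup_{u\in U}\mathbb Z(u)$, and with probability $1$, $\mathbb Z(u)<\mathbb Z(\hat u)$ for all $u\in U$ with $u\ne\hat u$. Then $$\hat u_T\xrightarrow{d_s(\mathcal G)}\hat u.$$ Moreover, assume in addition [A5] for the continuous random field $$\mathbb V_T(u)=\exp\Big\{\Delta_T(\theta^*,\hat\tau_T)[bu]-\frac12\Gamma(\theta^* )\big[(bu)^{\otimes2}\big]-\sum_{i\in\mathcal J_1}\mathfrak a_{i,T}\xi_{i,T}\frac{d}{dx}p_i(\theta_i^* )u_i-\sum_{k\in\mathcal J_0}\mathfrak a_{k,T}^{q_k\rho_k}\xi_{k,T}|u_k|^{q_k}\Big\}\quad(u\in\mathbb R^{\mathsf p}),$$ with $\Delta_T(\theta^*,\cdot)=\mathfrak a_T\partial_\theta\mathcal H_T(\theta^*,\cdot)$, that is: there exist $T_0\in\mathbb T$ and $U$-valued random variables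 $\hat v_T$ ($T\in\mathbb T$, $T\ge T_0$) such that with probability $1$, $\mathbb V_T(\hat v_T)=\sup_{u\in U}\mathbb V_T(u)$, and such that $\{\hat v_T\}_{T\ge T_0}$ is tight. Then $$\hat u_T-\hat v_T=o_P(1).$$
   Context: $(\Omega,\mathcal F,P)$ is a probability space, $\mathcal G\subset\mathcal F$ a sub-$\sigma$-algebra; $\Theta\subset\mathbb R^{\mathsf p}$, $\mathcal T\subset\mathbb R^{\mathsf q}$ compact, $\Xi=\Theta\times\mathcal T$, $\theta^*\in\Theta$ fixed with components $\theta_j^*$. $\mathbb T\subset\mathbb R$ with $\sup\mathbb T=\infty$; all indices $T$ range over $\mathbb T$, limits are as $T\to\infty$. A continuous random field is a random field continuous in its parameter for each $\omega$. Penalized quasi-log-likelihood: $$\mathbb H_T(\theta,\tau)=\mathcal H_T(\theta,\tau)-\sum_{j\in\mathcal J}\xi_{j,T}\,p_j(\theta_j)-s_T(\tau),\qquad(\theta,\tau)\in\Xi,$$ where $\mathcal H_T:\Omega\times\Xi\to\mathbb R$ is a continuous random field, $s_T:\Omega\times\mathbb R^{\mathsf q}\to[0,\infty)$ is a continuous random field, $\mathcal J\subset\{1,\dots,\mathsf p\}$, $\xi_{j,T}:\Omega\to[0,\infty)$ are random variables, and $p_j:\mathbb R\to[0,\infty)$ ($j\in\mathcal J$) are deterministic continuous functions such that (i) $p_j|_{\mathbb R\setminus\{0\}}$ is $C^1$; (ii) $p_j(x)=0$ iff $x=0$; (iii) there are positive constants $\delta_0,q_j$ with $p_j(x)=|x|^{q_j}$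 for $x\in[-\delta_0,\delta_0]$. Let $\mathcal J_1=\{i\in\mathcal J;\theta_i^*\ne0\}$, $\mathcal J_0=\{k\in\mathcal J;\theta_k^*=0\}$. $\hat\tau_T$ is an arbitrary $\mathcal T$-valued random variable, and $\hat\theta_T$ a $\Theta$-valued random variable asymptotically maximizing $\mathbb H_T(\cdot,\hat\tau_T)$ on $\Theta$, i.e. $P[\mathbb H_T(\hat\theta_T,\hat\tau_T)=\sup_{\theta\in\Theta}\mathbb H_T(\theta,\hat\tau_T)]\to1$. $\mathcal N\subset\mathbb R^{\mathsf p}$ is a bounded open set such that (i) for some $\delta>0$, $\Theta\cap\{|\theta-\theta^*|<\delta\}\subset\overline{\mathcal N}$; (ii) for any $\theta\in\mathcal N$ and $0<t\le1$, $t\theta+(1-t)\theta^*\in\mathcal N$. $\mathcal H_T$ extends to a continuous random field on $\Omega\times\overline{\mathcal N}\times\mathcal T$ with $\mathcal H_T(\omega,\cdot,\tau)\in C^2(\overline{\mathcal N})$ for all $\omega,\tau$ ($C^2$ in $\mathcal N$, derivatives continuously extended to $\overline{\mathcal N}$). $\mathfrak a_{j,T}>0$ ($j=1,\dots,\mathsf p$) are deterministic with $\mathfrak a_{j,T}\to0$; $\mathfrak a_T=\mathrm{diag}(\mathfrak a_{1,T},\dots,\mathfrak a_{\mathsf p,T})$; $\mathfrak b_T=\lambda_{\min}[(\mathfrak a_T'\mathfrak a_T)^{-1}]$ (minimum eigenvalue). $\mathcal Y_T(\theta,\tau)=\mathfrak b_T^{-1}(\mathcal H_T(\theta,\tau)-\mathcal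 H_T(\theta^*,\tau))$, and $\mathcal Y:\Omega\times\Theta\to\mathbb R$ is a continuous random field. $\Delta(\theta^* )$ is an $\mathbb R^{\mathsf p}$-valued random variable; $\Gamma(\theta^* )$ a $\mathcal G$-measurable random $\mathsf p\times\mathsf p$ matrix; $\rho_k\ge1$ ($k\in\mathcal J_0$) are constants; $c_i:\Omega\to[0,\infty)$ ($i\in\mathcal J_1$) and $d_k:\Omega\to[0,\infty)$ ($k\in\mathcal J_0$) are random variables. $a_T$ is the diagonal matrix with $(a_T)_{jj}=\mathfrak a_{j,T}$ for $j\notin\mathcal J_0$ and $(a_T)_{jj}=\mathfrak a_{j,T}^{\rho_j}$ for $j\in\mathcal J_0$; $b$ is the diagonal $\mathsf p\times\mathsf p$ matrix with $(b)_{jj}=1$ for $j\notin\mathcal J_0$ and $(b)_{jj}=1_{\{\rho_j=1\}}$ for $j\in\mathcal J_0$. Put $$U_T=\{u\in\mathbb R^{\mathsf p};\theta^*+a_Tu\in\Theta\},\quad U=\bigcap_{\delta>0}\bigcup_{N=1}^\infty\bigcap_{T\ge N}U_T^{\,\delta},\quad\hat u_T=a_T^{-1}(\hat\theta_T-\theta^* ),$$ with $A^\delta=\{x;\inf_{a\in A}|x-a|<\delta\}$. Notation: $v[u]=\sum_iv_iu_i$, $M[u^{\otimes2}]=u'Mu$, $\|A\|=\{\mathrm{Tr}(AA')\}^{1/2}$. $Y_T\xrightarrow{d_s(\mathcal G)}Y$ means $E[f(Y_T)Z]\to E[f(Y)Z]$ for every bounded continuous $f$ and every bounded $\mathcal G$-measurable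 random variable $Z$. *)

(* Defs.v *)
From HB Require Import structures.
From mathcomp Require Import all_boot all_order all_algebra.
From mathcomp Require Import all_classical all_reals all_analysis.

Set Implicit Arguments.
Unset Strict Implicit.
Unset Printing Implicit Defensive.

Import Order.TTheory GRing.Theory Num.Theory.
Import numFieldNormedType.Exports.

Local Open Scope classical_set_scope.
Local Open Scope ring_scope.

(* Points of R^p are row vectors 'rV[R]_p, so a matrix acts on the right:
   the vector written A u on paper is u *m A^T, which is u *m A for the
   diagonal matrices a_T and b. *)

Section Euclidean.
Context {R : realType}.

Definition dotv {p : nat} (v u : 'rV[R]_p) : R := \sum_i v 0 i * u 0 i.

Definition quad {p : nat} (M : 'M[R]_p) (u : 'rV[R]_p) : R :=
  (u *m M *m u^T) 0 0.

(* Serves also as the Euclidean norm of row vectors (fnorm_rowE); the norm that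
   the library puts on matrices is the sup norm. *)
Definition fnorm {m n : nat} (A : 'M[R]_(m, n)) : R := Num.sqrt (\tr (A *m A^T)).

Lemma fnorm_rowE {p : nat} (v : 'rV[R]_p) :
  fnorm v = Num.sqrt (\sum_i v 0 i ^+ 2).
Proof.
rewrite /fnorm /mxtrace big_ord1 mxE; congr Num.sqrt.
by apply: eq_bigr => i _; rewrite !mxE expr2.
Qed.

(* Used on symmetric matrices only, whose eigenvalues are all real. *)
Definition lambda_min {p : nat} (A : 'M[R]_p) : R :=
  inf [set x : R | eigenvalue A x].

Definition posdef {p : nat} (M : 'M[R]_p) : Prop :=
  forall u : 'rV[R]_p, u != 0 -> 0 < quad M u.

(* The infimum is taken in \bar R, so that set0 has an empty enlargement. *)
Definition enlarge {p : nat} (delta : R) (A : set 'rV[R]_p) : set 'rV[R]_p :=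
  [set x | (ereal_inf [set (fnorm (x - a))%:E | a in A] < delta%:E)%E].

(* f is C^2 in the open set N, with gradient g and Hessian h there, and g and h
   are the continuous extensions of these derivatives to the closure of N. *)
Definition C2_closure {p : nat} (N : set 'rV[R]_p) (f : 'rV[R]_p -> R)
    (g : 'rV[R]_p -> 'rV[R]_p) (h : 'rV[R]_p -> 'M[R]_p) : Prop :=
  [/\ forall x j, N x -> is_derive x (delta_mx 0 j) f (g x 0 j),
      forall x i j, N x ->
        is_derive x (delta_mx 0 i) (fun y => g y 0 j) (h x i j),
      {within closure N, continuous f},
      {within closure N, continuous g} &
      {within closure N, continuous h}].

Definition at_infty (TT : set R) : set_system R := within TT (pinfty_nbhs R).

Lemma at_infty_proper (TT : set R) :
  ereal_sup [set T%:E | T in TT] = +oo%E -> ProperFilter (at_infty TT).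
Proof.
move=> TToo; apply: Build_ProperFilter_ex.
move=> A [M [_ MA]].
have : (M%:E < ereal_sup [set T%:E | T in TT])%E by rewrite TToo ltry.
move=> /ereal_sup_gt [_ [T TTT <-]]; rewrite lte_fin => MT.
by exists T; exact: MA.
Qed.

End Euclidean.

Section Probability.
Context {R : realType} {d : measure_display} {Omega : measurableType d}.

Definition random_element {d' : measure_display} {S : measurableType d'}
    {E : ptopologicalType} (X : S -> E) : Prop :=
  measurable_fun [set: S] (X : S -> g_sigma_algebraType (@open E)).

Definition continuous_random_field {E : topologicalType} (D : set E)
    (f : Omega -> E -> R) : Prop :=
  (forall x, D x -> measurable_fun [set: Omega] (f ^~ x)) /\
  (forall w, {within D, continuous (f w)}).

(* Convergence to 0 in probability.  The outer probability mu_ext P coincides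
   with P on measurable events (measurable_mu_extE); it gives a meaning to the
   condition for suprema over uncountable sets whose measurability is not
   guaranteed, where the value of P itself would be meaningless. *)
Definition cvg_prob0 (P : probability Omega R) (F : set_system R)
    (X : R -> Omega -> \bar R) : Prop :=
  forall eps : R, 0 < eps ->
    mu_ext P [set w | (eps%:E <= `|X T w|)%E] @[T --> F] --> 0%E.

Definition cvg_ds (P : probability Omega R) (G : set (set Omega))
    (F : set_system R) {E : topologicalType} (Y : R -> Omega -> E)
    (Yoo : Omega -> E) : Prop :=
  forall (f : E -> R) (Z : Omega -> R),
    continuous f -> (exists M : R, forall x, `|f x| <= M) ->
    measurable_fun [set: g_sigma_algebraType G]
      (Z : g_sigma_algebraType G -> R) ->
    (exists M : R, forall w, `|Z w| <= M) ->
    ('E_P[(fun w => f (Y T w) * Z w)%R])%E @[T --> F] -->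
      ('E_P[(fun w => f (Yoo w) * Z w)%R])%E.

Definition tight (P : probability Omega R) (I : set R) {E : topologicalType}
    (X : R -> Omega -> E) : Prop :=
  forall eps : R, 0 < eps ->
    exists2 K : set E, compact K &
      forall T, I T -> (P [set w | ~ K (X T w)] <= eps%:E)%E.

End Probability.

Section PenalizedQuasiLikelihood.
Context {R : realType} {p : nat}.
Implicit Types (J : {set 'I_p}) (th thstar u : 'rV[R]_p) (rho qe : 'I_p -> R).

Definition J1 J thstar : {set 'I_p} := [set j in J | thstar 0 j != 0]%SET.
Definition J0 J thstar : {set 'I_p} := [set j in J | thstar 0 j == 0]%SET.

Definition penalized {Omega : Type} {q : nat} J
    (H : R -> Omega -> 'rV[R]_p -> 'rV[R]_q -> R)
    (xi : R -> 'I_p -> Omega -> R) (pen : 'I_p -> R -> R)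
    (s : R -> Omega -> 'rV[R]_q -> R)
    (T : R) (w : Omega) th (tau : 'rV[R]_q) : R :=
  H T w th tau - \sum_(j in J) xi T j w * pen j (th 0 j) - s T w tau.

Definition penalty_axioms (pj : R -> R) (qj delta0 : R) : Prop :=
  [/\ continuous pj /\ (forall x, 0 <= pj x),
      forall x, x != 0 -> derivable pj x 1 /\ {for x, continuous (derive1 pj)},
      forall x, pj x = 0 <-> x = 0 &
      forall x, - delta0 <= x <= delta0 -> pj x = `|x| `^ qj].

(* aa T is the row of the deterministic rates, i.e. the diagonal of the matrix
   diag(a_{1,T}, ..., a_{p,T}). *)
Definition bT (aa : R -> 'rV[R]_p) (T : R) : R :=
  lambda_min (invmx ((diag_mx (aa T))^T *m diag_mx (aa T))).

Definition amx J thstar rho (aa : R -> 'rV[R]_p) (T : R) : 'M[R]_p :=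
  diag_mx (\row_j (if j \in J0 J thstar then aa T 0 j `^ rho j else aa T 0 j)).

Definition bmx J thstar rho : 'M[R]_p :=
  diag_mx (\row_j (if j \in J0 J thstar then (rho j == 1)%:R else 1)).

Definition UT (Theta : set 'rV[R]_p) J thstar rho (aa : R -> 'rV[R]_p) (T : R)
    : set 'rV[R]_p :=
  [set u | Theta (thstar + u *m amx J thstar rho aa T)].

Definition Ulim (TT : set R) (V : R -> set 'rV[R]_p) : set 'rV[R]_p :=
  \bigcap_(delta in [set delta : R | 0 < delta])
  \bigcup_(N in [set N : nat | (1 <= N)%N])
  \bigcap_(T in [set T | TT T /\ N%:R <= T]) enlarge delta (V T).

Definition Ulimsup (TT : set R) (V : R -> set 'rV[R]_p) : set 'rV[R]_p :=
  \bigcap_(N in [set N : nat | (1 <= N)%N])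
  closure (\bigcup_(T in [set T | TT T /\ N%:R <= T]) V T).

(* The common shape of the fields Z and V_T, as a function of the values of
   the linear coefficient Delta, of Gamma and of the penalty coefficients. *)
Definition quasi_field J thstar rho (pen : 'I_p -> R -> R) qe
    (Delta : 'rV[R]_p) (Gamma : 'M[R]_p) (c d : 'I_p -> R) u : R :=
  expR (dotv Delta (u *m bmx J thstar rho)
        - 2^-1 * quad Gamma (u *m bmx J thstar rho)
        - \sum_(i in J1 J thstar) c i * derive1 (pen i) (thstar 0 i) * u 0 i
        - \sum_(k in J0 J thstar) d k * `|u 0 k| `^ qe k).

End PenalizedQuasiLikelihood.

(* Main.v *)
Require Import Defs.
From HB Require Import structures.
From mathcomp Require Import all_boot all_order all_algebra.
From mathcomp Require Import all_classical all_reals all_analysis.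
From mathcomp Require Import ring lra.
From mathcomp Require Import measurable_realfun.

(** The logarithm of the limit field is a scalar product s.psi(u), where s lists
the random coefficients (Delta, c, d and Gamma) and psi(u) the functions of u that
they multiply ([dotv_psi]). Let sT list the same coefficients before the limit,
with Gamma itself as its last component. The theorem holds because, on bounded
sets and with large probability, the rescaled estimator nearly maximizes sT.psi
over U, while uhat is the only maximizer of s.psi over U and sT converges stably
to s.

No weak convergence of random fields is needed to conclude from this
([stable_argmax]). Take f continuous and bounded, and let K be the intersection of
U with a large ball. The penalized maximum

  max_K (f + n s.psi) - n max_K s.psi

is a bounded and continuous function of s, and decreases as n grows, to
f(uhat) when uhat is the only maximizer of s.psi over K. On the other hand it is
at least f(a) minus a small error when a is a near-maximizer. Taking expectations
with a nonnegative G-measurable weight, then the limit in T, then n large, gives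
one inequality between the limit of E[f(.)Z] and E[f(uhat)Z]; the other one follows
with - f. The passage to the limit requires the stable convergence of sT, whose
last component is the G-measurable Gamma: on each event where Gamma is almost
constant it can be frozen, and the indicator of the event joins the weight
([stable_joint]).

The near-maximization ([near_maximizer_estimator]) is obtained as follows.
- The estimator is consistent, since the normalized criterion converges to a
  field that is negative away from the true value, and the penalties of the
  nonzero components are negligible after normalization ([consistency]).
- Along the segment from the true value, which stays in N because N is
  star-shaped, Taylor's formula and the convergence of the Hessian to - Gamma
  expand the quasi-log-likelihood; penalties are linearized at nonzero components
  and are exact powers at the others ([expansion]).
- At the estimator the criterion is at least its value at the true parameter. As
  Gamma is positive definite, this bounds the deviation at the rates of the score;
  then the penalties with a positive limit bound the components with an
  accelerated rate ([tight_estimator]). On bounded sets of these coordinates the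
  expansion becomes sT.psi, since the score and the information no longer see the
  accelerated components in the limit ([approximation]).
- The local parameter sets converge to U on bounded sets: the definition of U
  gives one half, and the inclusion of the outer limit in U gives the other
  ([near_sub_Ulim], [near_Ulim_sub]).

For the last claim, the maximizers of the fields V_T are also near-maximizers of
sT.psi over U, because replacing tau_0 by the estimated nuisance parameter changes
the score by a negligible amount. The pair of the two estimators therefore nearly
maximizes sT.psi(u) + sT.psi(v) over U x U, and converges stably to (uhat, uhat) by
the same abstract result, so that the difference tends to 0 in probability. *)

Set Implicit Arguments.
Unset Strict Implicit.
Unset Printing Implicit Defensive.

Import Order.TTheory GRing.Theory Num.Theory.
Import numFieldNormedType.Exports.

Local Open Scope classical_set_scope.
Local Open Scope ring_scope.

(** * Coordinates, continuity and compactness *)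

Section Coordinates.
Context {R : realType}.

Lemma mx_coord_le m n (x : 'M[R]_(m, n)) i j : `|x i j| <= `|x|.
Proof. by rewrite -[leRHS]/(mx_norm x) mx_normrE; exact: (le_bigmax _ (fun ij => `|x ij.1 ij.2|) (i, j)). Qed.

Lemma mx_norm_le m n (x : 'M[R]_(m, n)) r :
  0 <= r -> (forall i j, `|x i j| <= r) -> `|x| <= r.
Proof.
by move=> r0 xr; rewrite -[leLHS]/(mx_norm x) mx_normrE; apply/bigmax_leP; split.
Qed.

Lemma row_norm_le n (x : 'rV[R]_n) r :
  0 <= r -> (forall j, `|x 0 j| <= r) -> `|x| <= r.
Proof. by move=> r0 xr; apply: mx_norm_le => // i j; rewrite ord1. Qed.

Lemma dotv_le n (s v : 'rV[R]_n) : `|dotv s v| <= n%:R * (`|s| * `|v|).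
Proof.
rewrite /dotv (le_trans (ler_norm_sum _ _ _))//.
rewrite -[n in n%:R]card_ord -sumr_const mulr_suml ler_sum// => i _.
by rewrite normrM mul1r ler_pM// mx_coord_le.
Qed.

Lemma dotvBl n (s s' v : 'rV[R]_n) : dotv (s - s') v = dotv s v - dotv s' v.
Proof.
by rewrite /dotv -sumrB; apply: eq_bigr => i _; rewrite !mxE mulrBl.
Qed.

Lemma dotvBr n (s v v' : 'rV[R]_n) : dotv s (v - v') = dotv s v - dotv s v'.
Proof.
by rewrite /dotv -sumrB; apply: eq_bigr => i _; rewrite !mxE mulrBr.
Qed.

Lemma compact_norm_le n (r : R) : compact [set x : 'rV[R]_n | `|x| <= r].
Proof.
apply: bounded_closed_compact.
  by exists r; split; [exact: num_real | move=> M rM x /= /le_trans; apply; exact: ltW].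
apply: (@closed_comp _ _ (fun x : 'rV[R]_n => `|x|) [set t | t <= r]).
  by move=> x _; exact: norm_continuous.
exact: closed_le.
Qed.

Lemma cvg_row (I : Type) (F : set_system I) {FF : Filter F} n
    (f : I -> 'rV[R]_n) (l : 'rV[R]_n) :
  (forall j, f i 0 j @[i --> F] --> l 0 j) -> f i @[i --> F] --> l.
Proof.
move=> h; apply/cvgrPdist_le => e e0.
have : forall j, \forall i \near F, `|l 0 j - f i 0 j| <= e.
  by move=> j; move/cvgrPdist_le : (h j); exact.
move=> /filter_forall; apply: filterS => i H.
by apply: row_norm_le; [exact: ltW | move=> j; rewrite !mxE].
Qed.

Lemma cvg_sumr (I : Type) (F : set_system I) {FF : Filter F} (J : Type)
    (r : seq J) (C : pred J) (f : J -> I -> R) (l : J -> R) :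
  (forall j, C j -> f j i @[i --> F] --> l j) ->
  \sum_(j <- r | C j) f j i @[i --> F] --> \sum_(j <- r | C j) l j.
Proof.
move=> fl; elim: r => [|j r IH].
  by rewrite big_nil; under eq_fun do rewrite big_nil; exact: cvg_cst.
rewrite big_cons; under eq_fun do rewrite big_cons.
case: ifP => Cj //; apply: cvgD => //; exact: fl.
Qed.

End Coordinates.

Section RealContinuity.
Context {R : realType} {E : topologicalType}.
Implicit Types f g : E -> R.

Lemma continuous_add f g :
  continuous f -> continuous g -> continuous (fun x => f x + g x).
Proof. by move=> cf cg x; apply: cvgD; [exact: cf | exact: cg]. Qed.

Lemma continuous_sub f g :
  continuous f -> continuous g -> continuous (fun x => f x - g x).
Proof. by move=> cf cg x; apply: cvgB; [exact: cf | exact: cg]. Qed.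

Lemma continuous_mul f g :
  continuous f -> continuous g -> continuous (fun x => f x * g x).
Proof. by move=> cf cg x; apply: cvgM; [exact: cf | exact: cg]. Qed.

Lemma continuous_const (V : topologicalType) (c : V) :
  continuous (fun _ : E => c).
Proof. by move=> x; exact: cvg_cst. Qed.

Lemma continuous_bigsum (J : Type) (r : seq J) (C : pred J) (f : J -> E -> R) :
  (forall j, C j -> continuous (f j)) ->
  continuous (fun x => \sum_(j <- r | C j) f j x).
Proof. by move=> cf x; apply: cvg_sumr => j Cj; exact: cf. Qed.

Lemma continuous_norm (V : normedModType R) (f : E -> V) :
  continuous f -> continuous (fun x => `|f x|).
Proof. by move=> cf x; apply: cvg_norm; exact: cf. Qed.

Lemma continuous_coord m n (f : E -> 'M[R]_(m, n)) i j :
  continuous f -> continuous (fun x => f x i j).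
Proof.
move=> cf x; apply: (@continuous_comp _ _ _ f (fun v => v i j)); first exact: cf.
exact: coord_continuous.
Qed.

Lemma continuous_row n (f : E -> 'rV[R]_n) :
  (forall j, continuous (fun x => f x 0 j)) -> continuous f.
Proof. by move=> cf x; apply: cvg_row => j; exact: cf. Qed.

End RealContinuity.

Lemma lipschitz_continuous {R : realType} (E V : normedModType R) (f : E -> V)
    (L : R) :
  0 <= L -> (forall s t, `|f s - f t| <= L * `|s - t|) -> continuous f.
Proof.
move=> L0 HL s; apply/cvgrPdist_lt => e e0.
have L1 : 0 < L + 1 by rewrite ltr_wpDl.
have : \forall t \near s, `|s - t| < e / (L + 1).
  by apply: (@cvgr_dist_lt _ _ _ _ _ id) => //; rewrite divr_gt0.
apply: filterS => t; rewrite ltr_pdivlMr// => st.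
apply: le_lt_trans (HL _ _) _; apply: le_lt_trans st.
by rewrite mulrC ler_wpM2l// lerDl.
Qed.

Section Compactness.
Context {R : realType}.

Lemma within_continuousP (E : normedModType R) (D : set E) (f : E -> R) :
  {within D, continuous f} -> forall x, D x -> forall e, 0 < e ->
  exists2 dl, 0 < dl & forall y, D y -> `|x - y| < dl -> `|f x - f y| < e.
Proof.
move=> cf x Dx e e0.
move/subspace_continuousP: cf => /(_ x Dx) /cvgrPdist_lt/(_ e e0).
rewrite near_withinE near_simpl => /nbhs_ballP[dl/= dl0 H].
by exists dl => // y Dy xy; apply: H => //; rewrite -ball_normE.
Qed.

(** Finite nets: the form of total boundedness used to discretize random elements
of a compact set. *)
Lemma compact_net (E : normedModType R) (D : set E) (e : R) :
  compact D -> 0 < e ->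
  exists2 s : seq E, (forall x, x \in s -> D x) &
    forall y, D y -> exists2 x, x \in s & `|x - y| < e.
Proof.
rewrite compact_cover => cD e0.
have [||D' D'D covD] := cD _ D (fun x => ball x e).
- by move=> x _; exact: ball_open.
- by move=> x Dx; exists x => //; exact: ballxx.
exists (finmap.enum_fset D').
  by move=> x xD'; have := D'D x xD'; rewrite inE.
move=> y /covD[x xD' xy]; exists x => //.
by move: xy; rewrite -ball_normE.
Qed.

(** The union of finite nets at all scales 1/(k+1), enumerated by coding pairs
(scale, position) as integers. *)
Lemma compact_dense_seq (E : normedModType R) (D : set E) :
  compact D -> D !=set0 ->
  exists2 s : nat -> E, (forall n, D (s n)) &
    forall y, D y -> forall e, 0 < e -> exists n, `|s n - y| < e.
Proof.
move=> cD [x0 Dx0].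
have /choice[net netP] : forall n : nat, exists s : seq E,
    (forall x, x \in s -> D x) /\
    forall y, D y -> exists2 x, x \in s & `|x - y| < n.+1%:R^-1.
  move=> n; have n0 : 0 < n.+1%:R^-1 :> R by rewrite invr_gt0.
  by have [s s1 s2] := compact_net cD n0; exists s.
pose s n := if unpickle n is Some (k, i) then nth x0 (net k) i else x0.
exists s.
  move=> n; rewrite /s; case: unpickle => [[k i]|//].
  have [ik|ik] := ltnP i (size (net k)); last by rewrite nth_default.
  by apply: (netP k).1; exact: mem_nth.
move=> y Dy e e0; have [k ke] := ltr_add_invr e0.
have [x xk xy] := (netP k).2 y Dy.
exists (pickle (k, index x (net k))).
rewrite /s pickleK nth_index//; apply: (lt_trans xy).
by rewrite add0r in ke.
Qed.

(** The Heine-Cantor theorem. Only x is confined to K, since a near-maximizer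
close to a bounded point need not lie in the same bounded set. *)
Lemma compact_unif_continuous (E F : normedModType R) (K : set E) (f : E -> F) :
  compact K -> continuous f -> forall e, 0 < e ->
  exists2 dl, 0 < dl & forall x y, K x -> `|x - y| < dl -> `|f x - f y| < e.
Proof.
move=> cK cf e e0.
have near_dl : \forall dl \near (0 : R)^'+,
    K `<=` (fun x => forall y, `|x - y| < dl -> `|f x - f y| < e).
  apply: (compact_near_coveringP K).1 => //.
  move=> x _; have /cvgrPdist_lt/(_ (e / 2)) := cf x.
  rewrite divr_gt0// => /(_ isT)/nbhs_ballP[d d0 H].
  have d20 : 0 < d / 2 by rewrite divr_gt0.
  exists (ball x (d / 2), [set t | t < d / 2]) => /=.
    split; first exact: nbhsx_ballx.
    exact: nbhs_right_lt.
  move=> [x' dl]/= [xx' dld] y x'y.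
  rewrite (splitr e) (le_lt_trans (ler_distD (f x) _ _))// ltrD//.
    rewrite distrC; apply: H; apply: le_ball xx'.
    by rewrite ler_pdivrMr// ler_peMr ?ler1n// ltW.
  apply: H; rewrite -ball_normE/= (splitr d).
  rewrite (le_lt_trans (ler_distD x' _ _))// ltrD//.
    by move: xx'; rewrite -ball_normE.
  exact: lt_trans dld.
have [dl [dl0 Kdl]] : exists dl, 0 < dl /\
    K `<=` (fun x => forall y, `|x - y| < dl -> `|f x - f y| < e).
  apply: (@filter_ex _ (0 : R)^'+); apply: filterI => //; exact: nbhs_right_gt.
by exists dl => // x y Kx; exact: Kdl.
Qed.

End Compactness.

Lemma within_continuous_open (E V : topologicalType) (N D : set E) (u : E -> V) x :
  open N -> N `<=` D -> {within D, continuous u} -> N x -> u y @[y --> x] --> u x.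
Proof.
move=> oN ND cu Nx.
move/subspace_continuousP : cu => /(_ x (ND _ Nx)).
by rewrite within_interior//; apply: (filterS ND); exact: open_nbhs_nbhs.
Qed.

(** For segments issued from the vertex of a star-shaped set: the vertex may lie on
the boundary, where continuity is only relative to the closure D. *)
Lemma within_continuous_line {R : realType} (E : normedModType R) (D : set E)
    (u : E -> R) (z v : E) (I : set R) :
  {within D, continuous u} -> (forall t, I t -> D (z + t *: v)) ->
  {within I, continuous (fun t => u (z + t *: v))}.
Proof.
move=> cu ID; apply/subspace_continuousP => t It; apply/cvgrPdist_lt => e e0.
have [dl dl0 H] := within_continuousP cu (ID t It) e0.
have v0 : 0 < `|v| + 1 by rewrite ltr_wpDl.
rewrite near_withinE; near=> t'; move=> It'.
apply: H; first exact: ID.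
rewrite opprD addrACA subrr add0r -scalerBl normrZ.
have : `|t - t'| < dl / (`|v| + 1).
  by near: t'; apply: (@cvgr_dist_lt _ _ _ _ _ id) => //; rewrite divr_gt0.
rewrite ltr_pdivlMr//; apply: le_lt_trans.
by rewrite ler_wpM2l// lerDl.
Unshelve. all: by end_near. Qed.

Lemma continuous_compose (E1 E2 E3 : topologicalType) (u : E1 -> E2) (v : E2 -> E3) :
  continuous u -> continuous v -> continuous (fun x => v (u x)).
Proof. by move=> cu cv x; apply: continuous_comp; [exact: cu | exact: cv]. Qed.

(** * Measurability of random fields *)

Section Measurability.
Context {R : realType} {d : measure_display} {S : measurableType d}.

(** The value selected at w is the first point of a finite net within e of X w, so
that the events where it is constant are Boolean combinations of events on the
distances to X. *)
Lemma discretize (E : normedModType R) (D : set E) (X : S -> E) (e : R) :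
  compact D -> D !=set0 -> (forall w, D (X w)) ->
  (forall x r, measurable [set w | `|x - X w| < r]) -> 0 < e ->
  exists (m : nat) (x : nat -> E) (k : S -> nat),
    [/\ forall w, (k w < m)%N, forall i, measurable [set w | k w = i],
        forall i, D (x i) & forall w, `|x (k w) - X w| < e].
Proof.
move=> cD [x0 Dx0] DX mX e0; have [s sD snet] := compact_net cD e0.
pose k w := find (fun x => `|x - X w| < e) s.
have kP w : has (fun x => `|x - X w| < e) s.
  by apply/hasP; have [x xs xe] := snet _ (DX w); exists x.
exists (size s), (fun i => nth x0 s i), k; split.
- by move=> w; rewrite -has_find.
- move=> i; rewrite /k; elim: s i {sD snet k kP} => [|x s IH] i /=.
    case: i => [|i].
      by rewrite (_ : mkset _ = setT)//; apply/seteqP; split.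
    by rewrite (_ : mkset _ = set0)//; apply/seteqP; split.
  case: i => [|i].
    rewrite (_ : mkset _ = [set w | `|x - X w| < e])//.
    by apply/seteqP; split => w /=; case: ifP.
  rewrite (_ : mkset _ = ~` [set w | `|x - X w| < e] `&`
      [set w | find (fun x => `|x - X w| < e) s = i]).
    by apply: measurableI => //; exact: measurableC.
  apply/seteqP; split => w /=; first by case: ifP => // _ [<-].
  by move=> [/negP/negbTE -> ->].
- move=> i; have [si|si] := ltnP i (size s); last by rewrite nth_default.
  by apply: sD; exact: mem_nth.
- by move=> w; exact: (nth_find x0 (kP w)).
Qed.

Lemma measurable_fun_index (m : nat) (k : S -> nat) (h : nat -> S -> R) :
  (forall w, (k w < m)%N) -> (forall i, measurable [set w | k w = i]) ->
  (forall i, measurable_fun [set: S] (h i)) ->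
  measurable_fun [set: S] (fun w => h (k w) w).
Proof.
move=> km mk mh _ B mB; rewrite setTI.
rewrite (_ : _ @^-1` B = \bigcup_i ([set w | k w = i] `&` (h i @^-1` B))).
  apply: bigcup_measurable => i _; apply: measurableI => //.
  by rewrite -[X in measurable X]setTI; exact: mh.
apply/seteqP; split => w /=; first by move=> Bw; exists (k w).
by move=> [i _ /= [<-]].
Qed.

(** The Caratheodory property: the random parameter is approximated by finitely
valued ones, at which measurability is that of the field at fixed points, and
continuity of the field gives the limit. *)
Lemma measurable_caratheodory (E : normedModType R) (D : set E)
    (f : S -> E -> R) (X : S -> E) :
  compact D -> (forall w, D (X w)) ->
  (forall x r, measurable [set w | `|x - X w| < r]) ->
  continuous_random_field D f ->
  measurable_fun [set: S] (fun w => f w (X w)).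
Proof.
move=> cD DX mX [mf cf].
have [D0|/set0P/negP/negPn/eqP D0] := pselect (D !=set0); last first.
  by move=> _ B mB; rewrite (_ : _ `&` _ = set0)//; apply/seteqP; split => w //=;
    have := DX w; rewrite D0.
have /choice[h hP] : forall n : nat, exists h : S -> R,
    measurable_fun [set: S] h /\ forall w, exists2 x, D x &
      `|x - X w| < n.+1%:R^-1 /\ h w = f w x.
  move=> n; have n0 : 0 < n.+1%:R^-1 :> R by rewrite invr_gt0.
  have [m [x [k [km mk Dx xk]]]] := discretize cD D0 DX mX n0.
  exists (fun w => f w (x (k w))); split.
    apply: (measurable_fun_index (h := fun i w => f w (x i)) km mk) => i.
    exact: mf.
  by move=> w; exists (x (k w)).
apply: (@measurable_fun_cvg _ _ _ _ h) => [n|w _].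
  exact: (hP n).1.
apply/cvgrPdist_lt => e e0.
have [dl dl0 H] := within_continuousP (cf w) (DX w) e0.
have : \forall n \near \oo, n.+1%:R^-1 < dl :> R.
  exact: near_infty_natSinv_lt (PosNum dl0).
apply: filterS => n ndl; have [x Dx [xX ->]] := (hP n).2 w.
by apply: H => //; rewrite distrC (lt_trans xX).
Qed.

(** Coordinatewise measurability avoids any comparison between the Borel
sigma-algebra of the space of rows and the product sigma-algebra. *)
Definition measurable_row n (X : S -> 'rV[R]_n) :=
  forall j, measurable_fun [set: S] (fun w => X w 0 j).

Lemma measurable_row_dist n (X : S -> 'rV[R]_n) : measurable_row X ->
  forall x r, measurable [set w | `|x - X w| < r].
Proof.
move=> mX x r; have [r0|r0] := ltP 0 r; last first.
  rewrite (_ : mkset _ = set0)//; apply/seteqP; split => w //=.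
  by move=> /(le_lt_trans (normr_ge0 _)); rewrite ltNge r0.
rewrite (_ : mkset _ = \bigcap_(j in [set: 'I_n]) [set w | `|x 0 j - X w 0 j| < r]).
  apply: fin_bigcap_measurable => // j _.
  rewrite -[X in measurable X]setTI.
  have : measurable_fun [set: S] (fun w => `|x 0 j - X w 0 j|).
    apply: measurableT_comp; first exact: normr_measurable.
    by apply: measurable_funB => //; exact: mX.
  move=> /(_ measurableT `]-oo, r[%classic (measurable_itv _)).
  by congr (measurable (_ `&` _)); apply/seteqP; split => w /=; rewrite in_itv.
apply/seteqP; split => w /=.
  by move=> xr j _; apply: le_lt_trans xr; have := mx_coord_le (x - X w) 0 j; rewrite !mxE.
move=> xr; rewrite -[ltLHS]/(mx_norm (x - X w)) mx_normrE.
apply/bigmax_ltP; split => // -[i j] _ /=; rewrite !mxE ord1.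
exact: xr.
Qed.

(** Clipping the coordinates at k brings the argument into a compact box, where
the evaluation of fields applies; the clipping disappears as k grows. *)
Lemma measurable_row_comp n (X : S -> 'rV[R]_n) (f : 'rV[R]_n -> R) :
  measurable_row X -> continuous f -> measurable_fun [set: S] (fun w => f (X w)).
Proof.
move=> mX cf.
pose C k w := \row_j Num.max (- k%:R) (Num.min k%:R (X w 0 j)) : 'rV[R]_n.
have mC k : measurable_row (C k).
  move=> j; under eq_fun do rewrite mxE.
  by apply: measurable_maxr => //; apply: measurable_minr => //; exact: mX.
apply: (@measurable_fun_cvg _ _ _ _ (fun k w => f (C k w))).
  move=> k; apply: (measurable_caratheodory (f := fun _ => f)
    (D := [set x : 'rV[R]_n | `|x| <= k%:R])).
  - exact: compact_norm_le.
  - move=> w; apply: row_norm_le => // j; rewrite mxE.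
    by rewrite ler_norml le_max lexx/= ge_max ge_min lexx -subr_ge0 opprK addr_ge0.
  - exact: measurable_row_dist.
  - split => [x _|w]; first exact: measurable_cst.
    exact: continuous_subspaceT.
move=> w _; apply: cvg_near_cst.
near=> k; congr f; apply/rowP => j; rewrite mxE.
have : `|X w 0 j| <= k%:R.
  rewrite (le_trans (mx_coord_le _ _ _))//; near: k; exact: nbhs_infty_ger.
by rewrite ler_norml => /andP[a b]; rewrite (min_r b) (max_r a).
Unshelve. all: by end_near. Qed.

(** By continuity the quantifier over D reduces to a countable dense set. *)
Lemma measurable_forall_le (E : normedModType R) (D : set E) (f g : S -> E -> R) :
  compact D -> continuous_random_field D f -> continuous_random_field D g ->
  measurable [set w | forall x, D x -> f w x <= g w x].
Proof.
move=> cD [mf cf] [mg cg].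
have [D0|/set0P/negP/negPn/eqP D0] := pselect (D !=set0); last first.
  by rewrite (_ : mkset _ = setT)//; apply/seteqP; split => w //= _ x; rewrite D0.
have [s sD sdense] := compact_dense_seq cD D0.
rewrite (_ : mkset _ = \bigcap_n [set w | f w (s n) <= g w (s n)]).
  apply: bigcap_measurable; first by exists 0%N.
  move=> n _; rewrite -[X in measurable X]setTI.
  have -> : [set w | f w (s n) <= g w (s n)] =
      (fun w => g w (s n) - f w (s n)) @^-1` `[0, +oo[%classic.
    by apply/seteqP; split => w /=; rewrite in_itv/= andbT subr_ge0.
  by apply: measurable_funB => //; [exact: mg | exact: mf].
apply/seteqP; split => w /=; first by move=> H n _; exact: H.
move=> H x Dx; rewrite leNgt; apply/negP; rewrite -subr_gt0 => fg.
have fg2 : 0 < (f w x - g w x) / 2 by rewrite divr_gt0.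
have [d1 d10 H1] := within_continuousP (cf w) Dx fg2.
have [d2 d20 H2] := within_continuousP (cg w) Dx fg2.
have [|n] := sdense x Dx (Num.min d1 d2); first by rewrite lt_min d10.
rewrite distrC lt_min => /andP[n1 n2].
have := H1 _ (sD n) n1; have := H2 _ (sD n) n2; have /= := H n I.
rewrite !ltr_norml => h /andP[a b] /andP[a' b']; lra.
Qed.

End Measurability.

Lemma random_element_coord {R : realType} {d : measure_display}
    {S : measurableType d} m n (X : S -> 'M[R]_(m, n)) i j :
  random_element X -> measurable_fun [set: S] (fun w => X w i j).
Proof.
move=> mX; apply: (measurability _ (@RGenOpens.measurableE R)).
move=> _ [_ [a [b ->] <-]].
suff mB : (@open 'M[R]_(m, n)).-sigma.-measurable
    [set x : 'M[R]_(m, n) | `]a, b[%classic (x i j)].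
  exact: (mX measurableT _ mB).
apply: sub_gen_smallest.
have := @open_comp _ _ (fun x : 'M[R]_(m, n) => x i j) `]a, b[%classic.
apply; last exact: interval_open.
by move=> x _; exact: coord_continuous.
Qed.

Lemma random_element_row {R : realType} {d : measure_display}
    {S : measurableType d} n (X : S -> 'rV[R]_n) :
  random_element X -> measurable_row X.
Proof. by move=> mX j; exact: random_element_coord. Qed.

(** * Events of small outer probability *)

Section HighProbability.
Context {R : realType} {d : measure_display} {Omega : measurableType d}.
Context (P : probability Omega R) (F : set_system R) {FF : Filter F}.
Implicit Types (Q : R -> Omega -> Prop) (B : R -> R -> Omega -> Prop).

(** Outer probabilities are needed because suprema over uncountable parameter
sets occur in these events; monotonicity, subadditivity and the agreement with P
on measurable events are what the calculus below rests on. *)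
Definition whp Q := forall eta : R, 0 < eta ->
  \forall T \near F, (mu_ext P [set w | ~ Q T w] <= eta%:E)%E.

(** The event B r is meant to be increasing in the level r, as |X| <= r is. *)
Definition tightly B := forall eta : R, 0 < eta ->
  \forall r \near +oo, \forall T \near F,
    (mu_ext P [set w | ~ B r T w] <= eta%:E)%E.

Lemma mu_extS (A A' : set Omega) : A `<=` A' -> (mu_ext P A <= mu_ext P A')%E.
Proof. exact: le_mu_ext. Qed.

Lemma mu_extU (A A1 A2 : set Omega) (e1 e2 : R) : A `<=` A1 `|` A2 ->
  (mu_ext P A1 <= e1%:E)%E -> (mu_ext P A2 <= e2%:E)%E ->
  (mu_ext P A <= (e1 + e2)%:E)%E.
Proof.
move=> AA A1e A2e; apply: le_trans (mu_extS AA) _.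
by apply: le_trans (outer_measureU2 _ _ _) _; rewrite EFinD leeD.
Qed.

Lemma mu_ext_negligible (A : set Omega) : P.-negligible A -> mu_ext P A = 0%E.
Proof.
move=> [B [mB PB AB]]; apply/eqP; rewrite eq_le; apply/andP; split.
  by apply: le_trans (mu_extS AB) _; rewrite measurable_mu_extE//; rewrite le_eqVlt; apply/orP; left; apply/eqP; exact: PB.
exact: mu_ext_ge0.
Qed.

Lemma whpS Q Q' : (\forall T \near F, forall w, Q T w -> Q' T w) ->
  whp Q -> whp Q'.
Proof.
move=> QQ' hQ eta /hQ; apply: filterS2 QQ' => T QQ'.
by apply: le_trans; apply: mu_extS => w /=; apply: contra_not; exact: QQ'.
Qed.

Lemma whpI Q Q' : whp Q -> whp Q' -> whp (fun T w => Q T w /\ Q' T w).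
Proof.
move=> hQ hQ' eta eta0; have e20 : 0 < eta / 2 by rewrite divr_gt0.
apply: filterS2 (hQ _ e20) (hQ' _ e20) => T h h'.
rewrite (splitr eta); apply: mu_extU h h'.
by move=> w /= /not_andP.
Qed.

Lemma whpW Q : (\forall T \near F, forall w, Q T w) -> whp Q.
Proof.
move=> hQ eta eta0; apply: filterS hQ => T hQ.
rewrite (_ : mkset _ = set0) ?mu_ext0 ?lee_fin ?ltW//.
by apply/seteqP; split => w //=; have := hQ w.
Qed.

Lemma whp_forall (I : finType) (Q : I -> R -> Omega -> Prop) :
  (forall i, whp (Q i)) -> whp (fun T w => forall i, Q i T w).
Proof.
move=> hQ; suff : forall s : seq I, whp (fun T w => forall i, i \in s -> Q i T w).
  move=> /(_ (enum I)); apply: whpS; apply: nearW => T w H i.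
  by apply: H; rewrite mem_enum.
elim=> [|i s IH]; first exact/whpW/nearW.
apply: whpS (whpI (hQ i) IH); apply: nearW => T w [Qi Qs] j.
by rewrite inE => /predU1P[->|/Qs].
Qed.

Lemma cvg_prob0_whp (X : R -> Omega -> \bar R) : cvg_prob0 P F X <->
  forall e, 0 < e -> whp (fun T w => (`|X T w| < e%:E)%E).
Proof.
split=> h e e0.
  move=> eta eta0; have /fine_cvgP[fin] := h e e0.
  move=> /cvgrPdist_le/(_ _ eta0) cv.
  apply: filterS2 fin cv => T fin.
  rewrite sub0r normrN /= => /ler_normlW cv.
  rewrite (_ : mkset _ = [set w | (e%:E <= `|X T w|)%E]); last first.
    by apply/seteqP; split => w /=; rewrite leNgt => /negP.
  by rewrite -(fineK fin) lee_fin.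
have near_le eta : 0 < eta -> \forall T \near F,
    (mu_ext P [set w | (e%:E <= `|X T w|)%E] <= eta%:E)%E.
  move=> /(h e e0); apply: filterS => T.
  rewrite (_ : mkset _ = [set w | (e%:E <= `|X T w|)%E])//.
  by apply/seteqP; split => w /=; rewrite leNgt => /negP.
apply/fine_cvgP; split.
  apply: filterS (near_le 1 ltr01) => T; rewrite ge0_fin_numE ?mu_ext_ge0//.
  by move=> /le_lt_trans; apply; rewrite ltry.
apply/cvgrPdist_le => eta /near_le; apply: filterS => T h1.
rewrite sub0r normrN ger0_norm ?fine_ge0 ?mu_ext_ge0//=.
have fin : mu_ext P [set w | (e%:E <= `|X T w|)%E] \is a fin_num.
  rewrite ge0_fin_numE ?mu_ext_ge0//.
  by apply: le_lt_trans h1 _; rewrite ltry.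
by rewrite -lee_fin fineK.
Qed.

Lemma tightly_gt0 : tightly (fun r _ _ => 0 < r).
Proof.
move=> eta eta0; have near_0 : \forall r \near +oo, 0 < r :> R.
  by apply: nbhs_pinfty_gt; exact: num_real.
apply: filterS near_0 => r r0; apply: (@whpW (fun _ _ => 0 < r)) => //.
exact: nearW.
Qed.

Lemma tightlyS B B' :
  (\forall r \near +oo, \forall T \near F, forall w, B r T w -> B' r T w) ->
  tightly B -> tightly B'.
Proof.
move=> BB' hB eta /hB; apply: filterS2 BB' => r; apply: filterS2 => T BB'.
by apply: le_trans; apply: mu_extS => w /=; apply: contra_not; exact: BB'.
Qed.

Lemma tightlyI B B' : tightly B -> tightly B' ->
  tightly (fun r T w => B r T w /\ B' r T w).
Proof.
move=> hB hB' eta eta0; have e20 : 0 < eta / 2 by rewrite divr_gt0.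
apply: filterS2 (hB _ e20) (hB' _ e20) => r; apply: filterS2 => T h h'.
rewrite (splitr eta); apply: mu_extU h h'.
by move=> w /= /not_andP.
Qed.

Lemma tightly_forall (I : finType) (B : I -> R -> R -> Omega -> Prop) :
  (forall i, tightly (B i)) -> tightly (fun r T w => forall i, B i r T w).
Proof.
move=> hB; suff : forall s : seq I,
    tightly (fun r T w => forall i, i \in s -> B i r T w).
  move=> /(_ (enum I)); apply: tightlyS; apply: nearW => r; apply: nearW => T w H i.
  by apply: H; rewrite mem_enum.
elim=> [|i s IH].
  move=> eta eta0; apply: nearW => r; apply: (@whpW (fun _ _ => _)) => //.
  by apply: nearW => T w i; rewrite in_nil.
apply: tightlyS (tightlyI (hB i) IH); apply: nearW => r; apply: nearW => T w [Qi Qs] j.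
by rewrite inE => /predU1P[->|/Qs].
Qed.

(** It suffices to argue on each event of a tight family: this is how random
coefficients are treated as if they were bounded by a constant. *)
Lemma whp_tightly B Q : tightly B ->
  (forall r, whp (fun T w => B r T w -> Q T w)) -> whp Q.
Proof.
move=> hB hQ eta eta0; have e20 : 0 < eta / 2 by rewrite divr_gt0.
have [r hr] := filter_ex (hB _ e20).
apply: filterS2 hr (hQ r _ e20) => T h h'.
rewrite (splitr eta); apply: mu_extU h h' => w /= nQ.
by have [Br|nB] := pselect (B r T w); [right => /(_ Br) | left].
Qed.

Lemma tightly_le B (h : R -> Omega -> R) : tightly B ->
  (forall r, exists C, whp (fun T w => B r T w -> h T w <= C)) ->
  tightly (fun r T w => h T w <= r).
Proof.
move=> hB hC eta eta0; have e20 : 0 < eta / 2 by rewrite divr_gt0.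
have [r hr] := filter_ex (hB _ e20); have [C hQ] := hC r.
near=> r'; apply: filterS2 hr (hQ _ e20) => T h1 h2.
rewrite (splitr eta); apply: mu_extU h1 h2 => w /= nh.
have [Br|nB] := pselect (B r T w); last by left.
right => H; have {H}hC' := H Br.
apply: nh; apply: (le_trans hC'); near: r'; apply: nbhs_pinfty_ge; exact: num_real.
Unshelve. all: by end_near. Qed.

(** Continuity of the probability along a decreasing sequence of events. *)
Lemma probability_decreasing (A : nat -> set Omega) :
  (forall n, measurable (A n)) -> {homo A : n m / (n <= m)%N >-> m `<=` n} ->
  P.-negligible (\bigcap_n A n) ->
  forall eta, 0 < eta -> exists n, (P (A n) <= eta%:E)%E.
Proof.
move=> mA dA nA eta eta0.
have mcap : measurable (\bigcap_n A n) by apply: bigcap_measurable => //; exists 0%N.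
have : (P \o A) n @[n --> \oo] --> P (\bigcap_n A n).
  apply: nonincreasing_cvg_mu => //.
  - by rewrite (le_lt_trans (probability_le1 P (mA 0%N))) ?ltry.
  - by move=> n m nm; apply/subsetPset; exact: dA.
rewrite (measure_negligible mcap nA) => /fine_cvgP[fin /cvgrPdist_le/(_ _ eta0) cv].
have [n [finn]] := filter_ex (filterI fin cv).
rewrite sub0r normrN /= => /ler_normlW cvn; exists n.
have -> : P (A n) = (fine ((P \o A) n))%:E by rewrite fineK.
by rewrite lee_fin.
Qed.

(** The bridge from almost sure statements about objects that do not depend on T
to tightness: the bad events A n decrease to a negligible set. *)
Lemma tightly_decreasing (A : nat -> set Omega) B :
  (forall n, measurable (A n)) -> {homo A : n m / (n <= m)%N >-> m `<=` n} ->
  P.-negligible (\bigcap_n A n) ->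
  (forall n r T w, n.+1%:R <= r -> ~ B r T w -> A n w) -> tightly B.
Proof.
move=> mA dA nA BA eta eta0.
have [n nP] := probability_decreasing mA dA nA eta0.
near=> r; apply: nearW => T; rewrite (le_trans _ nP)//.
rewrite -measurable_mu_extE//; apply: mu_extS => w /=; apply: BA.
near: r; apply: nbhs_pinfty_ge; exact: num_real.
Unshelve. all: by end_near. Qed.

Lemma tightly_rv (h : Omega -> R) : measurable_fun [set: Omega] h ->
  tightly (fun r _ w => h w <= r).
Proof.
move=> mh; apply: (@tightly_decreasing (fun n => [set w | n.+1%:R < h w])).
- move=> n; rewrite -[X in measurable X]setTI.
  rewrite (_ : [set w | _] = h @^-1` `]n.+1%:R, +oo[%classic); first exact: mh.
  by apply/seteqP; split => w /=; rewrite in_itv/= andbT.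
- by move=> n m nm w /=; apply: le_lt_trans; rewrite ler_nat.
- rewrite (_ : \bigcap_n _ = set0); first exact: negligible_set0.
  apply/seteqP; split => w //= H.
  have [k hk] : exists k : nat, h w <= k%:R.
    exists (Num.bound `|h w|); rewrite (le_trans (ler_norm _))// ltW//.
    by rewrite archi_boundP.
  by have := H k I; rewrite /= ltNge (le_trans hk)// ler_nat.
- move=> n r T w nr /negP; rewrite -ltNge; exact: le_lt_trans.
Qed.

(** By compactness the maximum over D is attained, hence almost surely negative,
and one of the levels - 1/(n+1) bounds it. *)
Lemma tightly_negative (E : normedModType R) (D : set E) (f : Omega -> E -> R) :
  compact D -> continuous_random_field D f ->
  {ae P, forall w, forall x, D x -> f w x < 0} ->
  tightly (fun r _ w => forall x, D x -> f w x <= - r^-1).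
Proof.
move=> cD cf f0; pose A n := ~` [set w | forall x, D x -> f w x <= - n.+1%:R^-1].
apply: (@tightly_decreasing A).
- move=> n; apply: measurableC; apply: measurable_forall_le => //.
  split => [x _|w]; first exact: measurable_cst.
  by apply: continuous_subspaceT => x; exact: cvg_cst.
- move=> n m nm w /=; apply: contra_not => H x /H /le_trans; apply.
  by rewrite lerN2 lef_pV2 ?posrE// ler_nat.
- apply: negligibleS f0 => w /= Aw H.
  have [D0|/set0P/negP/negPn/eqP D0] := pselect (D !=set0); last first.
    by apply: (Aw 0%N I) => x; rewrite D0.
  have [c] := compact_EVT_max D0 cD (cf.2 w); rewrite inE => Dc cmax.
  have fc : 0 < - f w c by rewrite oppr_gt0; exact: H.
  have [n nfc] := ltr_add_invr fc.
  apply: (Aw n I) => x Dx; rewrite (le_trans (cmax x _)) ?inE//.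
  by rewrite lerNr ltW// -[ltLHS]add0r.
- move=> n r T w nr; apply: contra_not => H x /H /le_trans; apply.
  by rewrite lerN2 lef_pV2 ?posrE// (lt_le_trans _ nr).
Qed.

Lemma whp_probability1 (A : R -> set Omega) :
  (\forall T \near F, measurable (A T)) ->
  P (A T) @[T --> F] --> 1%E -> whp (fun T w => A T w).
Proof.
move=> mA /fine_cvgP[fin cv] eta eta0.
move/cvgrPdist_le : cv => /(_ _ eta0) cv.
apply: filterS3 mA fin cv => T mA fin /= cv.
have mAc := measurableC mA.
apply: (@le_trans _ _ (1 - P (A T))%E).
  by rewrite -(probability_setC P mA) -(measurable_mu_extE P mAc).
rewrite -(fineK fin) -EFinB lee_fin.
by rewrite (le_trans _ cv)// ler_norm.
Qed.

End HighProbability.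

(** * Expectations of bounded random variables *)

Section BoundedExpectation.
Context {R : realType} {d : measure_display} {Omega : measurableType d}.
Context (P : probability Omega R).
Implicit Types f g h Z : Omega -> R.

Definition bounded_rv f :=
  measurable_fun [set: Omega] f /\ exists M, forall w, `|f w| <= M.

Definition Ex f : R := \int[P]_w f w.

Lemma probability_nonempty : [set: Omega] !=set0.
Proof.
apply/set0P/negP => /eqP O0; have := probability_setT P.
by rewrite O0 measure0 => /eqP; rewrite eq_sym onee_eq0.
Qed.

Lemma bounded_rv_integrable f : bounded_rv f -> P.-integrable setT (EFin \o f).
Proof.
move=> [mf [M fM]]; apply: measurable_bounded_integrable => //.
  by rewrite (le_lt_trans (probability_le1 P measurableT)) ?ltry.
exists M; split; first exact: num_real.
by move=> x Mx w _ /=; rewrite (le_trans (fM w))// ltW.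
Qed.

Lemma bounded_rvM f g : bounded_rv f -> bounded_rv g ->
  bounded_rv (fun w => f w * g w).
Proof.
move=> [mf [M fM]] [mg [M' gM]]; split; first exact: measurable_funM.
by exists (M * M') => w; rewrite normrM ler_pM.
Qed.

Lemma bounded_rvD f g : bounded_rv f -> bounded_rv g ->
  bounded_rv (fun w => f w + g w).
Proof.
move=> [mf [M fM]] [mg [M' gM]]; split; first exact: measurable_funD.
by exists (M + M') => w; rewrite (le_trans (ler_normD _ _))// lerD.
Qed.

Lemma bounded_rv_cst c : bounded_rv (fun _ => c).
Proof. by split; [exact: measurable_cst | exists `|c|]. Qed.

Lemma bounded_rv_indic (A : set Omega) : measurable A ->
  bounded_rv (\1_A : Omega -> R).
Proof.
move=> mA; split; first exact: measurable_indic.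
by exists 1 => w; rewrite indicE; case: (w \in A); rewrite ?normr1 ?normr0.
Qed.

Lemma bounded_rv_sum n (f : 'I_n -> Omega -> R) : (forall i, bounded_rv (f i)) ->
  bounded_rv (fun w => \sum_i f i w).
Proof.
elim: n f => [|n IH] f hf.
  by under eq_fun do rewrite big_ord0; exact: bounded_rv_cst.
under eq_fun do rewrite big_ord_recl.
by apply: bounded_rvD => //; apply: IH.
Qed.

Lemma ExE f : bounded_rv f -> 'E_P[f]%E = (Ex f)%:E.
Proof.
move=> /bounded_rv_integrable fi.
by rewrite unlock /Ex /Rintegral fineK//; exact: integrable_fin_num.
Qed.

Lemma ExD f g : bounded_rv f -> bounded_rv g ->
  Ex (fun w => f w + g w) = Ex f + Ex g.
Proof.
by move=> /bounded_rv_integrable fi /bounded_rv_integrable gi; rewrite /Ex RintegralD.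
Qed.

Lemma ExZ c f : bounded_rv f -> Ex (fun w => c * f w) = c * Ex f.
Proof. by move=> /bounded_rv_integrable fi; rewrite /Ex RintegralZl. Qed.

Lemma Ex_le f g : bounded_rv f -> bounded_rv g -> (forall w, f w <= g w) ->
  Ex f <= Ex g.
Proof.
move=> /bounded_rv_integrable fi /bounded_rv_integrable gi fg.
by apply: le_Rintegral => // w _; exact: fg.
Qed.

Lemma Ex_cst c : Ex (fun _ => c) = c.
Proof.
have P1 : fine (P [set: Omega]) = 1 by rewrite probability_setT.
by rewrite /Ex Rintegral_cst// [X in _ * X]P1 mulr1.
Qed.

Lemma Ex_indic (A : set Omega) : measurable A -> Ex \1_A = fine (P A).
Proof.
move=> mA; rewrite /Ex /Rintegral integral_indic//.
by rewrite setIT.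
Qed.

Lemma Ex_sum n (f : 'I_n -> Omega -> R) : (forall i, bounded_rv (f i)) ->
  Ex (fun w => \sum_i f i w) = \sum_i Ex (f i).
Proof.
elim: n f => [|n IH] f hf.
  under [in LHS]eq_fun do rewrite big_ord0.
  by rewrite big_ord0 Ex_cst.
under [in LHS]eq_fun do rewrite big_ord_recl.
rewrite big_ord_recl -IH// ExD//.
by apply: bounded_rv_sum.
Qed.

(** The exceptional event contributes at most 2 M C eta, since there h1 - h2 is at
most 2 M and Z at most C. *)
Lemma Ex_le_outside h1 h2 Z M C e eta :
  measurable_fun [set: Omega] h1 -> measurable_fun [set: Omega] h2 ->
  (forall w, `|h1 w| <= M) -> (forall w, `|h2 w| <= M) ->
  measurable_fun [set: Omega] Z -> (forall w, 0 <= Z w <= C) -> 0 <= e ->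
  (mu_ext P [set w | ~ h1 w <= h2 w + e]%R <= eta%:E)%E ->
  Ex (fun w => h1 w * Z w) <=
  Ex (fun w => h2 w * Z w) + (C * e + 2 * M * C * eta).
Proof.
move=> m1 m2 b1 b2 mZ Z0 e0.
set A := [set w | ~ _]; have mA : measurable A.
  have -> : A = (fun w => h1 w - h2 w) @^-1` `]e, +oo[%classic.
    apply/seteqP; split => w /=; rewrite /A/= in_itv/= andbT ltrBrDl.
      by move=> /negP; rewrite -ltNge.
    by move=> H; apply/negP; rewrite -ltNge.
  rewrite -[X in measurable X]setTI; apply: measurable_funB => //.
rewrite measurable_mu_extE// => PA.
have [w0 _] := probability_nonempty.
have M0 : 0 <= M by exact: le_trans (b1 w0).
have C0 : 0 <= C by have /andP[/le_trans] := Z0 w0; apply.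
have r1 : bounded_rv h1 by split => //; exists M.
have r2 : bounded_rv h2 by split => //; exists M.
have rZ : bounded_rv Z.
  by split => //; exists C => w; have /andP[? ?] := Z0 w; rewrite ger0_norm.
have rA := bounded_rv_indic mA.
have rcA : bounded_rv (fun w => 2 * M * C * \1_A w).
  by apply: bounded_rvM => //; exact: bounded_rv_cst.
have rh : bounded_rv (fun w => C * e + 2 * M * C * \1_A w).
  by apply: bounded_rvD => //; exact: bounded_rv_cst.
apply: (@le_trans _ _ (Ex (fun w => h2 w * Z w + (C * e + 2 * M * C * \1_A w)))).
  apply: Ex_le => [||w].
  - exact: bounded_rvM.
  - by apply: bounded_rvD => //; exact: bounded_rvM.
  have /andP[z0 zC] := Z0 w; have := b1 w; have := b2 w.
  rewrite !ler_norml => /andP[x1 x2] /andP[y1 y2].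
  rewrite indicE; have [wA|wA] := boolP (w \in A).
    rewrite -lerBlDl -mulrBl mulr1 (@le_trans _ _ (2 * M * Z w))//.
      by apply: ler_wpM2r => //; lra.
    rewrite (@le_trans _ _ (2 * M * C))//; last by rewrite lerDr mulr_ge0.
    by rewrite ler_wpM2l// mulr_ge0.
  rewrite mulr0 addr0 -lerBlDl -mulrBl.
  have h12 : h1 w <= h2 w + e.
    by move: wA; rewrite notin_setE => /contrapT.
  rewrite (@le_trans _ _ (e * Z w))//.
    by apply: ler_wpM2r => //; lra.
  by rewrite mulrC ler_wpM2r.
rewrite ExD//; last exact: bounded_rvM.
rewrite lerD2l ExD//; last exact: bounded_rv_cst.
rewrite Ex_cst lerD2l ExZ// ler_wpM2l//; first by rewrite !mulr_ge0.
rewrite Ex_indic// -lee_fin fineK//.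
by rewrite fin_num_measure.
Qed.

Lemma cvg_ExE (F : set_system R) (FF : Filter F) (f : R -> Omega -> R) g :
  (\forall T \near F, bounded_rv (f T)) -> bounded_rv g ->
  ('E_P[f T] @[T --> F] --> 'E_P[g])%E <-> Ex (f T) @[T --> F] --> Ex g.
Proof.
move=> bf bg; rewrite ExE//; split => [/fine_cvgP[_]|cv].
  apply: cvg_trans; apply: near_eq_cvg; apply: filterS bf => T bf /=.
  by rewrite ExE.
apply/fine_cvgP; split.
  by apply: filterS bf => T bf; rewrite ExE.
apply: cvg_trans cv; apply: near_eq_cvg; apply: filterS bf => T bf /=.
by rewrite ExE.
Qed.

End BoundedExpectation.

Section SupOnCompact.
Context {R : realType} {E : normedModType R} (K : set E).
Hypotheses (cK : compact K) (K0 : K !=set0).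

(** A real supremum, so that it can be subtracted; the maximum is attained for
the continuous functions to which it is applied. *)
Definition supK (h : E -> R) : R := sup [set h a | a in K].

Lemma supKP (h : E -> R) : continuous h ->
  exists2 a, K a & supK h = h a /\ forall a', K a' -> h a' <= supK h.
Proof.
move=> ch; have [|a] := compact_EVT_max K0 cK (f := h).
  exact: continuous_subspaceT.
rewrite inE => Ka amax.
have ub x : [set h a | a in K] x -> x <= h a.
  by move=> [a' Ka' <-]; apply: amax; rewrite inE.
have se : supK h = h a.
  apply/eqP; rewrite eq_le; apply/andP; split.
    by apply: ge_sup => //; exists (h a), a.
  by apply: ub_le_sup; [exists (h a) | exists a].
by exists a => //; split => // a' Ka'; rewrite se; apply: ub; exists a'.
Qed.

Lemma supK_dist (h1 h2 : E -> R) e : continuous h1 -> continuous h2 ->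
  (forall a, K a -> `|h1 a - h2 a| <= e) -> `|supK h1 - supK h2| <= e.
Proof.
move=> c1 c2 he.
have [a1 K1 [-> m1]] := supKP c1; have [a2 K2 [-> m2]] := supKP c2.
have {}m1 := m1 _ K2; have {}m2 := m2 _ K1.
have := he _ K1; have := he _ K2.
by rewrite !ler_norml => /andP[p1 p2] /andP[q1 q2]; apply/andP; split; lra.
Qed.

End SupOnCompact.

(** * Penalized maxima *)

Section PenalizedMaximum.
Context {R : realType} {p N : nat} (psi : 'rV[R]_p -> 'rV[R]_N).
Hypothesis cpsi : continuous psi.
Context (K : set 'rV[R]_p).
Hypotheses (cK : compact K) (K0 : K !=set0).
Context (f : 'rV[R]_p -> R) (M : R).
Hypotheses (cf : continuous f) (fM : forall x, `|f x| <= M).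

Lemma continuous_dotv s : continuous (fun a => dotv s (psi a)).
Proof.
apply: continuous_bigsum => i _; apply: continuous_mul.
  exact: continuous_const.
exact: continuous_coord.
Qed.

(** Maximizing f penalized by n times the defect of s.psi(a) from its maximum
over K: as n grows, this decreases to the largest value of f over the
maximizers, while for each n it depends continuously on s. *)
Definition penmax (n : nat) (s : 'rV[R]_N) : R :=
  supK K (fun a => f a + n%:R * dotv s (psi a))
  - n%:R * supK K (fun a => dotv s (psi a)).

Lemma continuous_penalized n s :
  continuous (fun a => f a + n%:R * dotv s (psi a)).
Proof.
apply: continuous_add => //; apply: continuous_mul.
  exact: continuous_const.
exact: continuous_dotv.
Qed.

(** At an exact maximizer of s.psi the penalty vanishes, and at a near-maximizer
it costs n times the defect. *)
Lemma penmax_ge n s a : K a ->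
  f a <= penmax n s + n%:R * (supK K (fun a => dotv s (psi a)) - dotv s (psi a)).
Proof.
move=> Ka; have [_ _ [_ m]] := supKP cK K0 (@continuous_penalized n s).
have := m _ Ka; rewrite /penmax mulrBr; lra.
Qed.

Lemma penmax_le n s b : (forall a, K a ->
  f a + n%:R * (dotv s (psi a) - supK K (fun a => dotv s (psi a))) <= b) ->
  penmax n s <= b.
Proof.
move=> H; have [a Ka [e _]] := supKP cK K0 (@continuous_penalized n s).
rewrite /penmax e; have := H _ Ka; rewrite mulrBr; lra.
Qed.

Lemma penmax_bounded n s : `|penmax n s| <= M.
Proof.
have [a Ka [e m]] := supKP cK K0 (continuous_dotv (s := s)).
rewrite ler_norml; apply/andP; split.
  have := @penmax_ge n s a Ka; rewrite e subrr mulr0 addr0; apply: le_trans.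
  by have := fM a; rewrite ler_norml => /andP[].
apply: penmax_le => a' Ka'; rewrite -[leRHS]addr0 lerD//.
  by rewrite (le_trans (ler_norm _)).
by rewrite mulr_ge0_le0// subr_le0 m.
Qed.

Lemma penmax_nincr n m s : (n <= m)%N -> penmax m s <= penmax n s.
Proof.
move=> nm; apply: penmax_le => a Ka.
have [_ _ [_ /(_ _ Ka) h]] := supKP cK K0 (continuous_dotv (s := s)).
have := @penmax_ge n s a Ka.
have : (n%:R : R) <= m%:R by rewrite ler_nat.
move: h; set S := supK _ _; set D := dotv _ _; nra.
Qed.

(** A global Lipschitz bound in s, uniform over K, is what allows the component
of s that is fixed along the limit to be frozen. *)
Lemma penmax_lipschitz n : exists L, 0 <= L /\ forall s s',
  `|penmax n s - penmax n s'| <= L * `|s - s'|.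
Proof.
have cnpsi : continuous (fun a => `|psi a|).
  exact: continuous_norm.
have [a Ka [_ m]] := supKP cK K0 cnpsi.
set B := supK K _ in m.
have B0 : 0 <= B by rewrite (le_trans _ (m _ Ka)).
have NB0 : 0 <= N%:R * B by rewrite mulr_ge0.
exists (2 * (n%:R * (N%:R * B))); split; first by rewrite !mulr_ge0.
move=> s s'.
have h1 a' : K a' -> `|dotv s (psi a') - dotv s' (psi a')| <= N%:R * B * `|s - s'|.
  move=> Ka'; rewrite -dotvBl (le_trans (dotv_le _ _))// -mulrA ler_wpM2l//.
  by rewrite mulrC ler_wpM2r// m.
have h2 := supK_dist cK K0 (continuous_dotv (s := s)) (continuous_dotv (s := s')) h1.
have h3 := supK_dist cK K0 (@continuous_penalized n s) (@continuous_penalized n s')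
  (e := n%:R * (N%:R * B * `|s - s'|)).
have {}h3 : `|supK K (fun a => f a + n%:R * dotv s (psi a)) -
    supK K (fun a => f a + n%:R * dotv s' (psi a))| <= n%:R * (N%:R * B * `|s - s'|).
  apply: h3 => a' Ka'; rewrite opprD addrACA subrr add0r -mulrBr normrM.
  by rewrite ger0_norm// ler_wpM2l// h1.
rewrite /penmax opprD opprK addrACA [- (_ * _) + _]addrC -mulrBr.
apply: (le_trans (ler_normD _ _)); rewrite normrM ger0_norm// distrC in h2 *.
rewrite distrC in h3.
rewrite -mulrA [2 * _]mulrC mulrDr mulr1 lerD//.
  by rewrite distrC (le_trans h3)// !mulrA.
by rewrite -mulrA ler_wpM2l.
Qed.

Lemma continuous_penmax n : continuous (penmax n).
Proof.
have [L [L0 HL]] := penmax_lipschitz n; exact: (lipschitz_continuous L0 HL).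
Qed.

(** Away from the unique maximizer the defect is bounded below by compactness,
and f is bounded, so a large n makes the penalty dominate. *)
Lemma penmax_unique s u e : K u ->
  (forall a, K a -> a != u -> dotv s (psi a) < dotv s (psi u)) -> 0 < e ->
  exists n, penmax n s <= f u + e.
Proof.
move=> Ku uniq e0.
have M0 : 0 <= M by rewrite (le_trans _ (fM u)).
have Su : supK K (fun a => dotv s (psi a)) = dotv s (psi u).
  have [a Ka [e1 m]] := supKP cK K0 (continuous_dotv (s := s)).
  apply/eqP; rewrite eq_le m// andbT e1.
  by have [->//|au] := eqVneq a u; exact/ltW/uniq.
pose C := K `&` [set a | f u + e <= f a].
have cC : compact C.
  apply: compact_closedI => //.
  apply: (@closed_comp _ _ f [set t | f u + e <= t]); last exact: closed_ge.
  by move=> x _; exact: cf.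
have [C0|/set0P/negP/negPn/eqP C0] := pselect (C !=set0); last first.
  exists 0%N; apply: penmax_le => a Ka; rewrite mul0r addr0 leNgt.
  by apply/negP => /ltW fa; have : C a by []; rewrite C0.
have [|c] := compact_EVT_max C0 cC (f := fun a => dotv s (psi a)).
  by apply: continuous_subspaceT; exact: continuous_dotv.
rewrite inE => -[Kc fc] cmax.
have cu : c != u.
  by apply/eqP => cu; move: fc; rewrite /= cu leNgt ltrDl e0.
have k0 : 0 < dotv s (psi u) - dotv s (psi c) by rewrite subr_gt0 uniq.
set k := _ - _ in k0.
exists (Num.bound (2 * M / k)); apply: penmax_le => a Ka; rewrite Su.
have [fa|/ltW fa] := leP (f u + e) (f a); last first.
  rewrite -[leRHS]addr0 lerD// mulr_ge0_le0// subr_le0.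
  by have [->//|au] := eqVneq a u; exact/ltW/uniq.
have : dotv s (psi a) <= dotv s (psi c) by apply: cmax; rewrite inE.
rewrite -subr_ge0 => ac.
have : 2 * M / k < (Num.bound (2 * M / k))%:R.
  by rewrite archi_boundP// divr_ge0// ?mulr_ge0// ltW.
rewrite ltr_pdivrMr// => b.
have := fM a; have := fM u; rewrite !ler_norml => /andP[p1 p2] /andP[q1 q2].
have n0 : 0 <= (Num.bound (2 * M / k))%:R :> R by [].
move: b n0 ac; rewrite /k; set n := (Num.bound _)%:R; set D := dotv s (psi u).
set D1 := dotv s (psi c); set D2 := dotv s (psi a) => b n0 ac.
have : n * (D2 - D) <= n * (D1 - D) by rewrite ler_wpM2l// lerB// -subr_ge0.
nra.
Qed.

End PenalizedMaximum.

(** * Stable convergence with an adjoined row *)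

Section StableConvergence.
Context {R : realType} {d : measure_display} {Omega : measurableType d}.
Context (P : probability Omega R) (G : set (set Omega)).
Hypothesis GP : G `<=` measurable.
Context (F : set_system R) {FF : ProperFilter F}.

Definition Gmeasurable (Z : Omega -> R) :=
  measurable_fun [set: g_sigma_algebraType G] (Z : g_sigma_algebraType G -> R).

Definition Gmeasurable_row n (X : Omega -> 'rV[R]_n) :=
  measurable_row (X : g_sigma_algebraType G -> 'rV[R]_n).

Lemma sub_Gmeasurable (A : set Omega) :
  (G.-sigma).-measurable (A : set (g_sigma_algebraType G)) -> measurable A.
Proof.
by apply: smallest_sub => //; exact: sigma_algebra_measurable.
Qed.

Lemma Gmeasurable_measurable Z : Gmeasurable Z -> measurable_fun [set: Omega] Z.
Proof. by move=> mZ _ B mB; apply: sub_Gmeasurable; exact: mZ. Qed.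

Lemma Gmeasurable_row_measurable n (X : Omega -> 'rV[R]_n) :
  Gmeasurable_row X -> measurable_row X.
Proof. by move=> mX j; apply: Gmeasurable_measurable; exact: mX. Qed.

Lemma measurable_row_mx n m (X : Omega -> 'rV[R]_n) (Y : Omega -> 'rV[R]_m) :
  measurable_row X -> measurable_row Y ->
  measurable_row (fun w => row_mx (X w) (Y w)).
Proof.
move=> mX mY j; have [i ->|i ->] := split_ordP j.
  by under eq_fun do rewrite row_mxEl; exact: mX.
by under eq_fun do rewrite row_mxEr; exact: mY.
Qed.

Lemma measurable_row_norm n (X : Omega -> 'rV[R]_n) :
  measurable_row X -> measurable_fun [set: Omega] (fun w => `|X w|).
Proof.
move=> mX; apply: (measurable_row_comp (f := fun x => `|x|)) => //.
exact: norm_continuous.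
Qed.

(** Stable convergence is preserved when a row measurable with respect to the
conditioning sigma-algebra is adjoined: on each event where that row is
almost constant, it can be frozen, and the event is absorbed in the weight. *)
Lemma stable_joint n m (XT : R -> Omega -> 'rV[R]_n) (X : Omega -> 'rV[R]_n)
    (Gam : Omega -> 'rV[R]_m) (Phi : 'rV[R]_(n + m) -> R) (M L : R)
    (Z : Omega -> R) (C : R) :
  (\forall T \near F, measurable_row (XT T)) -> measurable_row X ->
  Gmeasurable_row Gam -> cvg_ds P G F XT X ->
  continuous Phi -> (forall x, `|Phi x| <= M) -> 0 <= L ->
  (forall s s', `|Phi s - Phi s'| <= L * `|s - s'|) ->
  Gmeasurable Z -> (forall w, 0 <= Z w <= C) ->
  Ex P (fun w => Phi (row_mx (XT T w) (Gam w)) * Z w) @[T --> F] -->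
  Ex P (fun w => Phi (row_mx (X w) (Gam w)) * Z w).
Proof.
move=> mXT mX mG XTX cPhi PhiM L0 PhiL mZ ZC.
have mZ' := Gmeasurable_measurable mZ.
have mG' := Gmeasurable_row_measurable mG.
have [w0 _] := probability_nonempty P.
have M0 : 0 <= M by exact: le_trans (PhiM 0).
have C0 : 0 <= C by have /andP[/le_trans] := ZC w0; apply.
have bZ : bounded_rv Z.
  by split => //; exists C => w; have /andP[? ?] := ZC w; rewrite ger0_norm.
apply/cvgrPdist_le => eps eps0.
(* den collects the error constants, so that freezing costs at most eps / 2 in all *)
pose den := 2 * (C * L) + 4 * (M * C) + 1.
have den0 : 0 < den by rewrite ltr_wpDl// addr_ge0// !mulr_ge0.
pose e := eps / 2 / den; have e0 : 0 < e by rewrite !divr_gt0.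
have [r [r0 rP]] : exists r : R, 0 <= r /\
    (mu_ext P [set w | ~ `|Gam w| <= r]%R <= e%:E)%E.
  have near_r : \forall r \near +oo, \forall T \near F,
      (mu_ext P [set w | ~ `|Gam w| <= r]%R <= e%:E)%E.
    exact: tightly_rv (measurable_row_norm mG') e e0.
  have near_0 : \forall r \near +oo, 0 <= r :> R.
    by apply: nbhs_pinfty_ge; exact: num_real.
  have [r [r0 /filter_ex[T rP]]] := filter_ex (filterI near_0 near_r).
  by exists r.
(* the values are clipped to a compact box, on which a finite net exists *)
pose Gc w := \row_j Num.max (- r) (Num.min r (Gam w 0 j)) : 'rV[R]_m.
have mGc : Gmeasurable_row Gc.
  move=> j; rewrite /Gc; under eq_fun do rewrite mxE.
  by apply: measurable_maxr => //; apply: measurable_minr => //; exact: mG.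
have GcG w : `|Gam w| <= r -> Gc w = Gam w.
  move=> Gr; apply/rowP => j; rewrite mxE.
  have : `|Gam w 0 j| <= r by rewrite (le_trans (mx_coord_le _ _ _)).
  by rewrite ler_norml => /andP[a b]; rewrite (min_r b) (max_r a).
have Gcr w : `|Gc w| <= r.
  apply: row_norm_le => // j; rewrite mxE.
  by rewrite ler_norml le_max lexx/= ge_max ge_min lexx -subr_ge0 opprK addr_ge0.
have [|N [x [k [kN mk _ xk]]]] := discretize (S := g_sigma_algebraType G)
  (D := [set x : 'rV[R]_m | `|x| <= r])
  (@compact_norm_le R m r) _ Gcr (measurable_row_dist mGc) e0.
  by exists 0; rewrite /= normr0.
pose I i : Omega -> R := \1_[set w | k w = i].
have mI i : Gmeasurable (I i) by apply: measurable_indic; exact: mk.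
have bI i : bounded_rv (I i) by apply: bounded_rv_indic; apply: sub_Gmeasurable; exact: mk.
pose h (Y : Omega -> 'rV[R]_n) w := Phi (row_mx (Y w) (x (k w))).
(* on each event k = i the adjoined row is frozen at x i; the indicator I i is
   measurable for G and joins the weight Z *)
have hE Y w : h Y w * Z w = \sum_(i < N) Phi (row_mx (Y w) (x i)) * (I i w * Z w).
  rewrite (bigD1 (Ordinal (kN w)))//= big1 ?addr0.
    by rewrite /I indicE mem_set//= mul1r.
  move=> i /eqP ik; rewrite /I indicE memNset ?mul0r ?mulr0//=.
  by move=> ki; apply: ik; apply: val_inj.
have cPhii i : continuous (fun y : 'rV[R]_n => Phi (row_mx y (x i))).
  apply: (lipschitz_continuous L0) => s t.
  apply: le_trans (PhiL _ _) _; rewrite ler_wpM2l//.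
  rewrite opp_row_mx add_row_mx subrr; apply: row_norm_le => // j.
  have [j' ->|j' ->] := split_ordP j; first by rewrite row_mxEl mx_coord_le.
  by rewrite row_mxEr mxE normr0.
have bPhi Y i : measurable_row Y -> bounded_rv (fun w => Phi (row_mx (Y w) (x i))).
  move=> mY; split; last by exists M => w.
  exact: (measurable_row_comp mY (cPhii i)).
have bterm Y i : measurable_row Y ->
    bounded_rv (fun w => Phi (row_mx (Y w) (x i)) * (I i w * Z w)).
  by move=> mY; apply: bounded_rvM; [exact: bPhi | exact: bounded_rvM].
have Exh Y : measurable_row Y -> Ex P (fun w => h Y w * Z w) =
    \sum_(i < N) Ex P (fun w => Phi (row_mx (Y w) (x i)) * (I i w * Z w)).
  move=> mY; under [X in Ex P X]eq_fun do rewrite hE.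
  by rewrite Ex_sum// => i; exact: bterm.
have cvgh : Ex P (fun w => h (XT T) w * Z w) @[T --> F] -->
    Ex P (fun w => h X w * Z w).
  rewrite Exh//; apply: (@cvg_trans _ ((fun T => \sum_(i < N)
    Ex P (fun w => Phi (row_mx (XT T w) (x i)) * (I i w * Z w))) @ F)).
    by apply: near_eq_cvg; apply: filterS mXT => T mXT; rewrite Exh.
  apply: cvg_sumr => i _; apply/cvg_ExE.
  - by apply: filterS mXT => T mXT; exact: bterm.
  - exact: bterm.
  apply: (XTX (fun y => Phi (row_mx y (x i)))) => //; first by exists M.
    by apply: measurable_funM => //; exact: mI.
  exists C => w; rewrite normrM /I indicE; have /andP[z0 zC] := ZC w.
  rewrite (ger0_norm z0); case: (_ \in _); rewrite ?normr1 ?mul1r//.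
  by rewrite normr0 mul0r.
have close Y : measurable_row Y ->
    `|Ex P (fun w => Phi (row_mx (Y w) (Gam w)) * Z w) - Ex P (fun w => h Y w * Z w)|
    <= C * (L * e) + 2 * M * C * e.
  move=> mY; have near_h w : `|Gam w| <= r ->
      `|Phi (row_mx (Y w) (Gam w)) - h Y w| <= L * e.
    move=> Gr; apply: le_trans (PhiL _ _) _; rewrite ler_wpM2l//.
    rewrite opp_row_mx add_row_mx subrr; apply: row_norm_le; first exact: ltW.
    move=> j; have [j' ->|j' ->] := split_ordP j.
      by rewrite row_mxEl mxE normr0 ltW.
    rewrite row_mxEr (le_trans (mx_coord_le _ _ _))// distrC ltW//.
    by rewrite -(GcG _ Gr) xk.
  have m1 : measurable_fun setT (fun w => Phi (row_mx (Y w) (Gam w))).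
    by apply: (measurable_row_comp _ cPhi); exact: measurable_row_mx.
  have m2 : measurable_fun setT (h Y).
    apply: (measurable_fun_index (S := Omega)
      (h := fun i w => Phi (row_mx (Y w) (x i))) kN).
      by move=> i; apply: sub_Gmeasurable; exact: mk.
    by move=> i; case: (bPhi _ _ Y i mY).
  have Le0 : 0 <= L * e by rewrite mulr_ge0// ltW.
  rewrite ler_distlC; apply/andP; split.
    rewrite lerBlDr; apply: Ex_le_outside => //; first by move=> w; exact: PhiM.
    apply: le_trans rP; apply: mu_extS => w /=; apply: contra_not => /near_h.
    by rewrite ler_norml => /andP[? ?]; lra.
  apply: Ex_le_outside => //; first by move=> w; exact: PhiM.
  apply: le_trans rP; apply: mu_extS => w /=; apply: contra_not => /near_h.
  by rewrite ler_norml => /andP[? ?]; lra.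
have e20 : 0 < eps / 2 by rewrite divr_gt0.
move/cvgrPdist_le : cvgh => /(_ _ e20).
apply: filterS2 mXT => T mXT h1; have h2 := close _ mX; have h3 := close _ mXT.
have : 2 * (C * (L * e) + 2 * M * C * e) <= eps / 2.
  have -> : eps / 2 = e * den by rewrite /e divfK// gt_eqF.
  rewrite /den; have : 0 <= C * L by rewrite mulr_ge0.
  lra.
move: h1 h2 h3; rewrite !ler_norml => /andP[? ?] /andP[? ?] /andP[? ?] ?.
by apply/andP; split; lra.
Qed.

End StableConvergence.

(** * Stable convergence of near-maximizers *)

Section StableArgmax.
Context {R : realType} {d : measure_display} {Omega : measurableType d}.
Context (P : probability Omega R) (G : set (set Omega)).
Hypothesis GP : G `<=` measurable.
Context (F : set_system R) {FF : ProperFilter F}.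
Context {n m p : nat} (XT : R -> Omega -> 'rV[R]_n) (X : Omega -> 'rV[R]_n).
Context (Gam : Omega -> 'rV[R]_m) (psi : 'rV[R]_p -> 'rV[R]_(n + m)).
Context (U : set 'rV[R]_p) (uhat : Omega -> 'rV[R]_p).
Context (y : R -> Omega -> 'rV[R]_p).
Hypotheses (mXT : \forall T \near F, measurable_row (XT T)).
Hypotheses (mX : measurable_row X) (mGam : Gmeasurable_row G Gam).
Hypotheses (XTX : cvg_ds P G F XT X).
Hypotheses (cpsi : continuous psi) (cU : closed U).
Hypotheses (muhat : measurable_row uhat) (Uuhat : forall w, U (uhat w)).
Hypotheses (my : \forall T \near F, measurable_row (y T)).
Hypotheses (ty : tightly P F (fun r T w => `|y T w| <= r)).

Let s w := row_mx (X w) (Gam w).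
Let sT T w := row_mx (XT T w) (Gam w).

Hypothesis uniq : {ae P, forall w, forall u, U u -> u != uhat w ->
  dotv (s w) (psi u) < dotv (s w) (psi (uhat w))}.

(** The competitors a' are bounded and the near-maximizer a is not: a lies within
e of y, hence in the slightly larger ball used below. *)
Hypothesis near_max : forall r e, 0 < e -> whp P F (fun T w => `|y T w| <= r ->
  exists a, [/\ U a, `|a - y T w| <= e & forall a', U a' -> `|a'| <= r ->
    dotv (sT T w) (psi a') <= dotv (sT T w) (psi a) + e]).

(** For k large the penalized maximum at the limit coefficients is at most
f(uhat) + e, with large probability, by uniqueness of the maximizer. Its
expectation passes to the limit because it is a continuous function of the
coefficients, and before the limit it is at least f(y) up to a small error,
because y is close to a near-maximizer. *)
Lemma stable_argmax_le (f : 'rV[R]_p -> R) (M : R) (Z : Omega -> R) (C : R) :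
  continuous f -> (forall x, `|f x| <= M) ->
  Gmeasurable G Z -> (forall w, 0 <= Z w <= C) ->
  forall eps, 0 < eps -> \forall T \near F,
    Ex P (fun w => f (y T w) * Z w) <= Ex P (fun w => f (uhat w) * Z w) + eps.
Proof.
move=> cf fM mZ ZC eps eps0.
have mZ' := Gmeasurable_measurable GP mZ.
have mGam' := Gmeasurable_row_measurable GP mGam.
have [w0 _] := probability_nonempty P.
have M0 : 0 <= M by exact: le_trans (fM 0).
have C0 : 0 <= C by have /andP[/le_trans] := ZC w0; apply.
pose den := 4 * C + 8 * (M * C) + 1.
have den0 : 0 < den by rewrite ltr_wpDl// addr_ge0// !mulr_ge0.
pose e := eps / 2 / den; have e0 : 0 < e by rewrite !divr_gt0.
have eden : e * den = eps / 2 by rewrite /e divfK// gt_eqF.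
have eps2 : 0 < eps / 2 by rewrite divr_gt0.
have near_y := ty e0.
have near_u : \forall r \near +oo, \forall T \near F,
    (mu_ext P [set w | ~ `|uhat w| <= r]%R <= e%:E)%E.
  exact: tightly_rv (measurable_row_norm muhat) e e0.
have near_w0 : \forall r \near +oo, `|uhat w0| <= r.
  by apply: nbhs_pinfty_ge; exact: num_real.
have [r0 [[yr0 ur0] w0r0]] := filter_ex (filterI (filterI near_y near_u) near_w0).
have {ur0} [T ur0] := filter_ex ur0.
(* room for a near-maximizer at distance at most 1 from y *)
pose r := r0 + 1.
pose K := U `&` [set x | `|x| <= r].
have cK : compact K by rewrite /K setIC; apply: compact_closedI => //; exact: compact_norm_le.
have Ku w : `|uhat w| <= r0 -> K (uhat w).
  by move=> h; split; [exact: Uuhat | rewrite /= (le_trans h)// lerDl].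
have K0 : K !=set0 by exists (uhat w0); exact: Ku.
pose Psi := penmax psi K f.
have cPsi k : continuous (Psi k) by exact: continuous_penmax.
have PsiM k x : `|Psi k x| <= M by exact: penmax_bounded.
(* at the limit, the penalized maxima are at most f (uhat) + e for large k *)
have ms : measurable_row s by exact: measurable_row_mx.
have mfu : measurable_fun setT (fun w => f (uhat w)).
  exact: (measurable_row_comp muhat cf).
have mPsi k : measurable_fun setT (fun w => Psi k (s w)).
  exact: (measurable_row_comp ms (@cPsi k)).
pose A k := [set w | `|uhat w| <= r0 /\ f (uhat w) + e < Psi k (s w)].
have mA k : measurable (A k).
    rewrite (_ : A k =
        ([set: Omega] `&` (fun w => `|uhat w|) @^-1` `]-oo, r0]%classic) `&`
        ([set: Omega] `&`
          (fun w => Psi k (s w) - f (uhat w)) @^-1` `]e, +oo[%classic)).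
      apply: measurableI; first exact: (measurable_row_norm muhat).
      by apply: measurable_funB => //; exact: mPsi.
    have E w : (e < Psi k (s w) - f (uhat w)) = (f (uhat w) + e < Psi k (s w)).
      exact: ltrBrDl.
    by apply/seteqP; split => w /=; rewrite !in_itv/= andbT E /A/=; tauto.
have [k kP] : exists k, (P (A k) <= e%:E)%E.
  apply: probability_decreasing => //.
  - move=> k k' kk' w /= [? H]; split => //.
    exact/(lt_le_trans H)/penmax_nincr.
  - apply: negligibleS uniq => w /= Hw H.
    have [ur _] := Hw 0%N I.
    have [|k Hk] := penmax_unique cpsi cK K0 cf fM (s := s w) (Ku _ ur) _ e0.
      by move=> a [Ua _] au; exact: H.
    by have [_] := Hw k I; rewrite ltNge Hk.
have lim_le : Ex P (fun w => Psi k (s w) * Z w) <=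
    Ex P (fun w => f (uhat w) * Z w) + (C * e + 2 * M * C * (e + e)).
  apply: Ex_le_outside => //; first exact: ltW.
  apply: (@mu_extU _ _ _ P _ [set w | ~ `|uhat w| <= r0] (A k)) => //.
    move=> w /= /negP; rewrite -ltNge => H.
    by have [?|?] := pselect (`|uhat w| <= r0); [right|left].
  by rewrite measurable_mu_extE.
have [L [L0 PsiL]] := @penmax_lipschitz R p (n + m) psi cpsi K cK K0 f cf k.
have /cvgrPdist_le/(_ _ e0) near_Psi :
    Ex P (fun w => Psi k (sT T w) * Z w) @[T --> F] -->
    Ex P (fun w => Psi k (s w) * Z w).
  exact: (stable_joint GP mXT mX mGam XTX (@cPsi k) (PsiM k) L0 PsiL mZ ZC).
(* the approximate maximizer a is close to y, and f is uniformly continuous *)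
have [dl dl0 fdl] := compact_unif_continuous (@compact_norm_le R p r) cf e0.
pose e' := Num.min (Num.min 1 (dl / 2)) (e / k.+1%:R).
have e'0 : 0 < e' by rewrite !lt_min ltr01 !divr_gt0.
have near_a := near_max r e'0 e0.
apply: filterS3 (filterI my mXT) (filterI yr0 near_Psi) near_a.
move=> {}T [myT mXTT] [yT PsiT] aT.
have m1 : measurable_fun setT (fun w => f (y T w)).
  exact: (measurable_row_comp myT cf).
have m2 : measurable_fun setT (fun w => Psi k (sT T w)).
  by apply: (measurable_row_comp _ (@cPsi k)); exact: measurable_row_mx.
have T_le : Ex P (fun w => f (y T w) * Z w) <=
    Ex P (fun w => Psi k (sT T w) * Z w) + (C * (e + e) + 2 * M * C * (e + e)).
  apply: Ex_le_outside => //; first by rewrite addr_ge0// ltW.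
  apply: mu_extU yT aT => w /= nle.
  have [yr|nyr] := pselect (`|y T w| <= r0); last by left.
  right => aP; apply: nle.
  have [|a [Ua ay amax]] := aP; first by rewrite (le_trans yr)// lerDl.
  have e'1 : e' <= 1 by rewrite !ge_min lexx.
  have e'dl : e' < dl.
    apply: (@le_lt_trans _ _ (dl / 2)); first by rewrite !ge_min lexx orbT.
    by rewrite ltr_pdivrMr// ltr_pMr// ltr1n.
  have e'k : k%:R * e' <= e.
    apply: (@le_trans _ _ (k.+1%:R * e')).
      by rewrite ler_wpM2r ?ler_nat// ltW.
    by rewrite mulrC -ler_pdivlMr// !ge_min lexx !orbT.
  have ar : `|a| <= r.
    rewrite -[a](subrK (y T w)) /r addrC (le_trans (ler_normD _ _))// lerD//.
    exact: le_trans ay _.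
  have fay := fdl a (y T w) ar (le_lt_trans ay e'dl).
  have [a' [Ua' a'r] [Sa' _]] := supKP cK K0 (continuous_dotv cpsi (s := sT T w)).
  have Sa : supK K (fun a => dotv (sT T w) (psi a)) <= dotv (sT T w) (psi a) + e'.
    by rewrite Sa'; exact: amax.
  have := penmax_ge cpsi cK K0 cf k (sT T w) (conj Ua ar).
  rewrite -[penmax _ _ _ _ _]/(Psi k (sT T w)).
  have : k%:R * (supK K (fun a => dotv (sT T w) (psi a)) - dotv (sT T w) (psi a))
      <= k%:R * e' by rewrite ler_wpM2l// lerBlDl.
  move: fay; rewrite ltr_norml => /andP[? ?] ? ?; lra.
move: PsiT; rewrite ler_norml => /andP[q1 q2].
have : 3 * (C * e) + 8 * (M * C * e) + e <= eps / 2.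
  have : 0 <= C * e by rewrite mulr_ge0// ltW.
  rewrite -eden /den; lra.
lra.
Qed.

(** Convergence in law towards the maximizer follows by applying the one-sided
bound to f and to -f, and by splitting Z as the difference of Z + C and C. *)
Theorem stable_argmax : cvg_ds P G F y uhat.
Proof.
move=> f Z cf [M fM] mZ [C ZC].
have mZ' := Gmeasurable_measurable GP mZ.
have bf (Y : Omega -> 'rV[R]_p) : measurable_row Y -> bounded_rv (fun w => f (Y w)).
  by move=> mY; split; [exact: (measurable_row_comp mY cf) | exists M => w].
have bZ : bounded_rv Z by split => //; exists C.
have bfZ (Y : Omega -> 'rV[R]_p) (W : Omega -> R) : measurable_row Y ->
    bounded_rv W -> bounded_rv (fun w => f (Y w) * W w).
  by move=> mY; apply: bounded_rvM; exact: bf.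
apply/cvg_ExE; [by apply: filterS my => T mY; exact: bfZ | exact: bfZ |].
have pos_cvg (W : Omega -> R) B : Gmeasurable G W -> (forall w, 0 <= W w <= B) ->
    Ex P (fun w => f (y T w) * W w) @[T --> F] -->
    Ex P (fun w => f (uhat w) * W w).
  move=> mW WB; apply/cvgrPdist_le => e e0.
  have bW : bounded_rv W.
    split; first exact: Gmeasurable_measurable mW.
    by exists B => w; have /andP[? ?] := WB w; rewrite ger0_norm.
  have up := stable_argmax_le cf fM mW WB e0.
  have cNf : continuous (fun x => -1 * f x).
    by apply: continuous_mul => //; exact: continuous_const.
  have NfM x : `|-1 * f x| <= M by rewrite mulN1r normrN.
  have lo := stable_argmax_le cNf NfM mW WB e0.
  apply: filterS3 my up lo => T mY up lo.
  have neg Y : measurable_row Y ->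
      Ex P (fun w => -1 * f (Y w) * W w) = - Ex P (fun w => f (Y w) * W w).
    move=> mY'; transitivity (-1 * Ex P (fun w => f (Y w) * W w)).
      2: by rewrite mulN1r.
    rewrite -ExZ; last exact: bfZ.
    by congr Ex; apply/funext => w; rewrite mulrA.
  rewrite !neg// in lo.
  by rewrite ler_norml; apply/andP; split; lra.
have C0 : 0 <= C.
  have [w0 _] := probability_nonempty P.
  exact: le_trans (ZC w0).
have bC : bounded_rv (fun _ : Omega => C) by exact: bounded_rv_cst.
have bZC : bounded_rv (fun w => Z w + C) by exact: bounded_rvD.
have split_Z (Y : Omega -> 'rV[R]_p) : measurable_row Y -> Ex P (fun w => f (Y w) * Z w) =
    Ex P (fun w => f (Y w) * (Z w + C)) - Ex P (fun w => f (Y w) * C).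
  move=> mY; apply/eqP; rewrite eq_sym subr_eq -ExD; [|exact: bfZ|exact: bfZ].
  by apply/eqP; congr Ex; apply/funext => w; rewrite mulrDr.
rewrite split_Z//.
apply: (@cvg_trans _ ((fun T => Ex P (fun w => f (y T w) * (Z w + C)) -
   Ex P (fun w => f (y T w) * C)) @ F)).
  by apply: near_eq_cvg; apply: filterS my => T mY; rewrite split_Z.
apply: cvgB.
  apply: (pos_cvg _ (C + C)).
    by apply: measurable_funD => //; exact: measurable_cst.
  by move=> w; have := ZC w; rewrite ler_norml => /andP[? ?]; apply/andP; split; lra.
apply: (pos_cvg _ C); first exact: measurable_cst.
by move=> w; rewrite C0 lexx.
Qed.

End StableArgmax.

(** * Tails under stable convergence *)

Section StablePortmanteau.
Context {R : realType} {d : measure_display} {Omega : measurableType d}.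
Context (P : probability Omega R) (G : set (set Omega)).
Context (F : set_system R) {FF : ProperFilter F}.

Lemma cvg_ds_comp (E E' : topologicalType) (phi : E -> E')
    (X : R -> Omega -> E) (Xoo : Omega -> E) :
  continuous phi -> cvg_ds P G F X Xoo ->
  cvg_ds P G F (fun T w => phi (X T w)) (fun w => phi (Xoo w)).
Proof.
move=> cphi XX f Z cf [M fM]; apply: (XX (f \o phi)); last by exists M => x; exact: fM.
by move=> x; apply: continuous_comp; [exact: cphi | exact: cf].
Qed.

Context {E : topologicalType} (X : R -> Omega -> E) (Xoo : Omega -> E).
Context (h : E -> R).
Hypotheses (XX : cvg_ds P G F X Xoo) (ch : continuous h).
Hypothesis mh : \forall T \near F, measurable_fun [set: Omega] (fun w => h (X T w)).
Hypothesis mhoo : measurable_fun [set: Omega] (fun w => h (Xoo w)).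

Let measurable_gt (g : Omega -> R) c : measurable_fun [set: Omega] g ->
  measurable [set w | ~ g w <= c].
Proof.
move=> mg; rewrite (_ : mkset _ = [set: Omega] `&` g @^-1` `]c, +oo[%classic).
  exact: mg.
apply/seteqP; split => w /=; rewrite in_itv/= andbT.
  by move=> /negP; rewrite -ltNge.
by move=> [_]; rewrite ltNge => /negP.
Qed.

(** The indicator of h > b lies below a continuous function which lies below
the indicator of h > a. *)
Lemma cvg_ds_le a b eta eps : a < b -> 0 < eps ->
  (mu_ext P [set w | ~ h (Xoo w) <= a]%R <= eta%:E)%E ->
  \forall T \near F,
    (mu_ext P [set w | ~ h (X T w) <= b]%R <= (eta + eps)%:E)%E.
Proof.
move=> ab eps0 Pa; pose c t := Num.min 1 (Num.max 0 ((t - a) / (b - a))) : R.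
have ba0 : 0 < b - a by rewrite subr_gt0.
have c0 t : 0 <= c t by rewrite le_min ler01 le_max lexx.
have c1 t : c t <= 1 by rewrite ge_min lexx.
have mc (Y : Omega -> E) : measurable_fun setT (fun w => h (Y w)) ->
    bounded_rv (fun w => c (h (Y w)) * 1).
  move=> mY; split; last by exists 1 => w; rewrite mulr1 ger0_norm.
  apply: measurable_funM => //; apply: measurable_minr => //.
  apply: measurable_maxr => //; apply: measurable_funM => //.
  exact: measurable_funB.
have cc : continuous (fun x => c (h x)).
  move=> x; apply: (@continuous_comp _ _ _ h c); first exact: ch.
  move: (h x) => t; apply: (@continuous_min _ _ (fun=> 1)
    (fun t => Num.max 0 ((t - a) / (b - a)))); first exact: cvg_cst.
  apply: (@continuous_max _ _ (fun=> 0) (fun t => (t - a) / (b - a))).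
    exact: cvg_cst.
  by apply: cvgM; [apply: cvgB; [exact: cvg_id | exact: cvg_cst] | exact: cvg_cst].
have cv := XX (f := fun x => c (h x)) (Z := fun _ => 1) cc.
have {}cv : Ex P (fun w => c (h (X T w)) * 1) @[T --> F] -->
    Ex P (fun w => c (h (Xoo w)) * 1).
  apply/cvg_ExE; [by apply: filterS mh => T mT; exact: mc | exact: mc |].
  apply: cv; [by exists 1 => x; rewrite ger0_norm | exact: measurable_cst |].
  by exists 1 => w; rewrite normr1.
move/cvgrPdist_le : cv => /(_ _ eps0); apply: filterS2 mh => T mT.
rewrite ler_norml => /andP[q1 q2].
have mA := measurable_gt a mhoo; have mB := measurable_gt b mT.
rewrite measurable_mu_extE// in Pa; rewrite measurable_mu_extE//.
have finA : P [set w | ~ h (Xoo w) <= a] \is a fin_num by rewrite fin_num_measure.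
have finB : P [set w | ~ h (X T w) <= b] \is a fin_num by rewrite fin_num_measure.
have B_le : fine (P [set w | ~ h (X T w) <= b]) <= Ex P (fun w => c (h (X T w)) * 1).
  rewrite -Ex_indic//; apply: Ex_le; [exact: bounded_rv_indic | exact: mc|] => w.
  rewrite indicE mulr1; have [|wB] := boolP (w \in _); last exact: c0.
  rewrite inE /= => /negP; rewrite -ltNge => bh.
  by rewrite le_min lexx/= le_max ler_pdivlMr// mul1r lerB ?orbT// ltW.
have A_ge : Ex P (fun w => c (h (Xoo w)) * 1) <= fine (P [set w | ~ h (Xoo w) <= a]).
  rewrite -Ex_indic//; apply: Ex_le; [exact: mc | exact: bounded_rv_indic|] => w.
  rewrite indicE mulr1; have [|wA] := boolP (w \in _); first by rewrite c1.
  move: wA; rewrite notin_setE /= => /contrapT ha.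
  rewrite ge_min ge_max lexx/= pmulr_lle0 ?invr_gt0// subr_le0 ha.
  by rewrite orbT.
have : fine (P [set w | ~ h (Xoo w) <= a]) <= eta by rewrite -lee_fin fineK.
move=> Peta; have : fine (P [set w | ~ h (X T w) <= b]) <= eta + eps by lra.
by rewrite -lee_fin fineK.
Qed.

(** The level phi r covers both growing bounds, with phi r = r, and bounds away
from 0, with phi r = - 1/r applied to the opposite of a positive variable. *)
Lemma cvg_ds_tightly (phi : R -> R) :
  (forall r r', 0 < r -> r < r' -> phi r < phi r') ->
  tightly P F (fun r _ w => h (Xoo w) <= phi r) ->
  tightly P F (fun r T w => h (X T w) <= phi r).
Proof.
move=> phiS hoo eta eta0; have e20 : 0 < eta / 2 by rewrite divr_gt0.
have near_0 : \forall r \near +oo, 0 < r :> R.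
  by apply: nbhs_pinfty_gt; exact: num_real.
have [r [r0 /filter_ex[_ hr]]] := filter_ex (filterI near_0 (hoo _ e20)).
near=> r'; rewrite (splitr eta); apply: cvg_ds_le hr => //.
apply: phiS => //; near: r'; apply: nbhs_pinfty_gt; exact: num_real.
Unshelve. all: by end_near. Qed.

End StablePortmanteau.

(** * Matrix norms and Taylor's formula *)

Section FrobeniusNorm.
Context {R : realType}.

Lemma fnorm_sumE m n (A : 'M[R]_(m, n)) :
  fnorm A = Num.sqrt (\sum_i \sum_j A i j ^+ 2).
Proof.
rewrite /fnorm /mxtrace; congr Num.sqrt; apply: eq_bigr => i _.
by rewrite mxE; apply: eq_bigr => j _; rewrite !mxE expr2.
Qed.

Lemma fnorm_ge0 m n (A : 'M[R]_(m, n)) : 0 <= fnorm A.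
Proof. exact: sqrtr_ge0. Qed.

Lemma coord_le_fnorm m n (A : 'M[R]_(m, n)) i j : `|A i j| <= fnorm A.
Proof.
rewrite fnorm_sumE -sqrtr_sqr ler_wsqrtr// (bigD1 i)//= (bigD1 j)//=.
rewrite -addrA lerDl addr_ge0// ?sumr_ge0// => k _; rewrite ?sqr_ge0//.
by apply: sumr_ge0 => l _; rewrite sqr_ge0.
Qed.

Lemma norm_le_fnorm m n (A : 'M[R]_(m, n)) : `|A| <= fnorm A.
Proof. by apply: mx_norm_le => [|i j]; [exact: fnorm_ge0 | exact: coord_le_fnorm]. Qed.

Lemma fnorm_le_norm n (v : 'rV[R]_n) : fnorm v <= n%:R * `|v|.
Proof.
have nv0 : 0 <= n%:R * `|v| by rewrite mulr_ge0.
rewrite fnorm_rowE -(ger0_norm nv0) -sqrtr_sqr ler_wsqrtr//.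
apply: (@le_trans _ _ (\sum_(i < n) `|v| ^+ 2)).
  apply: ler_sum => i _; rewrite -real_normK ?num_real//.
  by rewrite lerXn2r ?nnegrE// mx_coord_le.
rewrite sumr_const card_ord exprMn -[leLHS]mulr_natl ler_wpM2r ?sqr_ge0//.
by rewrite -natrX ler_nat; case: n {v nv0} => // n; rewrite expnS leq_pmulr// expn_gt0.
Qed.

Lemma quadE n (M : 'M[R]_n) (u : 'rV[R]_n) :
  quad M u = \sum_i \sum_j u 0 i * M i j * u 0 j.
Proof.
rewrite /quad mxE exchange_big/=; apply: eq_bigr => j _.
by rewrite !mxE mulr_suml.
Qed.

Lemma quadD n (M M' : 'M[R]_n) u : quad (M + M') u = quad M u + quad M' u.
Proof. by rewrite /quad mulmxDr mulmxDl mxE. Qed.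

Lemma quad_le n (M : 'M[R]_n) (u : 'rV[R]_n) B :
  (forall i j, `|M i j| <= B) -> `|quad M u| <= n%:R ^+ 2 * B * `|u| ^+ 2.
Proof.
move=> MB; rewrite quadE (le_trans (ler_norm_sum _ _ _))//.
apply: (@le_trans _ _ (\sum_(i < n) n%:R * (B * `|u| ^+ 2))).
  apply: ler_sum => i _; rewrite (le_trans (ler_norm_sum _ _ _))//.
  rewrite -[n in n%:R]card_ord -sumr_const mulr_suml ler_sum// => j _.
  rewrite mul1r !normrM mulrAC [leRHS]mulrC expr2.
  by rewrite ler_pM ?mulr_ge0// ler_pM// mx_coord_le.
by rewrite sumr_const card_ord -[leLHS]mulr_natl expr2 !mulrA.
Qed.

End FrobeniusNorm.

Section Taylor.
Context {R : realType}.

Lemma MVT_from0 (phi dphi : R -> R) (c : R) :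
  (forall t : R, `|t| <= `|c| -> is_derive t (1 : R) phi (dphi t)) ->
  exists2 x, `|x| <= `|c| & phi c - phi 0 = dphi x * c.
Proof.
move=> H; have [c0|/ltW c0] := leP 0 c.
  have [t /itvP t0c||x xc e] := @MVT_segment R phi dphi 0 c c0.
  - by apply: H; rewrite !ger0_norm// t0c.
  - apply: derivable_within_continuous => t /itvP t0c.
    by have [] := H t _; rewrite // !ger0_norm// t0c.
  exists x; last by rewrite e subr0.
  by move/itvP : xc => xc; rewrite !ger0_norm// xc.
have [t /itvP t0c||x xc e] := @MVT_segment R phi dphi c 0 c0.
- by apply: H; rewrite !ler0_norm// ?lerN2 t0c.
- apply: derivable_within_continuous => t /itvP t0c.
  by have [] := H t _; rewrite // !ler0_norm// ?lerN2 t0c.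
exists x; last by rewrite -opprB e sub0r mulrN opprK.
by move/itvP : xc => xc; rewrite !ler0_norm// ?lerN2 xc.
Qed.

Lemma is_derive_line (V : normedModType R) (f : V -> R) (z v : V) (t l : R) :
  is_derive (z + t *: v) v f l -> is_derive t (1 : R) (fun t => f (z + t *: v)) l.
Proof.
have E : (fun h : R => h^-1 *: (f (z + (h *: (1:R) + t) *: v) - f (z + t *: v))) =
    (fun h : R => h^-1 *: (f (h *: v + (z + t *: v)) - f (z + t *: v))).
  by apply/funext => h; rewrite scalerDl [in z + _]addrC -addrA [t *: v + z]addrC
    -[h *: 1]/(h * 1) mulr1.
by move=> [dv e]; split; [rewrite /derivable | rewrite -e /derive]; rewrite /= E.
Qed.

Lemma is_derive_quadratic (a b t : R) :
  is_derive t (1 : R) (fun t : R => a * t + b * t ^+ 2) (a + 2 * b * t).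
Proof.
apply: (@is_derive_eq _ _ _ (fun t : R => a * t + b * t ^+ 2)).
have E (x y : R) : x *: y = x * y by [].
by rewrite !E; ring.
Qed.

(** The mean value theorem is applied to phi minus its quadratic approximation
and then to the derivative of that difference; continuity on the closed segment
is enough at 0, where phi may fail to be differentiable. *)
Lemma taylor01 (phi dphi ddphi : R -> R) (c e : R) :
  (forall t : R, t \in `]0, 1[ -> is_derive t (1 : R) phi (dphi t)) ->
  (forall t : R, t \in `]0, 1[ -> is_derive t (1 : R) dphi (ddphi t)) ->
  {within `[0, 1], continuous phi} -> {within `[0, 1], continuous dphi} ->
  (forall t, t \in `]0, 1[ -> `|ddphi t - c| <= e) ->
  `|phi 1 - phi 0 - dphi 0 - c / 2| <= e.
Proof.
move=> d1 d2 c1 c2 He.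
have cq (a b : R) : continuous (fun t : R => a * t + b * t ^+ 2).
  move=> t; have [d _] := is_derive_quadratic a b t.
  exact/differentiable_continuous/derivable1_diffP.
pose chi t := phi t - (dphi 0 * t + c / 2 * t ^+ 2).
have [t t01||x x01 ex] :=
    @MVT R chi (fun t => dphi t - (dphi 0 + 2 * (c / 2) * t)) 0 1 ltr01.
- by apply: is_deriveB; [exact: d1 | exact: is_derive_quadratic].
- apply: continuous_sub; first exact: c1.
  exact: continuous_subspaceT.
have /andP[x0 x1] : 0 < x < 1 by move: x01; rewrite in_itv.
have [t t0x||z z0x ez] :=
    @MVT R (fun t => dphi t - (c * t + 0 * t ^+ 2)) (fun t => ddphi t - (c + 2 * 0 * t)) 0 x x0.
- have t01 : t \in `]0, 1[.
    by move: t0x; rewrite !in_itv/= => /andP[-> /lt_trans->].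
  by apply: is_deriveB; [exact: d2 | exact: is_derive_quadratic].
- apply: continuous_sub; last exact: continuous_subspaceT.
  apply: continuous_subspaceW c2 => t /=; rewrite !in_itv/= => /andP[-> /le_trans->//].
  exact: ltW.
have z01 : z \in `]0, 1[.
  by move: z0x; rewrite !in_itv/= => /andP[-> /lt_trans->].
have := He z z01; rewrite /chi in ex; rewrite !expr2 in ex ez.
have -> : phi 1 - phi 0 - dphi 0 - c / 2 = (ddphi z - c) * x by lra.
move=> H; rewrite normrM (ger0_norm (ltW x0)) (le_trans _ H)//.
by rewrite ler_piMr// ltW.
Qed.

End Taylor.

(** * Differentiability from continuous partial derivatives *)

Section TotalDerivative.
Context {R : realType} {p : nat} (N : set 'rV[R]_p).
Hypothesis oN : open N.
Context (f : 'rV[R]_p -> R) (g : 'rV[R]_p -> 'rV[R]_p).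
Hypothesis df : forall x j, N x -> is_derive x (delta_mx 0 j) f (g x 0 j).
Hypothesis cg : forall x, N x -> g y @[y --> x] --> g x.

(** The vertices of the path from 0 to k that moves one coordinate at a time. *)
Let trunc (k : 'rV[R]_p) (j : nat) : 'rV[R]_p :=
  \row_i (if (i < j)%N then k 0 i else 0).

Let truncS k (j : 'I_p) : trunc k j.+1 = trunc k j + k 0 j *: delta_mx 0 j.
Proof.
apply/rowP => i; rewrite !mxE eqxx /=; have [->|ij] := eqVneq i j.
  by rewrite ltnSn ltnn add0r mulr1.
have ij' : val i != val j by rewrite val_eqE.
by rewrite mulr0 addr0 ltnS leq_eqVlt (negbTE ij').
Qed.

Let trunc_le (k : 'rV[R]_p) (j : 'I_p) (t : R) : `|t| <= `|k 0 j| ->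
  `|trunc k j + t *: delta_mx 0 j| <= `|k|.
Proof.
move=> tk; apply: row_norm_le => // i; rewrite !mxE eqxx /=.
have [->|ij] := eqVneq i j.
  by rewrite ltnn add0r mulr1 (le_trans tk)// mx_coord_le.
by rewrite mulr0 addr0; case: ifP => _; rewrite ?normr0// mx_coord_le.
Qed.

(** Moving one coordinate at a time, each increment of f is given by the mean
value theorem in that coordinate, at a point where g is close to g x. *)
Lemma partials_differentiable x e : N x -> 0 < e -> exists2 dl, 0 < dl &
  forall k, `|k| < dl -> `|f (x + k) - f x - dotv (g x) k| <= e * `|k|.
Proof.
move=> Nx e0; have e10 : 0 < e / p.+1%:R by rewrite divr_gt0.
have /nbhs_ballP[d1 d10 H1] := open_nbhs_nbhs (conj oN Nx).
have /cvgrPdist_le/(_ _ e10)/nbhs_ballP[d2 d20 H2] := cg Nx.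
exists (Num.min d1 d2); first by rewrite lt_min d10.
move=> k; rewrite lt_min => /andP[k1 k2].
have Nball y : `|y| <= `|k| -> N (x + y).
  move=> yk; apply: H1; rewrite -ball_normE/= opprD addrA subrr sub0r normrN.
  exact: le_lt_trans yk k1.
have gball y : `|y| <= `|k| -> `|g x - g (x + y)| <= e / p.+1%:R.
  move=> yk; apply: H2; rewrite -ball_normE/= opprD addrA subrr sub0r normrN.
  exact: le_lt_trans yk k2.
have tp : trunc k p = k by apply/rowP => i; rewrite mxE ltn_ord.
have t0 : trunc k 0 = 0 by apply/rowP => i; rewrite !mxE.
have tele : f (x + k) - f x =
    \sum_(j < p) (f (x + trunc k j.+1) - f (x + trunc k j)).
  rewrite -(big_mkord xpredT (fun j => f (x + trunc k j.+1) - f (x + trunc k j))).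
  by rewrite (telescope_sumr (fun j => f (x + trunc k j)))// tp t0 addr0.
have step (j : 'I_p) : exists2 y, `|y| <= `|k| &
    f (x + trunc k j.+1) - f (x + trunc k j) = g (x + y) 0 j * k 0 j.
  pose z := x + trunc k j.
  have [t /trunc_le tk|t /trunc_le tk et] :=
      @MVT_from0 R (fun t => f (z + t *: delta_mx 0 j))
        (fun t => g (z + t *: delta_mx 0 j) 0 j) (k 0 j).
    by apply: is_derive_line; apply: df; rewrite /z -addrA; exact: Nball.
  exists (trunc k j + t *: delta_mx 0 j) => //.
  by rewrite truncS !addrA -et scale0r addr0.
rewrite tele /dotv -sumrB (le_trans (ler_norm_sum _ _ _))//.
apply: (@le_trans _ _ (\sum_(j < p) e / p.+1%:R * `|k|)).
  apply: ler_sum => j _; have [y yk ->] := step j.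
  rewrite -mulrBl normrM ler_pM// ?mx_coord_le// (le_trans _ (gball y yk))//.
  by rewrite distrC; have := mx_coord_le (g x - g (x + y)) 0 j; rewrite !mxE.
rewrite sumr_const card_ord -mulrnAl ler_wpM2r//.
rewrite -mulrnAr -[X in _ * X]mulr_natl -[leRHS]mulr1 ler_wpM2l//; first exact: ltW.
by rewrite ler_pdivrMr// mul1r ler_nat.
Qed.

(** Partial derivatives alone do not give derivatives along an arbitrary segment:
this is where the continuity of the gradient enters. *)
Lemma is_derive_direction x v : N x -> is_derive x v f (dotv (g x) v).
Proof.
move=> Nx.
suff cv : (fun h : R => h^-1 *: (f (h *: v + x) - f x)) @ 0^' --> dotv (g x) v.
  by split; [apply/cvg_ex; exists (dotv (g x) v) | exact: cvg_lim].
apply/cvgrPdist_le => e e0.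
have v0 : 0 < `|v| + 1 by rewrite ltr_wpDl.
have e10 : 0 < e / (`|v| + 1) by rewrite divr_gt0.
have [dl dl0 H] := partials_differentiable Nx e10.
near=> h.
have h0 : h != 0 by near: h; exact: nbhs_dnbhs_neq.
have hdl : `|h| < dl / (`|v| + 1).
  near: h; apply: dnbhs0_lt; exact: divr_gt0.
have hv : `|h *: v| < dl.
  rewrite normrZ; move: hdl; rewrite ltr_pdivlMr//; apply: le_lt_trans.
  by rewrite ler_wpM2l// lerDl.
have := H _ hv; rewrite [x + _]addrC.
have -> : dotv (g x) (h *: v) = h * dotv (g x) v.
  rewrite /dotv mulr_sumr; apply: eq_bigr => i _; rewrite !mxE; ring.
move=> H'; rewrite distrC -[_ *: _]/(h^-1 * _).
have -> : h^-1 * (f (h *: v + x) - f x) - dotv (g x) v =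
    h^-1 * (f (h *: v + x) - f x - h * dotv (g x) v).
  by field.
rewrite normrM normfV ler_pdivrMl ?normr_gt0//.
apply: (le_trans H'); rewrite normrZ mulrCA ler_wpM2l//.
rewrite mulrAC ler_pdivrMr// ler_wpM2l//; first exact: ltW.
by rewrite lerDl.
Unshelve. all: by end_near. Qed.

End TotalDerivative.

(** * Second-order expansion near the vertex of a star-shaped set *)

Section SecondOrderExpansion.
Context {R : realType} {p : nat} (N : set 'rV[R]_p) (thstar : 'rV[R]_p).
Hypotheses (oN : open N) (N0 : N !=set0).
Hypothesis Nstar : forall (th : 'rV[R]_p) (t : R), N th -> 0 < t <= 1 ->
  N (t *: th + (1 - t) *: thstar).
Context (f : 'rV[R]_p -> R) (g : 'rV[R]_p -> 'rV[R]_p) (h : 'rV[R]_p -> 'M[R]_p).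
Hypothesis C2f : C2_closure N f g h.

(** The vertex need not belong to N: it is reached along a segment only in the
limit. *)
Lemma star_closure : closure N thstar.
Proof.
have [th Nth] := N0; move=> B /nbhs_ballP[e e0 eB].
pose t := Num.min 1 (e / 2 / (`|th - thstar| + 1)).
have d0 : 0 < `|th - thstar| + 1 by rewrite ltr_wpDl.
have t0 : 0 < t by rewrite lt_min ltr01 !divr_gt0.
exists (t *: th + (1 - t) *: thstar); split.
  by apply: Nstar => //; rewrite t0 ge_min lexx.
apply: eB; rewrite -ball_normE/=.
have -> : thstar - (t *: th + (1 - t) *: thstar) = - (t *: (th - thstar)).
  by apply/rowP => j; rewrite !mxE; ring.
rewrite normrN normrZ gtr0_norm//.
have : t * (`|th - thstar| + 1) <= e / 2.
  by rewrite -ler_pdivlMr// ge_min lexx orbT.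
have : e / 2 < e by rewrite ltr_pdivrMr// ltr_pMr// ltr1n.
move=> a b; apply: le_lt_trans a; apply: le_trans b.
by rewrite ler_wpM2l ?lerDl// ltW.
Qed.

Let linear_quad (k y : 'rV[R]_p) : dotv (\row_j dotv (\row_i h y i j) k) k = quad (h y) k.
Proof.
rewrite quadE exchange_big/= /dotv; apply: eq_bigr => j _; rewrite !mxE mulr_suml.
by apply: eq_bigr => i _; rewrite !mxE; ring.
Qed.

Let is_derive_grad (k y : 'rV[R]_p) : N y ->
  is_derive y k (fun y => dotv (g y) k) (quad (h y) k).
Proof.
move=> Ny; have [df dg cf cg ch] := C2f.
have gj (j : 'I_p) : is_derive y k (fun y => g y 0 j) (dotv (\row_i h y i j) k).
  apply: (is_derive_direction oN (g := fun x => \row_i h x i j)) Ny.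
    by move=> x i Nx; rewrite mxE; exact: dg.
  move=> x Nx; apply: (@cvg_row R _ (nbhs x) (nbhs_filter x)) => i; rewrite mxE; under eq_fun do rewrite mxE.
  have := within_continuous_open oN (@subset_closure _ N) ch Nx.
  move=> chx; apply: (@continuous_comp _ _ _ h (fun M => M i j)) => //.
  exact: coord_continuous.
rewrite -linear_quad {1}/dotv.
have -> : (fun y => dotv (g y) k) = \sum_(j < p) (fun y => k 0 j * g y 0 j).
  apply/funext => x; rewrite fct_sumE /dotv; apply: eq_bigr => j _; exact: mulrC.
apply: is_derive_sum => j; rewrite mxE [_ * k 0 j]mulrC.
exact: (is_deriveZ (k 0 j)).
Qed.

Lemma C2_expansion_open (th : 'rV[R]_p) (c e : R) : N th ->
  (forall y, N y -> `|y - thstar| <= `|th - thstar| ->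
    `|quad (h y) (th - thstar) - c| <= e) ->
  `|f th - f thstar - dotv (g thstar) (th - thstar) - c / 2| <= e.
Proof.
move=> Nth He; have [df dg cf cg ch] := C2f.
set k := th - thstar in He *.
have seg t : 0 < t <= 1 -> N (thstar + t *: k).
  move=> /(Nstar Nth); congr N; apply/rowP => j; rewrite !mxE; ring.
have cseg (t : R) : t \in `[0, 1] -> closure N (thstar + t *: k).
  rewrite in_itv/= le_eqVlt => /andP[/orP[/eqP <- _|t0 t1]].
    by rewrite scale0r addr0; exact: star_closure.
  by apply: subset_closure; apply: seg; rewrite t0.
have seg' t : t \in `]0, 1[ -> N (thstar + t *: k).
  by rewrite in_itv/= => /andP[t0 t1]; apply: seg; rewrite t0 ltW.
have := @taylor01 R (fun t => f (thstar + t *: k))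
  (fun t => dotv (g (thstar + t *: k)) k) (fun t => quad (h (thstar + t *: k)) k) c e.
have -> : thstar + 1 *: k = th by rewrite scale1r addrC subrK.
have -> : thstar + 0 *: k = thstar by rewrite scale0r addr0.
apply.
- move=> t /seg' Nt; apply: is_derive_line.
  apply: (is_derive_direction oN df) => // x Nx.
  exact: (within_continuous_open oN (@subset_closure _ N) cg).
- move=> t /seg' Nt.
  exact: (is_derive_line (f := fun y => dotv (g y) k) (is_derive_grad k Nt)).
- exact: within_continuous_line cf cseg.
- apply: (within_continuous_line (u := fun y => dotv (g y) k) _ cseg).
  apply: continuous_bigsum => j _; apply: continuous_mul; last exact: continuous_const.
  exact: continuous_coord.
- move=> t /[dup] /seg' Nt; rewrite in_itv/= => /andP[t0 t1]; apply: He => //.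
  rewrite addrAC subrr add0r normrZ gtr0_norm// ler_piMl// ltW//.
Qed.

(** Points of the closure are approached from N; the error bound is therefore
stated with functions Q and E of the increment that are continuous, in practice
the quadratic form of the opposite of Gamma and a multiple of a squared norm. *)
Lemma C2_expansion (Q E : 'rV[R]_p -> R) (dl : R) (th : 'rV[R]_p) :
  continuous Q -> continuous E ->
  (forall y v, N y -> `|y - thstar| < dl -> `|quad (h y) v - Q v| <= E v) ->
  closure N th -> `|th - thstar| < dl ->
  `|f th - f thstar - dotv (g thstar) (th - thstar) - Q (th - thstar) / 2|
    <= E (th - thstar).
Proof.
move=> cQ cE He Nth thdl; have [df dg cf cg ch] := C2f.
pose D y := f y - f thstar - dotv (g thstar) (y - thstar) - Q (y - thstar) / 2.
pose Phi y := E (y - thstar) - `|D y|.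
have csub : continuous (fun y : 'rV[R]_p => y - thstar).
  apply: (lipschitz_continuous ler01) => s t.
  by rewrite opprB addrA subrK mul1r.
have csubW (u : 'rV[R]_p -> R) : continuous u ->
    {within closure N, continuous (fun y => u (y - thstar))}.
  move=> cu; apply: continuous_subspaceT.
  exact: (continuous_compose csub cu).
have cPhi : {within closure N, continuous Phi}.
  apply: continuous_sub; first exact: csubW.
  apply: (@continuous_norm R (subspace (closure N)) R D); apply: continuous_sub.
    apply: continuous_sub.
      by apply: continuous_sub => //; exact: continuous_const.
    apply: (csubW (fun v => dotv (g thstar) v)).
    apply: continuous_bigsum => j _; apply: continuous_mul.
      exact: continuous_const.
    exact: coord_continuous.
  by apply: continuous_mul; [exact: csubW | exact: continuous_const].
rewrite -subr_ge0 -[leRHS]/(Phi th) leNgt; apply/negP => neg.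
have neg' : 0 < - Phi th by rewrite oppr_gt0.
have [d1 d10 Hd] := within_continuousP cPhi Nth neg'.
pose r := Num.min d1 (dl - `|th - thstar|).
have r0 : 0 < r by rewrite lt_min d10 subr_gt0.
have [y [Ny /= yr]] := Nth _ (nbhsx_ballx th r r0).
have {}yr : `|th - y| < r by move: yr; rewrite -ball_normE.
move: yr; rewrite lt_min => /andP[y1 y2].
have ydl : `|y - thstar| < dl.
  rewrite -(subrK th y) -addrA (le_lt_trans (ler_normD _ _))//.
  by rewrite distrC -ltrBrDr.
have Phiy : 0 <= Phi y.
  rewrite subr_ge0; apply: C2_expansion_open => // z Nz zy; apply: He => //.
  exact: le_lt_trans zy ydl.
have := Hd y (subset_closure Ny) y1; rewrite ltr_norml => /andP[? ?]; lra.
Qed.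

End SecondOrderExpansion.

(** * Powers, one-variable expansions and deterministic rates *)

Section RealAnalysis.
Context {R : realType}.

Lemma continuous_powR_norm (q : R) : 0 < q -> continuous (fun x : R => `|x| `^ q).
Proof.
move=> q0 x; have [->|x0] := eqVneq x 0.
  apply/cvgrPdist_lt => e e0; rewrite normr0 powR0 ?gt_eqF//.
  have e'0 : 0 < e `^ q^-1 by exact: powR_gt0.
  have : \forall t \near (0 : R), `|0 - t| < e `^ q^-1.
    by apply/nbhs_ballP; exists (e `^ q^-1) => // t; rewrite -ball_normE.
  apply: filterS => t; rewrite !sub0r !normrN => te.
  rewrite ger0_norm ?powR_ge0//.
  have -> : e = (e `^ q^-1) `^ q by rewrite -powRrM mulVf ?gt_eqF// powRr1// ltW.
  by apply: gt0_ltr_powR => //; rewrite ?nnegrE// powR_ge0.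
have E (t : R) : t != 0 -> expR (q * ln `|t|) = `|t| `^ q.
  by move=> t0; rewrite /powR normr_eq0 (negbTE t0).
have cv : (fun t : R => expR (q * ln `|t|)) @ x --> expR (q * ln `|x|).
  apply: (@continuous_comp _ _ _ (fun t : R => q * ln `|t|) expR).
    apply: cvgM; first exact: cvg_cst.
    apply: (@continuous_comp _ _ _ (fun t : R => `|t|) (@ln R)).
      exact: norm_continuous.
    by apply: continuous_ln; rewrite normr_gt0.
  exact: continuous_expR.
rewrite E// in cv; apply: cvg_trans cv.
apply: near_eq_cvg; near=> t; apply: E; near: t.
exact: (@cvgr_neq0 _ _ _ (nbhs x) _ id x _ x0).
Unshelve. all: by end_near. Qed.

Lemma derivable_expansion (f : R -> R) (x e : R) : derivable f x 1 -> 0 < e ->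
  exists2 dl, 0 < dl & forall y, `|y - x| < dl ->
    `|f y - f x - derive1 f x * (y - x)| <= e * `|y - x|.
Proof.
move=> df e0; have := df; rewrite /derivable => /cvg_lim cv.
have {}cv : (fun h : R => h^-1 *: (f (h *: (1:R) + x) - f x)) @ 0^' --> derive1 f x.
  by rewrite derive1E /derive; exact: df.
move/cvgrPdist_le : cv => /(_ _ e0) /nbhs_ballP[dl dl0 H].
exists dl => // y yx; have [->|yx0] := eqVneq y x.
  by rewrite !subrr mulr0 subr0 !normr0 mulr0.
have d0 : y - x != 0 by rewrite subr_eq0.
have := H (y - x); rewrite -ball_normE/= sub0r normrN => /(_ yx d0).
rewrite -![_ *: _]/(_ * _) mulr1 subrK => H'.
have -> : f y - f x - derive1 f x * (y - x) =
    - ((derive1 f x - (y - x)^-1 * (f y - f x)) * (y - x)) by field.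
by rewrite normrN normrM ler_wpM2r.
Qed.

(** The rate is, at each T, the infimum of the levels e that are reached with
probability at most e, plus the sequence b, which makes it positive. *)
Lemma whp_rate (d : measure_display) (Omega : measurableType d)
    (P : probability Omega R) (F : set_system R) {FF : Filter F}
    (X : R -> Omega -> R) (b : R -> R) :
  (\forall T \near F, 0 < b T) -> b T @[T --> F] --> 0 ->
  (forall e, 0 < e -> whp P F (fun T w => X T w < e)) ->
  exists2 a : R -> R, (forall T, b T <= a T) /\ a T @[T --> F] --> 0 &
    whp P F (fun T w => X T w < a T).
Proof.
move=> b0 cb hX.
pose S T := [set e | 0 < e /\ (mu_ext P [set w | ~ X T w < e]%R <= e%:E)%E].
have S1 T : S T 1.
  split=> //; apply: (@le_trans _ _ (mu_ext P setT)); first exact: mu_extS.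
  by rewrite measurable_mu_extE// probability_le1.
have S0 T : lbound (S T) 0 by move=> e [/ltW].
have inf0 T : 0 <= inf (S T) by apply: lb_le_inf; [exists 1 | exact: S0].
have infS e : 0 < e -> \forall T \near F, inf (S T) <= e.
  move=> e0; apply: filterS (hX e e0 e e0) => T h.
  by apply: ge_inf; [exists 0; exact: S0 | split].
pose a T := inf (S T) + b T.
have a_cvg : a T @[T --> F] --> 0.
  rewrite -[0]addr0; apply: cvgD => //; apply/cvgrPdist_le => e e0.
  by apply: filterS (infS e e0) => T; rewrite sub0r normrN ger0_norm.
exists a; first by split => // T; rewrite lerDr.
move=> eta eta0; near=> T.
have bT0 : 0 < b T by near: T.
have hiS : has_inf (S T) by split; [exists 1; exact: S1 | exists 0; exact: S0].
have [e [e0 Pe] ea] := inf_adherent bT0 hiS.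
apply: (@le_trans _ _ e%:E).
  apply: le_trans Pe; apply: mu_extS => w /=; apply: contra_not => /lt_le_trans; apply.
  exact: ltW.
rewrite lee_fin ltW// (lt_le_trans ea)//.
have : `|0 - a T| <= eta by near: T; move/cvgrPdist_le : a_cvg => /(_ _ eta0).
by rewrite sub0r normrN => /ler_normlW.
Unshelve. all: by end_near. Qed.

(** The error of the local expansion: h and l are the increments of the criterion
and of its smooth penalties, m is the singular penalty, a and a' are the score
terms at two values of the nuisance parameter, b is the quadratic term. *)
Lemma combine_errors (h a a' b l l' m e n n2 : R) :
  `|h - a' + 2^-1 * b| <= e * n2 -> `|a' - a| <= e / 2 * n ->
  `|l - l'| <= e / 2 * n ->
  `|h - l - m - (a - 2^-1 * b - l' - m)| <= e * (n + n2).
Proof.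
rewrite !ler_norml => /andP[b1 b2] /andP[b3 b4] /andP[b5 b6].
by apply/andP; split; lra.
Qed.

(** If hy beats hu and both are close to f, then f at a nearly beats f at a';
the four errors come from two approximations of h by f and from two moves of
the argument of f. *)
Lemma chain_bounds (fa fa' fu fy hy hu h0 e : R) : `|fu - fa'| <= e / 4 ->
  `|hu - h0 - fu| <= e / 4 -> hu <= hy -> `|hy - h0 - fy| <= e / 4 ->
  `|fa - fy| <= e / 4 -> fa' <= fa + e.
Proof.
rewrite !ler_norml => /andP[x1 x2] /andP[x3 x4] x5 /andP[x6 x7] /andP[x8 x9].
lra.
Qed.

(** A nonnegative increment x leaves at least half of the quadratic term b, and the
penalty m, to be compensated by the linear terms. *)
Lemma quadratic_bound (x l' b m a l e n : R) : 0 <= x ->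
  `|x - (a - 2^-1 * b - l' - m)| <= e * (n + n ^+ 2) -> `|a - l'| <= l * n ->
  n ^+ 2 * (2 * e) <= 2^-1 * b -> m + n ^+ 2 * e <= (l + e) * n.
Proof. by rewrite !ler_norml => x0 /andP[_ b1] /andP[_ b2] b3; lra. Qed.

End RealAnalysis.

(** * Local coordinates and the linear form of the log-field *)

Section LocalCoordinates.
Context {R : realType} {p : nat}.
Implicit Types (th u : 'rV[R]_p).

Lemma dotv_row_mx m n (a c : 'rV[R]_m) (b e : 'rV[R]_n) :
  dotv (row_mx a b) (row_mx c e) = dotv a c + dotv b e.
Proof.
rewrite /dotv big_split_ord/=; congr (_ + _); apply: eq_bigr => i _.
  by rewrite !row_mxEl.
by rewrite !row_mxEr.
Qed.

Lemma dotv_mxvec m n (A B : 'M[R]_(m, n)) :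
  dotv (mxvec A) (mxvec B) = \sum_i \sum_j A i j * B i j.
Proof.
rewrite /dotv (reindex _ (curry_mxvec_bij m n)) pair_bigA/=.
by apply: eq_bigr => -[i j] _ /=; rewrite !mxvecE.
Qed.

Lemma row_diag_mx (d u : 'rV[R]_p) j : (u *m diag_mx d) 0 j = u 0 j * d 0 j.
Proof. by rewrite mul_mx_diag mxE. Qed.

Lemma invmx_diag (d : 'rV[R]_p) : (forall j, d 0 j != 0) ->
  invmx (diag_mx d) = diag_mx (\row_j (d 0 j)^-1).
Proof.
move=> d0; have dd : diag_mx d *m diag_mx (\row_j (d 0 j)^-1) = 1%:M.
  rewrite mul_diag_mx; apply/matrixP => i j; rewrite !mxE.
  by have [->|ij] := eqVneq i j; rewrite ?mulr1n ?divff// mulr0n mulr0.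
have [ud _] := mulmx1_unit dd.
by rewrite -[RHS](mulKmx ud) dd mulmx1.
Qed.

Context (J : {set 'I_p}) (thstar : 'rV[R]_p) (rho qe : 'I_p -> R).
Context (pen : 'I_p -> R -> R).

Let n1 := #|J1 J thstar|.
Let n0 := #|J0 J thstar|.

(** The logarithm of a quasi-field is linear in its coefficients: psi lists the
functions of u that they multiply. *)
Definition psi u : 'rV[R]_(p + n1 + n0 + p * p) :=
  let bu := u *m bmx J thstar rho in
  row_mx (row_mx (row_mx bu
    (\row_(i < n1) - (derive1 (pen (enum_val i)) (thstar 0 (enum_val i)) * u 0 (enum_val i))))
    (\row_(k < n0) - (`|u 0 (enum_val k)| `^ qe (enum_val k))))
    (mxvec (- 2^-1 *: (bu^T *m bu))).

Definition coefs (D : 'rV[R]_p) (c d : 'I_p -> R) : 'rV[R]_(p + n1 + n0) :=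
  row_mx (row_mx D (\row_(i < n1) c (enum_val i))) (\row_(k < n0) d (enum_val k)).

Lemma dotv_psi D (Gam : 'M[R]_p) c d u :
  let bu := u *m bmx J thstar rho in
  dotv (row_mx (coefs D c d) (mxvec Gam)) (psi u) =
  dotv D bu - 2^-1 * quad Gam bu
  - \sum_(i in J1 J thstar) c i * derive1 (pen i) (thstar 0 i) * u 0 i
  - \sum_(k in J0 J thstar) d k * `|u 0 k| `^ qe k.
Proof.
move=> bu; rewrite /psi /coefs -/bu !dotv_row_mx dotv_mxvec.
have -> : \sum_i \sum_j Gam i j * (- 2^-1 *: (bu^T *m bu)) i j = - (2^-1 * quad Gam bu).
  rewrite quadE mulr_sumr -sumrN; apply: eq_bigr => i _.
  rewrite mulr_sumr -sumrN; apply: eq_bigr => j _.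
  by rewrite !mxE big_ord1 !mxE; ring.
have -> : dotv (\row_(i < n1) c (enum_val i)) (\row_(i < n1) - (derive1 (pen (enum_val i)) (thstar 0 (enum_val i)) * u 0 (enum_val i))) =
    - \sum_(i in J1 J thstar) c i * derive1 (pen i) (thstar 0 i) * u 0 i.
  rewrite big_enum_val /dotv -sumrN; apply: eq_bigr => i _.
  by rewrite !mxE mulrN mulrA.
have -> : dotv (\row_(k < n0) d (enum_val k)) (\row_(k < n0) - (`|u 0 (enum_val k)| `^ qe (enum_val k))) =
    - \sum_(k in J0 J thstar) d k * `|u 0 k| `^ qe k.
  rewrite big_enum_val /dotv -sumrN; apply: eq_bigr => i _.
  by rewrite !mxE mulrN.
ring.
Qed.

Lemma quasi_fieldE D (Gam : 'M[R]_p) c d u :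
  quasi_field J thstar rho pen qe D Gam c d u =
  expR (dotv (row_mx (coefs D c d) (mxvec Gam)) (psi u)).
Proof. by rewrite dotv_psi. Qed.

Lemma continuous_psi : (forall k, k \in J0 J thstar -> 0 < qe k) ->
  continuous psi.
Proof.
move=> q0.
have cu (j : 'I_p) : continuous (fun u : 'rV[R]_p => u 0 j) by exact: coord_continuous.
have cbu (j : 'I_p) : continuous (fun u => (u *m bmx J thstar rho) 0 j).
  rewrite (_ : (fun u => _) = (fun u => u 0 j *
    (\row_j (if j \in J0 J thstar then (rho j == 1)%:R else 1 : R)) 0 j)).
    by apply: continuous_mul => //; exact: continuous_const.
  by apply/funext => u; rewrite row_diag_mx.
apply: continuous_row => j.
have [j1 ->|j1 ->] := split_ordP j.
  have [j2 ->|k ->] := split_ordP j1.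
    have [j3 ->|i ->] := split_ordP j2.
      rewrite (_ : (fun u => _) = (fun u => (u *m bmx J thstar rho) 0 j3))//.
      by apply/funext => u; rewrite /psi !row_mxEl.
    rewrite (_ : (fun u => _) = (fun u =>
      - derive1 (pen (enum_val i)) (thstar 0 (enum_val i)) * u 0 (enum_val i))).
      by apply: continuous_mul => //; exact: continuous_const.
    by apply/funext => u; rewrite /psi !row_mxEl row_mxEr mxE mulNr.
  rewrite (_ : (fun u => _) = (fun u => -1 * `|u 0 (enum_val k)| `^ qe (enum_val k))).
    apply: continuous_mul; first exact: continuous_const.
    apply: (continuous_compose (v := fun t : R => `|t| `^ qe (enum_val k))) => //.
    by apply: continuous_powR_norm; apply: q0; exact: enum_valP.
  by apply/funext => u; rewrite /psi row_mxEl row_mxEr mxE mulN1r.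
case/mxvec_indexP: j1 => i k.
rewrite (_ : (fun u => _) = (fun u => - 2^-1 *
    ((u *m bmx J thstar rho) 0 i * (u *m bmx J thstar rho) 0 k))).
  by apply: continuous_mul; [exact: continuous_const | exact: continuous_mul].
by apply/funext => u; rewrite /psi row_mxEr mxvecE !mxE big_ord1 !mxE.
Qed.

Context (a : 'rV[R]_p).
Hypothesis a0 : forall j, 0 < a 0 j.

(** Two rescalings of the deviation from the true value: u at the rates of the
estimator, v at the rates of the score. *)
Definition rate (j : 'I_p) : R :=
  if j \in J0 J thstar then a 0 j `^ rho j else a 0 j.
Definition ucoord th : 'rV[R]_p := \row_j ((th - thstar) 0 j / rate j).
Definition vcoord th : 'rV[R]_p := \row_j ((th - thstar) 0 j / a 0 j).

Lemma rate_gt0 j : 0 < rate j.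
Proof. by rewrite /rate; case: ifP => _ //; exact: powR_gt0. Qed.

Lemma ucoordK th : thstar + ucoord th *m diag_mx (\row_j rate j) = th.
Proof.
apply/rowP => j; rewrite mxE row_diag_mx !mxE divfK ?gt_eqF ?rate_gt0//.
by rewrite addrC subrK.
Qed.

Lemma ucoord_invmx th :
  (th - thstar) *m invmx (diag_mx (\row_j rate j)) = ucoord th.
Proof.
rewrite invmx_diag => [|j]; last by rewrite mxE gt_eqF ?rate_gt0.
by apply/rowP => j; rewrite row_diag_mx !mxE.
Qed.

Lemma ucoord_add u : ucoord (thstar + u *m diag_mx (\row_j rate j)) = u.
Proof.
apply/rowP => j; rewrite mxE addrAC subrr add0r row_diag_mx mxE mulfK//.
by rewrite gt_eqF ?rate_gt0.
Qed.

Lemma vcoord_notin th j : j \notin J0 J thstar -> vcoord th 0 j = ucoord th 0 j.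
Proof. by move=> jJ; rewrite !mxE /rate (negbTE jJ). Qed.

Lemma vcoord_in th k : k \in J0 J thstar ->
  vcoord th 0 k = a 0 k `^ (rho k - 1) * ucoord th 0 k.
Proof.
move=> kJ; rewrite !mxE /rate kJ.
have ak0 := a0 k; have r0 := powR_gt0 (rho k) ak0.
have -> : a 0 k `^ (rho k - 1) = a 0 k `^ rho k / a 0 k.
  by rewrite powRB ?powRr1// ?(ltW ak0)// (gt_eqF ak0) implybT.
by field; rewrite !gt_eqF.
Qed.

Lemma dev_vcoord th j : (th - thstar) 0 j = a 0 j * vcoord th 0 j.
Proof. by rewrite [vcoord _ _ _]mxE mulrC divfK// gt_eqF. Qed.

(** Deviations are at most the rates times the rescaled coordinates, so bounded
sets of coordinates shrink to the true value. *)
Lemma dev_le_ucoord th :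
  `|th - thstar| <= \sum_j rate j * `|ucoord th|.
Proof.
apply: row_norm_le => [|j].
  by rewrite sumr_ge0// => j _; rewrite mulr_ge0// ltW// rate_gt0.
have -> : (th - thstar) 0 j = rate j * ucoord th 0 j.
  by rewrite [ucoord _ _ _]mxE mulrC divfK// gt_eqF ?rate_gt0.
rewrite normrM gtr0_norm ?rate_gt0// (bigD1 j)//= -[leLHS]addr0 lerD//.
  by rewrite ler_wpM2l ?mx_coord_le// ltW// rate_gt0.
by rewrite sumr_ge0// => i _; rewrite mulr_ge0// ltW// rate_gt0.
Qed.

Lemma bmx_norm_le u : `|u *m bmx J thstar rho| <= `|u|.
Proof.
apply: row_norm_le => // j; rewrite row_diag_mx mxE normrM.
rewrite -[leRHS]mulr1 ler_pM ?mx_coord_le//.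
by case: ifP => _; rewrite ?normr1// normr_nat lern1 leq_b1.
Qed.

(** The score coordinates of a component with an accelerated rate vanish in the
limit, whereas those of the other components are those of the estimator: this
is the origin of the matrix b. *)
Lemma vcoord_sub_bmx th : (forall k, k \in J0 J thstar -> 1 <= rho k) ->
  `|vcoord th - ucoord th *m bmx J thstar rho| <=
  \sum_(k in J0 J thstar | rho k != 1) a 0 k `^ (rho k - 1) * `|ucoord th|.
Proof.
move=> rho1; have pos k : 0 <= a 0 k `^ (rho k - 1) * `|ucoord th|.
  by rewrite mulr_ge0// powR_ge0.
apply: row_norm_le => [|j]; first by rewrite sumr_ge0.
rewrite mxE [X in _ + X]mxE row_diag_mx [X in _ - _ * X]mxE.
have [jJ|jJ] := boolP (j \in J0 J thstar); last first.
  by rewrite vcoord_notin// mulr1 subrr normr0 sumr_ge0.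
rewrite vcoord_in//; have [r1|r1] := eqVneq (rho j) 1.
  by rewrite r1 subrr powRr0 mul1r mulr1 subrr normr0 sumr_ge0.
rewrite mulr0 subr0 (bigD1 j)/=; last by rewrite jJ.
rewrite -[leLHS]addr0 lerD//; last by rewrite sumr_ge0.
by rewrite normrM ger0_norm ?powR_ge0// ler_wpM2l ?powR_ge0// mx_coord_le.
Qed.

End LocalCoordinates.

(** * Limits of the local parameter sets *)

Section SetLimits.
Context {R : realType} {p N : nat} (TT : set R) (V : R -> set 'rV[R]_p).
Hypothesis hTT : ereal_sup [set T%:E | T in TT] = +oo%E.
Hypothesis A3 : Ulimsup TT V `<=` Ulim TT V.
Context (psi : 'rV[R]_p -> 'rV[R]_N).
Hypothesis cpsi : continuous psi.

Let F := at_infty TT.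
#[local] Instance at_infty_filter : ProperFilter F := at_infty_proper hTT.

Lemma near_at_infty (M : R) : \forall T \near F, TT T /\ M <= T.
Proof.
have near_ge : \forall T \near +oo, M <= T by apply: nbhs_pinfty_ge; exact: num_real.
by rewrite /F /at_infty near_withinE; apply: filterS near_ge => T.
Qed.

(** The lower half of the convergence of sets, immediate from the definition of the
limit by enlargements. *)
Lemma Ulim_near u e : Ulim TT V u -> 0 < e ->
  \forall T \near F, exists2 x, V T x & `|x - u| < e.
Proof.
move=> Uu e0; have [n _ H] := Uu e e0.
apply: filterS (near_at_infty n%:R) => T /H.
move=> /ereal_inf_lt[_ [x Vx <-]]; rewrite lte_fin => ux; exists x => //.
by rewrite distrC; apply: le_lt_trans ux; exact: norm_le_fnorm.
Qed.

(** The upper half: by the inclusion of the outer limit in the inner one, a point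
outside the limit keeps a positive distance from V T. *)
Lemma Ulim_far u : ~ Ulim TT V u -> exists2 e, 0 < e &
  \forall T \near F, forall x, V T x -> e <= `|x - u|.
Proof.
move=> nUu; have /existsNP[n] : ~ Ulimsup TT V u by move=> /A3.
move=> /not_implyP[n1 /existsNP[B /not_implyP[/nbhs_ballP[e e0 eB] nB]]].
exists e => //; apply: filterS (near_at_infty n%:R) => T Tn x Vx.
rewrite leNgt; apply/negP => xu; apply: nB; exists x; split; first by exists T.
by apply: eB; rewrite -ball_normE/= distrC.
Qed.

Lemma closed_Ulim : closed (Ulim TT V).
Proof.
move=> u cu; apply: contrapT => /Ulim_far[e e0 near_e].
have e20 : 0 < e / 2 by rewrite divr_gt0.
have [x [Ux xu]] := cu _ (nbhsx_ballx u (e / 2) e20).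
have [T [H [y Vy yx]]] := filter_ex (filterI near_e (Ulim_near Ux e20)).
have := H _ Vy; rewrite leNgt => /negP; apply.
rewrite -[y](subrK x) -addrA (le_lt_trans (ler_normD _ _))// (splitr e) ltrD//.
by move: xu; rewrite -ball_normE/= distrC.
Qed.

Let near_psi u e : 0 < e -> exists2 dl, 0 < dl &
  forall x, `|x - u| < dl -> `|x - u| <= e /\ `|psi x - psi u| <= e.
Proof.
move=> e0; have /cvgrPdist_le/(_ _ e0)/nbhs_ballP[d d0 H] := @cpsi u.
exists (Num.min d e); first by rewrite lt_min d0.
move=> x; rewrite lt_min => /andP[xd /ltW xe]; split => //.
by rewrite distrC; apply: H; rewrite -ball_normE/= distrC.
Qed.

(** On a compact set the two halves of the convergence of V T to its limit hold
uniformly, together with the continuity of psi. *)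
Lemma near_sub_Ulim r e : 0 < e -> \forall T \near F, forall u, V T u -> `|u| <= r ->
  exists a, [/\ Ulim TT V a, `|a - u| <= e & `|psi a - psi u| <= e].
Proof.
move=> e0.
have : \forall T \near F, [set x : 'rV[R]_p | `|x| <= r] `<=`
    (fun u => V T u ->
      exists a, [/\ Ulim TT V a, `|a - u| <= e & `|psi a - psi u| <= e]).
  apply: (compact_near_coveringP _).1; first exact: compact_norm_le.
  move=> u _; have [Uu|/Ulim_far[d d0 near_d]] := pselect (Ulim TT V u).
    have [dl dl0 H] := near_psi u e0.
    exists (ball u dl, setT); first by split; [exact: nbhsx_ballx | exact: filterT].
    move=> [x T]/= [ux _] _; exists u.
    have [|h1 h2] := H x; first by move: ux; rewrite -ball_normE/= distrC.
    by split => //; rewrite distrC.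
  exists (ball u d, [set T | forall x, V T x -> d <= `|x - u|]).
    by split => //; exact: nbhsx_ballx.
  move=> [x T]/= [ux H] /H; rewrite leNgt => /negP[].
  by move: ux; rewrite -ball_normE/= distrC.
by apply: filterS => T H u Vu ur; exact: H.
Qed.

Lemma near_Ulim_sub r e : 0 < e -> \forall T \near F, forall a, Ulim TT V a ->
  `|a| <= r -> exists u, [/\ V T u, `|u - a| <= e & `|psi u - psi a| <= e].
Proof.
move=> e0; have e20 : 0 < e / 2 by rewrite divr_gt0.
have : \forall T \near F, [set x : 'rV[R]_p | `|x| <= r] `<=`
    (fun a => Ulim TT V a ->
      exists u, [/\ V T u, `|u - a| <= e & `|psi u - psi a| <= e]).
  apply: (compact_near_coveringP _).1; first exact: compact_norm_le.
  move=> a _; have [Ua|nUa] := pselect (Ulim TT V a); last first.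
    have [d d0 near_d] := Ulim_far nUa.
    exists (ball a (d / 2), setT).
      by split; [apply: nbhsx_ballx; rewrite divr_gt0 | exact: filterT].
    move=> [x T]/= [ax _] Ux.
    have d20 : 0 < d / 2 by rewrite divr_gt0.
    have [T' [H [y Vy yx]]] := filter_ex (filterI near_d (Ulim_near Ux d20)).
    have := H _ Vy; rewrite leNgt => /negP[].
    rewrite -[y](subrK x) -addrA (le_lt_trans (ler_normD _ _))// (splitr d) ltrD//.
    by move: ax; rewrite -ball_normE/= distrC.
  have [dl dl0 H] := near_psi a e20.
  exists (ball a dl, [set T | exists2 x, V T x & `|x - a| < dl]).
    by split; [exact: nbhsx_ballx | exact: Ulim_near].
  move=> [x T]/= [ax [u Vu ua]] _; exists u.
  have [|h1 h2] := H x; first by move: ax; rewrite -ball_normE/= distrC.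
  have [h3 h4] := H u ua; split => //.
    rewrite -[u](subrK a) -addrA (le_trans (ler_normD _ _))// (splitr e) lerD//.
    by rewrite distrC.
  rewrite -[psi u](subrK (psi a)) -addrA (le_trans (ler_normD _ _))// (splitr e) lerD//.
  by rewrite distrC.
by apply: filterS => T H a Ua ar; exact: H.
Qed.

End SetLimits.

(** * Measurability of derivatives and sections *)

Section FieldMeasurability.
Context {R : realType} {d : measure_display} {Omega : measurableType d}.

(** Difference quotients express a derivative as a limit of measurable
functions. *)
Lemma measurable_derive p (N : set 'rV[R]_p) (f : Omega -> 'rV[R]_p -> R) x v l :
  open N -> N x -> (forall y, N y -> measurable_fun [set: Omega] (f ^~ y)) ->
  (forall w, is_derive x v (f w) (l w)) -> measurable_fun [set: Omega] l.
Proof.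
move=> oN Nx mf dl.
have v0 : 0 < `|v| + 1 by rewrite ltr_wpDl.
have /nbhs_ballP[e e0 eN] := open_nbhs_nbhs (conj oN Nx).
have [n0 n0e] := ltr_add_invr (divr_gt0 e0 v0).
rewrite add0r in n0e.
pose h n : R := (n + n0).+1%:R^-1.
have h0 n : 0 < h n by rewrite invr_gt0.
have hN n : N (h n *: v + x).
  apply: eN; rewrite -ball_normE/= opprD addrCA subrr addr0 normrN normrZ gtr0_norm//.
  have : h n < e / (`|v| + 1).
    apply: le_lt_trans n0e; rewrite lef_pV2 ?posrE// ler_nat ltnS; exact: leq_addl.
  rewrite ltr_pdivlMr//; apply: le_lt_trans.
  by rewrite ler_wpM2l ?lerDl// ltW.
apply: (@measurable_fun_cvg _ _ _ _ (fun n w => (h n)^-1 * (f w (h n *: v + x) - f w x))).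
  move=> n; apply: measurable_funM => //; apply: measurable_funB; exact: mf.
move=> w _; have [/cvg_ex[l' cl'] el] := dl w.
have {}cl' : (fun t : R => t^-1 *: (f w (t *: v + x) - f w x)) @ 0^' --> l w.
  by rewrite -el /derive; apply/cvg_ex; exists l'.
have /cvgr_dnbhsP := cl'; apply; split=> [n|]; first by rewrite gt_eqF.
apply/cvgrPdist_lt => e' e'0.
apply: filterS (near_infty_natSinv_lt (PosNum e'0)) => n.
rewrite sub0r normrN gtr0_norm//; apply: le_lt_trans.
by rewrite lef_pV2 ?posrE// ler_nat ltnS leq_addr.
Qed.

Lemma measurable_field_pair p q (D1 : set 'rV[R]_p) (D2 : set 'rV[R]_q)
    (f : Omega -> 'rV[R]_p * 'rV[R]_q -> R) (X : Omega -> 'rV[R]_p)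
    (Y : Omega -> 'rV[R]_q) :
  compact D1 -> compact D2 -> continuous_random_field (D1 `*` D2) f ->
  measurable_row X -> measurable_row Y ->
  (forall w, D1 (X w)) -> (forall w, D2 (Y w)) ->
  measurable_fun [set: Omega] (fun w => f w (X w, Y w)).
Proof.
move=> c1 c2 cf mX mY DX DY.
apply: (measurable_caratheodory (X := fun w => (X w, Y w)) _ _ _ cf).
- exact: compact_setX.
- by move=> w; exact: (conj (DX w) (DY w)).
move=> [x y] r; have [r0|r0] := ltP 0 r; last first.
  rewrite (_ : mkset _ = set0)//; apply/seteqP; split => w //=.
  by move=> /(le_lt_trans (normr_ge0 _)); rewrite ltNge r0.
rewrite (_ : mkset _ = [set w | `|x - X w| < r] `&` [set w | `|y - Y w| < r]).
  by apply: measurableI; exact: measurable_row_dist.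
apply/seteqP; split => w /=; rewrite prod_normE/= gt_max.
  by move=> /andP[].
by move=> [-> ->].
Qed.

Lemma field_section p q (D1 : set 'rV[R]_p) (D2 : set 'rV[R]_q)
    (f : Omega -> 'rV[R]_p * 'rV[R]_q -> R) (Y : Omega -> 'rV[R]_q) :
  compact D2 -> continuous_random_field (D1 `*` D2) f ->
  measurable_row Y -> (forall w, D2 (Y w)) ->
  continuous_random_field D1 (fun w x => f w (x, Y w)).
Proof.
move=> c2 [mf cf] mY DY; split=> [x Dx|w]; last first.
  apply/subspace_continuousP => x Dx; apply/cvgrPdist_lt => e e0.
  have [dl dl0 H] := within_continuousP (cf w) (conj Dx (DY w) : (D1 `*` D2) (x, Y w)) e0.
  rewrite near_withinE; apply/nbhs_ballP; exists dl => //= y xy Dy.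
  apply: H; first exact: (conj Dy (DY w)).
  rewrite prod_normE/= subrr normr0 gt_max dl0 andbT.
  by move: xy; rewrite -ball_normE.
apply: (measurable_caratheodory (D := D2) (f := fun w y => f w (x, y))) => //.
  exact: measurable_row_dist.
split => [y Dy|w]; first exact: mf.
apply/subspace_continuousP => y Dy; apply/cvgrPdist_lt => e e0.
have [dl dl0 H] := within_continuousP (cf w) (conj Dx Dy : (D1 `*` D2) (x, y)) e0.
rewrite near_withinE; apply/nbhs_ballP; exists dl => //= z xz Dz.
apply: H; first exact: (conj Dx Dz).
rewrite prod_normE/= subrr normr0 gt_max dl0/=.
by move: xz; rewrite -ball_normE.
Qed.

End FieldMeasurability.

(** * The model and its criterion *)

Section Model.
Context (R : realType) (d : measure_display)
  (Omega : measurableType d) (P : probability Omega R)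
  (G : set (set Omega)) (p q : nat)
  (Theta : set 'rV[R]_p) (Tau : set 'rV[R]_q) (thstar : 'rV[R]_p)
  (TT : set R)
  (H : R -> Omega -> 'rV[R]_p -> 'rV[R]_q -> R)
  (s : R -> Omega -> 'rV[R]_q -> R)
  (J : {set 'I_p}) (xi : R -> 'I_p -> Omega -> R)
  (pen : 'I_p -> R -> R) (qe : 'I_p -> R)
  (tauhat : R -> Omega -> 'rV[R]_q) (thhat : R -> Omega -> 'rV[R]_p)
  (N : set 'rV[R]_p)
  (dH : R -> Omega -> 'rV[R]_p -> 'rV[R]_q -> 'rV[R]_p)
  (ddH : R -> Omega -> 'rV[R]_p -> 'rV[R]_q -> 'M[R]_p)
  (aa : R -> 'rV[R]_p)
  (Y : Omega -> 'rV[R]_p -> R)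
  (Delta : Omega -> 'rV[R]_p) (Gamma : Omega -> 'M[R]_p)
  (rho : 'I_p -> R) (c dd : 'I_p -> Omega -> R)
  (uhat : Omega -> 'rV[R]_p).
Hypotheses (hGsub : G `<=` measurable) (hp : (0 < p)%N).
Hypotheses (hTheta : compact Theta) (hTau : compact Tau) (hthstar : Theta thstar).
Hypothesis hTT : ereal_sup [set T%:E | T in TT] = +oo%E.
Hypothesis hH : forall T, TT T ->
  continuous_random_field (Theta `*` Tau) (fun w z => H T w z.1 z.2).
Hypothesis hs : forall T, TT T ->
  continuous_random_field [set: 'rV[R]_q] (s T) /\ (forall w tau, 0 <= s T w tau).
Hypothesis hxi : forall T j, TT T -> j \in J ->
  measurable_fun [set: Omega] (xi T j) /\ (forall w, 0 <= xi T j w).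
Hypothesis hpen : forall j, j \in J -> 0 < qe j /\
  exists2 delta0 : R, 0 < delta0 & penalty_axioms (pen j) (qe j) delta0.
Hypothesis htauhat : forall T, TT T ->
  random_element (tauhat T) /\ (forall w, Tau (tauhat T w)).
Hypothesis hthhat : forall T, TT T ->
  random_element (thhat T) /\ (forall w, Theta (thhat T w)).
Hypothesis hargmax :
  P [set w | (penalized J H xi pen s T w (thhat T w) (tauhat T w))%:E =
             ereal_sup [set (penalized J H xi pen s T w th (tauhat T w))%:E
                       | th in Theta]]
  @[T --> at_infty TT] --> 1%E.
Hypotheses (hNopen : open N) (hNTheta : exists2 delta : R, 0 < delta &
  Theta `&` [set th | fnorm (th - thstar) < delta] `<=` closure N).
Hypothesis hNstar : forall (th : 'rV[R]_p) (t : R), N th -> 0 < t <= 1 ->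
  N (t *: th + (1 - t) *: thstar).
Hypothesis hHN : forall T, TT T ->
  continuous_random_field (closure N `*` Tau) (fun w z => H T w z.1 z.2).
Hypothesis hHC2 : forall T w tau, TT T -> Tau tau ->
  C2_closure N (fun th => H T w th tau)
    (fun th => dH T w th tau) (fun th => ddH T w th tau).
Hypothesis haa : forall T j, TT T -> 0 < aa T 0 j.
Hypothesis haa0 : forall j, aa T 0 j @[T --> at_infty TT] --> (0 : R).
Hypothesis hY : continuous_random_field Theta Y.
Hypothesis hDelta : random_element Delta.
Hypothesis hGamma : random_element (Gamma : g_sigma_algebraType G -> 'M[R]_p).
Hypothesis hrho : forall k, k \in J0 J thstar -> 1 <= rho k.
Hypothesis hc : forall i, i \in J1 J thstar ->
  measurable_fun [set: Omega] (c i) /\ (forall w, 0 <= c i w).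
Hypothesis hdd : forall k, k \in J0 J thstar ->
  measurable_fun [set: Omega] (dd k) /\ (forall w, 0 <= dd k w).
Hypothesis C1_cvg : cvg_prob0 P (at_infty TT) (fun T w =>
  ereal_sup [set `| (bT aa T)^-1 * (H T w z.1 z.2 - H T w thstar z.2)
                    - Y w z.1 |%:E | z in Theta `*` Tau]).
Hypothesis C1_neg :
  {ae P, forall w, forall th, Theta th -> th != thstar -> Y w th < 0}.
Context (tau0 : 'rV[R]_q).
Hypothesis htau0 : Tau tau0.
Hypothesis C2_score : cvg_prob0 P (at_infty TT) (fun T w =>
  ereal_sup [set (fnorm (dH T w thstar tau *m diag_mx (aa T)
                         - dH T w thstar tau0 *m diag_mx (aa T)))%:E
            | tau in Tau]).
Hypothesis C2_ds : cvg_ds P G (at_infty TT)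
  (fun T w =>
    (dH T w thstar tau0 *m diag_mx (aa T),
     (\row_(i < #|J1 J thstar|) (aa T 0 (enum_val i) * xi T (enum_val i) w)),
     (\row_(k < #|J0 J thstar|)
        (aa T 0 (enum_val k) `^ (qe (enum_val k) * rho (enum_val k))
         * xi T (enum_val k) w))))
  (fun w =>
    (Delta w,
     (\row_(i < #|J1 J thstar|) c (enum_val i) w),
     (\row_(k < #|J0 J thstar|) dd (enum_val k) w))).
Hypothesis C2_hessian : forall deltaT : R -> R,
  (forall T, TT T -> 0 < deltaT T) ->
  deltaT T @[T --> at_infty TT] --> (0 : R) ->
  cvg_prob0 P (at_infty TT) (fun T w =>
    ereal_sup [set (fnorm (diag_mx (aa T) *m ddH T w z.1 z.2
                           *m diag_mx (aa T) + Gamma w))%:E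
              | z in [set z | (closure N `*` Tau) z /\
                              fnorm (z.1 - thstar) < deltaT T]]).
Hypothesis C3 : {ae P, forall w, posdef (Gamma w)}.
Hypothesis C4 : forall i, i \in J1 J thstar ->
  cvg_prob0 P (at_infty TT) (fun T w => (xi T i w * (bT aa T)^-1)%:E).
Hypothesis C5 : forall k, k \in J0 J thstar -> 1 < rho k ->
  {ae P, forall w, 0 < dd k w}.
Let UU := Ulim TT (UT Theta J thstar rho aa).
Hypothesis A3 : Ulimsup TT (UT Theta J thstar rho aa) `<=` UU.
Hypothesis A4_rv : random_element uhat.
Hypothesis A4_U : forall w, UU (uhat w).
Hypothesis A4_uniq : {ae P, forall w, forall u,
  UU u -> u != uhat w ->
  quasi_field J thstar rho pen qe (Delta w) (Gamma w) (c ^~ w) (dd ^~ w) u <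
  quasi_field J thstar rho pen qe (Delta w) (Gamma w) (c ^~ w) (dd ^~ w)
    (uhat w)}.

Let F := at_infty TT.
#[local] Instance at_infty_model_filter : ProperFilter F := at_infty_proper hTT.

Let near_TT : \forall T \near F, TT T.
Proof. by apply: filterS (near_at_infty TT 0) => T []. Qed.

Let prob0_whp (X : R -> Omega -> \bar R) e : cvg_prob0 P F X -> 0 < e ->
  whp P F (fun T w => (`|X T w| < e%:E)%E).
Proof. by move=> /cvg_prob0_whp; exact. Qed.

Let in_J1 i : i \in J1 J thstar -> i \in J /\ thstar 0 i != 0.
Proof. by rewrite !inE => /andP[]. Qed.

Let in_J0 k : k \in J0 J thstar -> k \in J /\ thstar 0 k = 0.
Proof. by rewrite !inE => /andP[? /eqP]. Qed.

Let Pn T w th := penalized J H xi pen s T w th (tauhat T w).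

Let pen_axioms j : j \in J -> continuous (pen j) /\ (forall x, 0 <= pen j x).
Proof. by move=> /hpen[_ [d0 _ []]]. Qed.

Lemma pen0 k : k \in J -> pen k 0 = 0.
Proof. by move=> /hpen[_ [d0 _ [_ _ h _]]]; exact/h. Qed.

Lemma penalized_diff T w th : Pn T w th - Pn T w thstar =
  H T w th (tauhat T w) - H T w thstar (tauhat T w)
  - \sum_(i in J1 J thstar) xi T i w * (pen i (th 0 i) - pen i (thstar 0 i))
  - \sum_(k in J0 J thstar) xi T k w * pen k (th 0 k).
Proof.
have split_J (u : 'I_p -> R) : \sum_(j in J) u j =
    \sum_(i in J1 J thstar) u i + \sum_(k in J0 J thstar) u k.
  rewrite (bigID (fun j => thstar 0 j != 0))/=; congr (_ + _).
    by apply: eq_bigl => j; rewrite !inE.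
  by apply: eq_bigl => j; rewrite !inE negbK.
rewrite /Pn /penalized !split_J.
have -> : \sum_(k in J0 J thstar) xi T k w * pen k (thstar 0 k) = 0.
  by rewrite big1// => k /in_J0[kJ ->]; rewrite pen0// mulr0.
have -> : \sum_(i in J1 J thstar) xi T i w * (pen i (th 0 i) - pen i (thstar 0 i)) =
    \sum_(i in J1 J thstar) xi T i w * pen i (th 0 i) -
    \sum_(i in J1 J thstar) xi T i w * pen i (thstar 0 i).
  by rewrite -sumrB; apply: eq_bigr => i _; rewrite mulrBr.
ring.
Qed.

Let mtauhat T : TT T -> measurable_row (tauhat T).
Proof. by move=> /htauhat[/random_element_row]. Qed.

Let mthhat T : TT T -> measurable_row (thhat T).
Proof. by move=> /hthhat[/random_element_row]. Qed.

Lemma argmax_whp : whp P F (fun T w => forall th, Theta th -> Pn T w th <= Pn T w (thhat T w)).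
Proof.
pose A T := [set w | (Pn T w (thhat T w))%:E =
  ereal_sup [set (Pn T w th)%:E | th in Theta]].
have AE T : TT T -> A T = [set w | forall th, Theta th -> Pn T w th <= Pn T w (thhat T w)].
  move=> TTT; have [mth Dth] := hthhat TTT.
  apply/seteqP; split => w /= Hw.
    move=> th Dtheta; rewrite -lee_fin [X in (_ <= X)%E]Hw.
    by apply: ereal_sup_ubound; exists th.
  apply/eqP; rewrite eq_le; apply/andP; split.
    by apply: ereal_sup_ubound; exists (thhat T w).
  by apply: ge_ereal_sup => _ [th Dtheta <-]; rewrite lee_fin; exact: Hw.
have mA : \forall T \near F, measurable (A T).
  apply: filterS near_TT => T TTT; have [mth Dth] := hthhat TTT; have [mta Dta] := htauhat TTT.
  have ms : measurable_fun [set: Omega] (fun w => s T w (tauhat T w)).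
    apply: (measurable_caratheodory (D := Tau) (f := s T)) => //.
      exact: measurable_row_dist (mtauhat TTT).
    have [[ms cs] _] := hs TTT; split => [tau _|w]; first exact: ms.
    exact: continuous_subspaceW (cs w).
  have [mHs cHs] := field_section hTau (hH TTT) (mtauhat TTT) Dta.
  have cpen j : j \in J -> continuous (fun x : 'rV[R]_p => pen j (x 0 j)).
    move=> jJ; apply: (continuous_compose (u := fun x : 'rV[R]_p => x 0 j) (v := pen j)).
      exact: coord_continuous.
    exact: (pen_axioms jJ).1.
  have mpen (X : Omega -> 'rV[R]_p) : measurable_row X -> measurable_fun [set: Omega]
      (fun w => \sum_(j in J) xi T j w * pen j (X w 0 j)).
    move=> mX; under eq_fun do rewrite big_mkcond.
    apply: measurable_sum => j; have [jJ|jJ] := boolP (j \in J); last exact: measurable_cst.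
    apply: measurable_funM; first exact: (hxi TTT jJ).1.
    exact: (measurable_row_comp mX (cpen j jJ)).
  have mPn (X : Omega -> 'rV[R]_p) : measurable_row X -> (forall w, Theta (X w)) ->
      measurable_fun [set: Omega] (fun w => Pn T w (X w)).
    move=> mX DX; apply: measurable_funB => //; apply: measurable_funB.
      exact: (measurable_field_pair hTheta hTau (hH TTT) mX (mtauhat TTT)).
    exact: mpen.
  rewrite AE//.
    apply: (measurable_forall_le (f := fun w th => Pn T w th)
      (g := fun w _ => Pn T w (thhat T w)) hTheta).
      split=> [th Dtheta|w].
        by apply: (mPn (fun _ => th)) => // j; exact: measurable_cst.
      apply: continuous_sub; last exact: continuous_const.
      apply: continuous_sub; first exact: cHs.
      apply: continuous_bigsum => j jJ; apply: continuous_mul.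
        exact: continuous_const.
      exact: (continuous_subspaceT (cpen j jJ)).
    split=> [th _|w]; first exact: (mPn _ (mthhat TTT) Dth).
    by apply: continuous_subspaceT; exact: continuous_const.
apply: whpS (whp_probability1 mA hargmax).
by apply: filterS near_TT => T TTT w; rewrite AE.
Qed.

(** * Rates and consistency *)

Lemma near_aa e : 0 < e -> \forall T \near F, forall j, 0 < aa T 0 j < e.
Proof.
move=> e0; suff : \forall T \near F, forall j, `|0 - aa T 0 j| < e.
  apply: filterS2 near_TT => T TTT h j; have := h j.
  by rewrite sub0r normrN gtr0_norm haa.
by apply: filter_forall => j; move/cvgrPdist_lt : (haa0 j) => /(_ _ e0).
Qed.

Lemma near_powR_aa j r e : 0 < r -> 0 < e -> \forall T \near F, aa T 0 j `^ r < e.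
Proof.
move=> r0 e0; have cv : `|aa T 0 j| `^ r @[T --> F] --> `|0 : R| `^ r.
  apply: (@cvg_comp _ _ _ (fun T => aa T 0 j) (fun x : R => `|x| `^ r)); first exact: haa0.
  exact: continuous_powR_norm.
rewrite normr0 powR0 ?gt_eqF// in cv.
move/cvgrPdist_lt : cv => /(_ _ e0); apply: filterS2 near_TT => T TTT.
by rewrite sub0r normrN (gtr0_norm (haa j TTT)) ger0_norm ?powR_ge0.
Qed.

Let ra T := rate J thstar rho (aa T).

Lemma near_rate e : 0 < e -> \forall T \near F, forall j, ra T j < e.
Proof.
move=> e0; apply: filter_forall => j; rewrite /ra /rate.
have [jJ|jJ] := boolP (j \in J0 J thstar).
  by apply: near_powR_aa => //; rewrite (lt_le_trans ltr01)// hrho.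
by apply: filterS (near_aa e0) => T /(_ j) /andP[].
Qed.

Lemma near_kappa e : 0 < e -> \forall T \near F,
  \sum_(k in J0 J thstar | rho k != 1) aa T 0 k `^ (rho k - 1) <= e.
Proof.
move=> e0; have e10 : 0 < e / p%:R by rewrite divr_gt0// ltr0n.
have : \forall T \near F, forall k, k \in J0 J thstar -> rho k != 1 ->
    aa T 0 k `^ (rho k - 1) < e / p%:R.
  apply: filter_forall => k; have [kJ|kJ] := boolP (k \in J0 J thstar); last first.
    exact: nearW.
  have [r1|r1] := eqVneq (rho k) 1; first exact: nearW.
  have r0 : 0 < rho k - 1 by rewrite subr_gt0 lt_neqAle eq_sym r1 hrho.
  by apply: filterS (near_powR_aa k r0 e10) => T h _ _.
apply: filterS => T h.
apply: (@le_trans _ _ (\sum_(k in J0 J thstar | rho k != 1) e / p%:R)).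
  by apply: ler_sum => k /andP[kJ r1]; rewrite ltW// h.
apply: (@le_trans _ _ (\sum_(k < p) e / p%:R)).
  by rewrite [leRHS](bigID (fun k => (k \in J0 J thstar) && (rho k != 1)))/= lerDl sumr_ge0// => k _; rewrite ltW.
by rewrite sumr_const card_ord -[leLHS]mulr_natr divfK// pnatr_eq0 -lt0n.
Qed.

(** An eigenvector has a nonzero coordinate j, and reading the eigenvalue equation
there shows that the eigenvalue is the inverse of the square of the j-th rate. *)
Lemma bT_ge0 T : TT T -> 0 <= bT aa T.
Proof.
move=> TTT; rewrite /bT /lambda_min.
have a0 j : aa T 0 j != 0 by rewrite gt_eqF// haa.
set A := invmx _; have [->|/set0P ne] := eqVneq [set x | eigenvalue A x] set0.
  by rewrite inf0.
apply: lb_le_inf => // x /= /eigenvalueP[v vA v0].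
have {}vA : x *: v *m (diag_mx (aa T) *m diag_mx (aa T)) = v.
  rewrite -vA /A tr_diag_mx mulmxKV//.
  rewrite unitmx_mul; have [ud _] : diag_mx (aa T) \in unitmx /\ true.
    split=> //; rewrite unitmxE det_diag unitfE; apply/prodf_neq0 => j _; exact: a0.
  by rewrite ud.
have [j vj] : exists j, v 0 j != 0.
  by apply/existsP; apply: contraNT v0; rewrite negb_exists => /forallP v0;
    apply/eqP/rowP => j; rewrite mxE; apply/eqP; have := v0 j; rewrite negbK.
have := congr1 (fun u : 'rV[R]_p => u 0 j) vA.
rewrite mulmxA !row_diag_mx mxE => e; rewrite leNgt; apply/negP => x0.
have : v 0 j * (x * aa T 0 j * aa T 0 j - 1) = 0 by rewrite mulrBr mulr1 -{2}e; ring.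
move/eqP; rewrite mulf_eq0 (negbTE vj)/= subr_eq0 => /eqP e1.
have : x * aa T 0 j * aa T 0 j <= 0.
  by rewrite -mulrA nmulr_rle0// mulr_ge0// ltW// haa.
by rewrite e1 leNgt ltr01.
Qed.

(** The criterion at the estimator is at least its value at the true parameter,
where the penalties that do not vanish are negligible after normalization, while
the limit field is bounded away from 0 at a distance from the true parameter.
The sign of the other penalties is favourable. *)
Lemma consistency e : 0 < e -> whp P F (fun T w => `|thhat T w - thstar| < e).
Proof.
move=> e0; pose K := Theta `&` [set th | e <= `|th - thstar|].
have cdist : continuous (fun th : 'rV[R]_p => `|th - thstar|).
  apply: continuous_norm; apply: (lipschitz_continuous ler01) => x y.
  by rewrite opprB addrA subrK mul1r.
have cK : compact K.
  apply: compact_closedI => //.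
  exact: (@closed_comp _ _ (fun th : 'rV[R]_p => `|th - thstar|) [set t | e <= t]
    (fun x _ => cdist x) (@closed_ge _ _)).
have KY : continuous_random_field K Y.
  split=> [th [Dth _]|w]; first exact: hY.1.
  by apply: continuous_subspaceW (hY.2 w) => th [].
have negY : {ae P, forall w, forall th, K th -> Y w th < 0}.
  apply: filterS C1_neg => w h th [Dth eth]; apply: h => //.
  by apply/eqP => E; move: eth; rewrite /= E subrr normr0 leNgt e0.
apply: whp_tightly (tightlyI (tightly_negative cK KY negY) (tightly_gt0 P (F := F))) _.
move=> r; have [r0|r0] := ltP 0 r; last first.
  by apply: whpW; apply: nearW => T w [_].
have r20 : 0 < r^-1 / 2 by rewrite divr_gt0 ?invr_gt0.
(* the term 1 makes B positive even when no penalty is active at thstar *)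
pose B := \sum_(i in J1 J thstar) pen i (thstar 0 i) + 1.
have pen_ge0 i : i \in J1 J thstar -> 0 <= pen i (thstar 0 i).
  by move=> /in_J1[iJ _]; exact: (pen_axioms iJ).2.
have B0 : 0 < B by rewrite ltr_wpDl// sumr_ge0.
have e'0 : 0 < r^-1 / 2 / B by rewrite divr_gt0.
have w1 := prob0_whp C1_cvg r20.
have w2 : whp P F (fun T w => forall i, i \in J1 J thstar ->
    (`|(xi T i w * (bT aa T)^-1)%:E| < (r^-1 / 2 / B)%:E)%E).
  apply: whp_forall => i; have [iJ|iJ] := boolP (i \in J1 J thstar).
    by apply: whpS (prob0_whp (C4 iJ) e'0); apply: nearW.
  by apply: whpW; exact: nearW.
apply: whpS (whpI argmax_whp (whpI w1 w2)); apply: filterS near_TT => T TTT w.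
move=> [amax [y1 y2]] [Yneg _]; rewrite ltNge; apply/negP => eth.
have [_ /(_ w) Dth] := hthhat TTT; have [_ /(_ w) Dtau] := htauhat TTT.
have b0 : 0 <= (bT aa T)^-1 by rewrite invr_ge0 bT_ge0.
have {}Yneg := Yneg _ (conj Dth eth).
set Z := (bT aa T)^-1 * (H T w (thhat T w) (tauhat T w) - H T w thstar (tauhat T w)).
have y1' : Z - Y w (thhat T w) < r^-1 / 2.
  have : (`|Z - Y w (thhat T w)|%:E < (r^-1 / 2)%:E)%E.
    apply: le_lt_trans y1; apply: le_trans (lee_abs _).
    by apply: ereal_sup_ubound; exists (thhat T w, tauhat T w).
  by rewrite lte_fin; apply: le_lt_trans; exact: ler_norm.
have Z_ge : - (r^-1 / 2) <= Z.
  have := amax _ hthstar; rewrite -subr_ge0 penalized_diff => h.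
  have sum0 : 0 <= \sum_(k in J0 J thstar) xi T k w * pen k (thhat T w 0 k).
    apply: sumr_ge0 => k /in_J0[kJ _]; rewrite mulr_ge0//.
      exact: (hxi TTT kJ).2.
    exact: (pen_axioms kJ).2.
  have sum1 : - \sum_(i in J1 J thstar) xi T i w * pen i (thstar 0 i) <=
      \sum_(i in J1 J thstar) xi T i w * (pen i (thhat T w 0 i) - pen i (thstar 0 i)).
    rewrite -sumrN; apply: ler_sum => i /in_J1[iJ _]; rewrite -mulrN ler_wpM2l//.
      exact: (hxi TTT iJ).2.
    by rewrite -[leLHS]add0r lerD2r; exact: (pen_axioms iJ).2.
  have sum2 : (bT aa T)^-1 * \sum_(i in J1 J thstar) xi T i w * pen i (thstar 0 i) <=
      r^-1 / 2.
    apply: (@le_trans _ _ (\sum_(i in J1 J thstar) r^-1 / 2 / B * pen i (thstar 0 i))).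
      rewrite mulr_sumr; apply: ler_sum => i iJ1; have [iJ _] := in_J1 iJ1.
      rewrite mulrA ler_wpM2r ?pen_ge0// mulrC.
      by have := y2 i iJ1; rewrite lte_fin => /ltW; apply: le_trans; exact: ler_norm.
    rewrite -mulr_sumr mulrAC ler_pdivrMr// ler_wpM2l//; first exact: ltW.
    by rewrite /B lerDl.
  rewrite lerNl; apply: le_trans sum2; rewrite -mulrN ler_wpM2l//; lra.
have E : r^-1 / 2 + r^-1 / 2 = r^-1 by rewrite -splitr.
lra.
Qed.

(** * The coefficients of the local criterion *)

Let sco T w tau := dH T w thstar tau *m diag_mx (aa T).
Let ct T w i := aa T 0 i * xi T i w.
Let dt T w k := aa T 0 k `^ (qe k * rho k) * xi T k w.
Let XT T w := coefs J thstar (sco T w tau0) (ct T w) (dt T w).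
Let Xoo w := coefs J thstar (Delta w) (c ^~ w) (dd ^~ w).
Let Gv w := mxvec (Gamma w).
Let sT T w := row_mx (XT T w) (Gv w).

Let N0 : N !=set0.
Proof.
have [dl dl0 h] := hNTheta; have : closure N thstar.
  by apply: h; split => //=; rewrite subrr /fnorm mul0mx mxtrace0 sqrtr0.
by move=> /(_ setT filterT)[x [Nx _]]; exists x.
Qed.

Lemma closure_thstar : closure N thstar.
Proof. exact: (star_closure N0 hNstar). Qed.

(** The true parameter may lie on the boundary of N, where the gradient is only a
limit of gradients at points of N. *)
Lemma measurable_gradient T tau j : TT T -> Tau tau ->
  measurable_fun [set: Omega] (fun w => dH T w thstar tau 0 j).
Proof.
move=> TTT Dtau; have [mHN _] := hHN TTT.
have mN x : N x -> measurable_fun [set: Omega] (fun w => dH T w x tau 0 j).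
  move=> Nx; apply: (measurable_derive (f := fun w y => H T w y tau)
    (v := delta_mx 0 j) hNopen Nx).
    by move=> y Ny; apply: (mHN (y, tau)); split => //; exact: subset_closure.
  by move=> w; have [h _ _ _ _] := hHC2 w TTT Dtau; exact: h.
have [th Nth] := N0; pose t n : R := n.+1%:R^-1.
have t01 n : 0 < t n <= 1 by rewrite invr_gt0 ltr0n invf_le1 ?ler1n.
pose x n := t n *: th + (1 - t n) *: thstar.
apply: (@measurable_fun_cvg _ _ _ _ (fun n w => dH T w (x n) tau 0 j)).
  by move=> n; apply: mN; exact: hNstar.
move=> w _; have [_ _ _ cg _] := hHC2 w TTT Dtau.
have cgj : {within closure N, continuous (fun y => dH T w y tau 0 j)}.
  exact: (continuous_coord (f := fun y : subspace (closure N) => dH T w y tau)).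
apply/cvgrPdist_lt => e e0.
have [dl dl0 h] := within_continuousP cgj closure_thstar e0.
have v0 : 0 < `|thstar - th| + 1 by rewrite ltr_wpDl.
apply: filterS (near_infty_natSinv_lt (PosNum (divr_gt0 dl0 v0))) => n /= ndl.
apply: h; first by apply: subset_closure; exact: hNstar.
have -> : thstar - x n = t n *: (thstar - th).
  by apply/rowP => i; rewrite !mxE; ring.
have /andP[t0 _] := t01 n; rewrite normrZ gtr0_norm//.
by move: ndl; rewrite ltr_pdivlMr//; apply: le_lt_trans; rewrite ler_wpM2l ?lerDl// ltW.
Qed.

Let near_mXT : \forall T \near F, measurable_row (XT T).
Proof.
apply: filterS near_TT => T TTT; apply: measurable_row_mx; first apply: measurable_row_mx.
- move=> j; under eq_fun do rewrite row_diag_mx.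
  by apply: measurable_funM => //; exact: measurable_gradient.
- move=> i; under eq_fun do rewrite mxE; apply: measurable_funM => //.
  by have [iJ _] := in_J1 (enum_valP i); exact: (hxi TTT iJ).1.
- move=> i; under eq_fun do rewrite mxE; apply: measurable_funM => //.
  by have [iJ _] := in_J0 (enum_valP i); exact: (hxi TTT iJ).1.
Qed.

Let mXoo : measurable_row Xoo.
Proof.
apply: measurable_row_mx; first apply: measurable_row_mx.
- exact: random_element_row.
- by move=> i; under eq_fun do rewrite mxE; exact: (hc (enum_valP i)).1.
- by move=> i; under eq_fun do rewrite mxE; exact: (hdd (enum_valP i)).1.
Qed.

Let mGv : Gmeasurable_row G Gv.
Proof.
move=> j; case/mxvec_indexP: j => i k; rewrite /Gv; under eq_fun do rewrite mxvecE.
exact: random_element_coord.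
Qed.

Let mGv' : measurable_row Gv := Gmeasurable_row_measurable hGsub mGv.

Let XT_ds : cvg_ds P G F XT Xoo.
Proof.
apply: (@cvg_ds_comp _ _ _ P G F _ _
  (fun x : 'rV[R]_p * 'rV[R]_#|J1 J thstar| * 'rV[R]_#|J0 J thstar| =>
     row_mx (row_mx x.1.1 x.1.2) x.2) _ _ _ C2_ds).
apply: continuous_row => j.
pose E := ('rV[R]_p * 'rV[R]_#|J1 J thstar| * 'rV[R]_#|J0 J thstar|)%type.
have c1 : continuous (fun x : 'rV[R]_p * 'rV[R]_#|J1 J thstar| * 'rV[R]_#|J0 J thstar| => x.1).
  by move=> x; exact: cvg_fst.
have c2 : continuous (fun x : 'rV[R]_p * 'rV[R]_#|J1 J thstar| * 'rV[R]_#|J0 J thstar| => x.2).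
  by move=> x; exact: cvg_snd.
have c11 : continuous (fun x : 'rV[R]_p * 'rV[R]_#|J1 J thstar| => x.1).
  by move=> x; exact: cvg_fst.
have c12 : continuous (fun x : 'rV[R]_p * 'rV[R]_#|J1 J thstar| => x.2).
  by move=> x; exact: cvg_snd.
have [j1 ->|j1 ->] := split_ordP j; last first.
  rewrite (_ : (fun x : E => _) = (fun x : E => x.2 0 j1)); first exact: continuous_coord.
  by apply/funext => x; rewrite row_mxEr.
have [j2 ->|j2 ->] := split_ordP j1.
  rewrite (_ : (fun x : E => _) = (fun x : E => x.1.1 0 j2)).
    by apply: continuous_coord; exact: continuous_compose c11.
  by apply/funext => x; rewrite !row_mxEl.
rewrite (_ : (fun x : E => _) = (fun x : E => x.1.2 0 j2)).
  by apply: continuous_coord; exact: continuous_compose c12.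
by apply/funext => x; rewrite row_mxEl row_mxEr.
Qed.

Let tight_XT : tightly P F (fun r T w => `|XT T w| <= r).
Proof.
have mh : \forall T \near F, measurable_fun setT (fun w => `|XT T w|).
  by apply: filterS near_mXT => T; exact: measurable_row_norm.
have ch : continuous (fun x : 'rV[R]_(p + #|J1 J thstar| + #|J0 J thstar|) => `|x|).
  exact: norm_continuous.
apply: (cvg_ds_tightly XT_ds ch mh (measurable_row_norm mXoo) (phi := id)) => //.
exact/tightly_rv/measurable_row_norm.
Qed.

Let tight_Gv : tightly P F (fun r _ w => `|Gv w| <= r).
Proof. exact/tightly_rv/measurable_row_norm. Qed.

Let Gamma_le_Gv w i j : `|Gamma w i j| <= `|Gv w|.
Proof. by have := mx_coord_le (Gv w) 0 (mxvec_index i j); rewrite mxvecE. Qed.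

(** Positive definiteness on the compact unit sphere, in the form of a lower bound
of the quadratic form. *)
Let tight_posdef : tightly P F (fun r _ w =>
  forall v, `|v| ^+ 2 <= r * quad (Gamma w) v).
Proof.
pose D := [set v : 'rV[R]_p | `|v| <= 1] `&` [set v | 1 <= `|v|].
have cD : compact D.
  apply: compact_closedI; first exact: compact_norm_le.
  exact: (@closed_comp _ _ (fun v : 'rV[R]_p => `|v|) [set t | 1 <= t]
    (fun x _ => @norm_continuous _ _ x) (@closed_ge _ _)).
have mG i j : measurable_fun [set: Omega] (fun w => Gamma w i j).
  by have := mGv' (mxvec_index i j); rewrite /Gv; under eq_fun do rewrite mxvecE.
have cQ : continuous_random_field D (fun w v => - quad (Gamma w) v).
  split=> [v _|w].
    apply: measurableT_comp => //; under eq_fun do rewrite quadE.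
    apply: measurable_sum => i; apply: measurable_sum => j.
    by apply: measurable_funM => //; apply: measurable_funM.
  apply: continuous_subspaceT.
  rewrite (_ : (fun v : 'rV[R]_p => _) = (fun v : 'rV[R]_p => -1 * \sum_i \sum_j v 0 i * Gamma w i j * v 0 j)).
    apply: continuous_mul; first exact: continuous_const.
    apply: continuous_bigsum => i _; apply: continuous_bigsum => j _.
    apply: continuous_mul; last exact: coord_continuous.
    by apply: continuous_mul; [exact: coord_continuous | exact: continuous_const].
  by apply/funext => v; rewrite quadE mulN1r.
have neg : {ae P, forall w, forall v, D v -> - quad (Gamma w) v < 0}.
  apply: filterS C3 => w pos v [_ v1]; rewrite oppr_lt0; apply: pos.
  by apply/eqP => v0; move: v1; rewrite /= v0 normr0 leNgt ltr01.
apply: tightlyS (tightly_negative cD cQ neg).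
have near_0 : \forall r \near +oo, 0 < r :> R.
  by apply: nbhs_pinfty_gt; exact: num_real.
apply: filterS near_0 => r r0; apply: nearW => T w h v.
have [->|v0] := eqVneq v 0.
  by rewrite normr0 expr0n /quad mul0mx mul0mx mxE mulr0.
have nv0 : 0 < `|v| by rewrite normr_gt0.
have : - quad (Gamma w) (`|v|^-1 *: v) <= - r^-1.
  by apply: h; split; rewrite /= normrZ normfV normr_id mulVf ?gt_eqF.
have -> : quad (Gamma w) (`|v|^-1 *: v) = `|v| ^- 2 * quad (Gamma w) v.
  rewrite !quadE mulr_sumr; apply: eq_bigr => i _; rewrite mulr_sumr.
  by apply: eq_bigr => j _; rewrite !mxE -exprVn; ring.
rewrite lerN2 => hq; have n20 : 0 < `|v| ^+ 2 by rewrite exprn_gt0.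
by move: hq; rewrite ler_pdivlMl// ler_pdivrMr// [r * _]mulrC.
Qed.

(** The limits of the penalty coefficients at the accelerated rates are almost
surely positive, so that these coefficients stay away from 0 in probability.
The field on a single point reduces the claim for the limit to that for
negative fields. *)
Let tight_dt k : k \in J0 J thstar -> rho k != 1 ->
  tightly P F (fun r T w => 1 <= r * dt T w k).
Proof.
move=> kJ r1; have [i ik] : exists i : 'I_#|J0 J thstar|, k = enum_val i.
  by exists (enum_rank_in kJ k); rewrite enum_rankK_in.
pose h (x : 'rV[R]_(p + #|J1 J thstar| + #|J0 J thstar|)) := - x 0 (rshift _ i).
have hXT T w : h (XT T w) = - dt T w k by rewrite /h row_mxEr mxE ik.
have hXoo w : h (Xoo w) = - dd k w by rewrite /h row_mxEr mxE ik.
have ch : continuous h.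
  rewrite /h; under eq_fun do rewrite -mulN1r.
  apply: continuous_mul; first exact: continuous_const.
  exact: coord_continuous.
have mh : \forall T \near F, measurable_fun setT (fun w => h (XT T w)).
  by apply: filterS near_mXT => T mT; exact: (measurable_row_comp mT ch).
have mhoo : measurable_fun setT (fun w => h (Xoo w)).
  exact: (measurable_row_comp mXoo ch).
have phiS (r r' : R) : 0 < r -> r < r' -> - r^-1 < - r'^-1.
  by move=> r0 rr; rewrite ltrN2 ltf_pV2 ?posrE// (lt_trans r0).
have lim : tightly P F (fun r _ w => h (Xoo w) <= - r^-1).
  have cf : continuous_random_field [set (0 : R)] (fun w (_ : R) => - dd k w).
    split=> [x _|w]; last by apply: continuous_subspaceT; exact: continuous_const.
    by apply: measurableT_comp => //; exact: (hdd kJ).1.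
  have neg : {ae P, forall w, forall x : R, [set (0 : R)] x -> - dd k w < 0}.
    have rk : 1 < rho k by rewrite lt_neqAle eq_sym r1 hrho.
    by apply: filterS (C5 kJ rk) => w pos x _; rewrite oppr_lt0.
  have bound : tightly P F (fun r _ w => forall x : R, [set (0 : R)] x ->
      - dd k w <= - r^-1).
    apply: (@tightly_negative R _ _ P F _ R _ _ _ cf neg); exact: compact_set1.
  apply: tightlyS bound; apply: nearW => r; apply: nearW => T w /(_ 0 erefl).
  by rewrite hXoo.
apply: tightlyS (cvg_ds_tightly XT_ds ch mh mhoo phiS lim).
have near_0 : \forall r \near +oo, 0 < r :> R.
  by apply: nbhs_pinfty_gt; exact: num_real.
apply: filterS near_0 => r r0; apply: nearW => T w; rewrite hXT lerN2.
by move=> h1; rewrite mulrC -ler_pdivrMr// mul1r.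
Qed.

(** * Expansion of the criterion *)

Let vc T th := vcoord thstar (aa T) th.
Let uc T th := ucoord J thstar rho (aa T) th.
Let pd i := derive1 (pen i) (thstar 0 i).

(** The local model of the criterion, in which the linear and quadratic terms
are still expressed at the rates of the score. *)
Let Mod T w th := dotv (sco T w tau0) (vc T th) - 2^-1 * quad (Gamma w) (vc T th)
  - \sum_(i in J1 J thstar) ct T w i * pd i * vc T th 0 i
  - \sum_(k in J0 J thstar) dt T w k * `|uc T th 0 k| `^ qe k.

Let p0 : 0 < p%:R :> R. Proof. by rewrite ltr0n. Qed.

(** The shrinking neighbourhood is given in advance by dl: the Hessian is compared
with - Gamma uniformly on it, the segment to the true parameter included. The
factor p converts the sup norm into the Euclidean norm of the hypothesis. *)
Lemma expansion_H e (dl : R -> R) : 0 < e -> (forall T, TT T -> 0 < dl T) ->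
  dl T @[T --> F] --> (0 : R) ->
  whp P F (fun T w => forall th, Theta th -> `|th - thstar| < dl T ->
    `|H T w th (tauhat T w) - H T w thstar (tauhat T w)
      - dotv (sco T w (tauhat T w)) (vc T th)
      + 2^-1 * quad (Gamma w) (vc T th)| <= e * `|vc T th| ^+ 2).
Proof.
move=> e0 dl0 cdl; have [dN dN0 hdN] := hNTheta.
have dl'0 T : TT T -> 0 < p%:R * dl T by move=> TTT; rewrite mulr_gt0// dl0.
have cdl' : p%:R * dl T @[T --> F] --> (0 : R).
  by rewrite -[X in _ --> X](mulr0 p%:R); apply: cvgM => //; exact: cvg_cst.
have e10 : 0 < e / p%:R ^+ 2 by rewrite divr_gt0// exprn_gt0.
have near_dN : \forall T \near F, p%:R * dl T < dN.
  move/cvgrPdist_lt : cdl' => /(_ _ dN0); apply: filterS => T.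
  by rewrite sub0r normrN; apply: le_lt_trans; exact: ler_norm.
apply: whpS (prob0_whp (C2_hessian dl'0 cdl') e10).
apply: filterS2 near_TT near_dN => T TTT dldN w hess th Dth thdl.
have [_ /(_ w) Dtau] := htauhat TTT.
have a0 j : aa T 0 j != 0 by rewrite gt_eqF// haa.
have fn y : `|y - thstar| < dl T -> fnorm (y - thstar) < p%:R * dl T.
  by move=> yd; apply: le_lt_trans (fnorm_le_norm _) _; rewrite ltr_pM2l.
have Nth : closure N th by apply: hdN; split => //=; apply: lt_trans dldN; exact: fn.
pose W (k : 'rV[R]_p) := k *m diag_mx (\row_j (aa T 0 j)^-1).
have Wth : W (th - thstar) = vc T th.
  by apply/rowP => j; rewrite row_diag_mx [RHS]mxE; congr (_ * _); rewrite mxE.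
have WK k : W k *m diag_mx (aa T) = k.
  by apply/rowP => j; rewrite !row_diag_mx mxE mulfVK.
have cW : continuous W.
  apply: continuous_row => j; rewrite (_ : (fun k : 'rV[R]_p => _) =
      (fun k : 'rV[R]_p => k 0 j * (aa T 0 j)^-1)).
    by apply: continuous_mul; [exact: coord_continuous | exact: continuous_const].
  by apply/funext => k; rewrite row_diag_mx mxE.
have cquad : continuous (fun k : 'rV[R]_p => - quad (Gamma w) (W k)).
  rewrite (_ : (fun k : 'rV[R]_p => _) = (fun k : 'rV[R]_p =>
      -1 * \sum_i \sum_j W k 0 i * Gamma w i j * W k 0 j)).
    apply: continuous_mul; first exact: continuous_const.
    apply: continuous_bigsum => i _; apply: continuous_bigsum => j _.
    apply: continuous_mul; last exact: continuous_coord.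
    by apply: continuous_mul; [exact: continuous_coord | exact: continuous_const].
  by apply/funext => v; rewrite quadE mulN1r.
have cE : continuous (fun k : 'rV[R]_p => e * (`|W k| * `|W k|)).
  apply: continuous_mul; first exact: continuous_const.
  by apply: continuous_mul; exact: continuous_norm.
have near_quad y v : N y -> `|y - thstar| < dl T ->
    `|quad (ddH T w y (tauhat T w)) v - (- quad (Gamma w) (W v))| <= e * (`|W v| * `|W v|).
  move=> Ny ydl; rewrite opprK.
  have -> : quad (ddH T w y (tauhat T w)) v = quad
      (diag_mx (aa T) *m ddH T w y (tauhat T w) *m diag_mx (aa T)) (W v).
    transitivity (quad (ddH T w y (tauhat T w)) (W v *m diag_mx (aa T))).
      by rewrite WK.
    by rewrite /quad trmx_mul tr_diag_mx !mulmxA.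
  rewrite -quadD.
  have le1 : (fnorm (diag_mx (aa T) *m ddH T w y (tauhat T w) *m diag_mx (aa T)
      + Gamma w) <= e / p%:R ^+ 2).
    rewrite -lee_fin; apply: le_trans (ltW hess); apply: le_trans (lee_abs _).
    apply: ereal_sup_ubound; exists (y, tauhat T w) => //; split; last exact: fn.
    by split => //=; exact: subset_closure.
  apply: le_trans (quad_le _ (B := e / p%:R ^+ 2) _) _.
    by move=> i j; apply: le_trans (coord_le_fnorm _ _ _) le1.
  have pE : p%:R ^+ 2 * (e / p%:R ^+ 2) = e :> R.
    by rewrite mulrC divfK// expf_neq0// gt_eqF.
  by rewrite pE [`|W v| ^+ 2]expr2.
have := C2_expansion hNopen N0 hNstar (hHC2 w TTT Dtau) cquad cE near_quad Nth thdl.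
rewrite Wth -expr2; congr (`|_| <= _).
have -> : dotv (dH T w thstar (tauhat T w)) (th - thstar) =
    dotv (sco T w (tauhat T w)) (vc T th).
  apply: eq_bigr => j _; rewrite row_diag_mx (@dev_vcoord _ _ thstar (aa T)) => [|i].
    by rewrite mulrA.
  exact: haa.
ring.
Qed.

Lemma score_whp e : 0 < e -> whp P F (fun T w =>
  `|sco T w (tauhat T w) - sco T w tau0| < e).
Proof.
move=> e0; apply: whpS (prob0_whp C2_score e0); apply: filterS near_TT => T TTT w h.
rewrite -lte_fin; apply: le_lt_trans h; apply: le_trans (lee_abs _).
apply: (@le_trans _ _ (fnorm (sco T w (tauhat T w) - sco T w tau0))%:E).
  by rewrite lee_fin norm_le_fnorm.
by apply: ereal_sup_ubound; exists (tauhat T w) => //; exact: (htauhat TTT).2.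
Qed.

Let ct_le T w i : TT T -> i \in J1 J thstar -> 0 <= ct T w i <= `|XT T w|.
Proof.
move=> TTT iJ1; have [iJ _] := in_J1 iJ1.
have ct0 : 0 <= ct T w i by rewrite mulr_ge0//; [exact/ltW/haa | exact: (hxi TTT iJ).2].
rewrite ct0/=.
have := mx_coord_le (XT T w) 0 (lshift _ (rshift _ (enum_rank_in iJ1 i))).
by rewrite row_mxEl row_mxEr mxE enum_rankK_in// ger0_norm.
Qed.

Let dt_ge0 T w k : TT T -> k \in J0 J thstar -> 0 <= dt T w k.
Proof.
by move=> TTT /in_J0[kJ _]; rewrite mulr_ge0 ?powR_ge0//; exact: (hxi TTT kJ).2.
Qed.

Let sco_le T w : `|sco T w tau0| <= `|XT T w|.
Proof.
apply: row_norm_le => // j.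
by have := mx_coord_le (XT T w) 0 (lshift _ (lshift _ j)); rewrite !row_mxEl.
Qed.

(** The penalties at nonzero components are linearized by differentiability, with
an error controlled by the bounded coefficients; those at zero components are
exact powers near 0, and their rates combine into the coefficient dt. *)
Lemma expansion e (dl : R -> R) : 0 < e -> (forall T, TT T -> 0 < dl T) ->
  dl T @[T --> F] --> (0 : R) ->
  whp P F (fun T w => forall th, Theta th -> `|th - thstar| < dl T ->
    `|Pn T w th - Pn T w thstar - Mod T w th| <= e * (`|vc T th| + `|vc T th| ^+ 2)).
Proof.
move=> e0 dl0 cdl; apply: (whp_tightly tight_XT) => r.
pose r' := `|r| + 1; have r'0 : 0 < r' by rewrite ltr_wpDl.
have e20 : 0 < e / 2 by rewrite divr_gt0.
have e20p : 0 < e / 2 / p%:R by rewrite divr_gt0.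
have e'0 : 0 < e / 2 / (p%:R * r') by rewrite divr_gt0// mulr_gt0.
have near_dl x : 0 < x -> \forall T \near F, dl T < x.
  move=> x0; move/cvgrPdist_lt : cdl => /(_ _ x0); apply: filterS => T.
  by rewrite sub0r normrN; apply: le_lt_trans; exact: ler_norm.
have near1 : \forall T \near F, forall i, i \in J1 J thstar -> forall x,
    `|x - thstar 0 i| < dl T ->
    `|pen i x - pen i (thstar 0 i) - pd i * (x - thstar 0 i)| <=
    e / 2 / (p%:R * r') * `|x - thstar 0 i|.
  apply: filter_forall => i; have [iJ1|_] := boolP (i \in J1 J thstar); last first.
    by apply: nearW.
  have [iJ i0] := in_J1 iJ1; have [_ [d0 _ [_ /(_ _ i0)[dp _] _ _]]] := hpen iJ.
  have [x1 x10 h] := derivable_expansion dp e'0.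
  by apply: filterS (near_dl x1 x10) => T dld _ x xd; apply: h; exact: lt_trans dld.
have near0 : \forall T \near F, forall k, k \in J0 J thstar -> forall x,
    `|x| < dl T -> pen k x = `|x| `^ qe k.
  apply: filter_forall => k; have [kJ0|_] := boolP (k \in J0 J thstar); last first.
    by apply: nearW.
  have [kJ _] := in_J0 kJ0; have [_ [d0 d00 [_ _ _ h]]] := hpen kJ.
  apply: filterS (near_dl d0 d00) => T dld _ x xd; apply: h.
  by rewrite -ler_norml ltW// (lt_trans xd).
apply: whpS (whpI (expansion_H e0 dl0 cdl) (score_whp e20p)).
apply: filterS3 near_TT near1 near0 => T TTT h1 h0 w [hH1 hsc] Xr th Dth thdl.
have {}hH1 := hH1 th Dth thdl.
have thj j : `|th 0 j - thstar 0 j| < dl T.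
  by apply: le_lt_trans thdl; have := mx_coord_le (th - thstar) 0 j; rewrite !mxE.
have E1 : `|dotv (sco T w (tauhat T w)) (vc T th) - dotv (sco T w tau0) (vc T th)| <=
    e / 2 * `|vc T th|.
  rewrite -dotvBl (le_trans (dotv_le _ _))// mulrA ler_wpM2r//.
  by rewrite mulrC -ler_pdivlMr// ltW.
have dev j : th 0 j - thstar 0 j = aa T 0 j * vc T th 0 j.
  have := @dev_vcoord _ _ thstar (aa T) (fun i => haa i TTT) th j.
  by rewrite !mxE.
have E2 : `|\sum_(i in J1 J thstar) xi T i w * (pen i (th 0 i) - pen i (thstar 0 i))
    - \sum_(i in J1 J thstar) ct T w i * pd i * vc T th 0 i| <= e / 2 * `|vc T th|.
  rewrite -sumrB (le_trans (ler_norm_sum _ _ _))//.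
  apply: (@le_trans _ _ (\sum_(i < p) e / 2 / (p%:R * r') * r' * `|vc T th|)).
    rewrite [leRHS](bigID (fun i => i \in J1 J thstar))/= -[leLHS]addr0 lerD//; last first.
      by rewrite sumr_ge0// => i _; rewrite mulr_ge0// mulr_ge0 ?(ltW e'0) ?(ltW r'0).
    apply: ler_sum => i iJ1; have [iJ _] := in_J1 iJ1.
    have -> : xi T i w * (pen i (th 0 i) - pen i (thstar 0 i)) - ct T w i * pd i * vc T th 0 i =
        xi T i w * (pen i (th 0 i) - pen i (thstar 0 i) - pd i * (th 0 i - thstar 0 i)).
      by rewrite dev /ct; ring.
    have xi0 : 0 <= xi T i w by exact: (hxi TTT iJ).2.
    rewrite normrM (ger0_norm xi0).
    apply: (le_trans (ler_wpM2l xi0 (h1 i iJ1 _ (thj i)))).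
    rewrite dev normrM (gtr0_norm (haa i TTT)).
    have -> : xi T i w * (e / 2 / (p%:R * r') * (aa T 0 i * `|vc T th 0 i|)) =
      e / 2 / (p%:R * r') * (ct T w i * `|vc T th 0 i|) by rewrite /ct; ring.
    rewrite -[leRHS]mulrA ler_wpM2l ?(ltW e'0)//.
    have /andP[ct0 ctX] := @ct_le T w i TTT iJ1.
    rewrite ler_pM ?mx_coord_le//; apply: le_trans ctX _; apply: le_trans Xr _.
    by rewrite /r' (le_trans (ler_norm _))// lerDl.
  rewrite sumr_const card_ord -mulrnAl -[X in X * _ <= _]mulr_natr.
  have -> : e / 2 / (p%:R * r') * r' * p%:R = e / 2 by field; rewrite !gt_eqF.
  by [].
have E3 : \sum_(k in J0 J thstar) xi T k w * pen k (th 0 k) =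
    \sum_(k in J0 J thstar) dt T w k * `|uc T th 0 k| `^ qe k.
  apply: eq_bigr => k kJ0; have [kJ k0] := in_J0 kJ0.
  have thk : `|th 0 k| < dl T by have := thj k; rewrite k0 subr0.
  rewrite (h0 k kJ0 _ thk) /dt.
  have -> : th 0 k = aa T 0 k `^ rho k * uc T th 0 k.
    rewrite !mxE k0 subr0 /rate kJ0 mulrC divfK// gt_eqF// powR_gt0// haa//.
  rewrite normrM (ger0_norm (powR_ge0 _ _)) powRM ?powR_ge0// -powRrM [rho k * _]mulrC.
  ring.
rewrite penalized_diff E3 /Mod.
exact: combine_errors hH1 E1 E2.
Qed.

(** * Tightness of the rescaled estimator *)

Let linear_part_le T w v r : TT T -> `|XT T w| <= r ->
  `|dotv (sco T w tau0) v - \sum_(i in J1 J thstar) ct T w i * pd i * v 0 i| <=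
  (p%:R * r + \sum_i r * `|pd i|) * `|v|.
Proof.
move=> TTT Xr; have r0 : 0 <= r by apply: le_trans Xr.
rewrite (le_trans (ler_normB _ _))// mulrDl lerD//.
  rewrite (le_trans (dotv_le _ _))// -mulrA ler_wpM2l// ler_wpM2r//.
  exact: le_trans (sco_le T w) Xr.
rewrite (le_trans (ler_norm_sum _ _ _))// mulr_suml.
rewrite [leRHS](bigID (fun i => i \in J1 J thstar))/= -[leLHS]addr0 lerD//; last first.
  by rewrite sumr_ge0// => i _; rewrite !mulr_ge0.
apply: ler_sum => i iJ1; have /andP[ct0 ctX] := @ct_le T w i TTT iJ1.
rewrite normrM (normrM (ct T w i)) ler_pM ?mulr_ge0 ?mx_coord_le//.
by apply: ler_wpM2r => //; rewrite (ger0_norm ct0); exact: le_trans ctX Xr.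
Qed.

(** Since the criterion at the estimator exceeds its value at the true
parameter, the quadratic term bounds the coordinates at the rates of the score,
and then the penalties bound those at the accelerated rates. *)
Lemma tight_estimator : tightly P F (fun r T w => `|uc T (thhat T w)| <= r).
Proof.
(* consistency at a deterministic rate, as the expansion needs one *)
have [a [ba ca] whp_a] := whp_rate (P := P) (F := F)
  (X := fun T w => `|thhat T w - thstar|) (b := fun T => aa T 0 (Ordinal hp))
  (filterS (fun T TTT => haa _ TTT) near_TT) (haa0 _) consistency.
have a0 T : TT T -> 0 < a T.
  by move=> TTT; apply: lt_le_trans (ba T); exact: haa.
have tdt : tightly P F (fun r T w => forall k, k \in J0 J thstar -> rho k != 1 ->
    1 <= r * dt T w k).
  apply: tightly_forall => k; have [kJ|_] := boolP (k \in J0 J thstar); last first.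
    by apply: tightlyS (tightly_gt0 P (F := F)); apply: nearW => r; apply: nearW.
  have [_|r1] := eqVneq (rho k) 1.
    by apply: tightlyS (tightly_gt0 P (F := F)); apply: nearW => r; apply: nearW.
  by apply: tightlyS (tight_dt kJ r1); apply: nearW => r; apply: nearW => T w h _ _.
apply: (tightly_le (tightlyI (tightlyI (tightly_gt0 P (F := F)) tight_XT) (tightlyI tight_posdef tdt))).
move=> r; have [r0|r0] := ltP 0 r; last first.
  by exists 0; apply: whpW; apply: nearW => T w [[]].
(* small enough for half of the quadratic term to survive the remainder *)
pose e := (4 * r)^-1; have e0 : 0 < e by rewrite invr_gt0 mulr_gt0.
pose L := p%:R * r + \sum_i r * `|pd i|.
have L0 : 0 <= L.
  by rewrite addr_ge0// ?sumr_ge0// => [|i _]; rewrite mulr_ge0// ltW.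
pose C1 := 4 * r * (L + e); pose C2 := (L + e) * C1.
have Le0 : 0 <= L + e by rewrite addr_ge0// ltW.
have C10 : 0 <= C1 by rewrite mulr_ge0// mulr_ge0// ltW.
have C20 : 0 <= C2 by rewrite mulr_ge0.
exists (C1 + \sum_k (r * C2 + 1) `^ (qe k)^-1).
apply: whpS (whpI argmax_whp (whpI whp_a (expansion e0 a0 ca))).
apply: filterS near_TT => T TTT w [amax [tha ex]] [[_ Xr] [pos hdt]].
have {}ex := ex _ ((hthhat TTT).2 w) tha.
have := amax _ hthstar; rewrite -subr_ge0 => ge0.
set th := thhat T w in ex ge0 *.
set n := `|vc T th| in ex *; have n0 : 0 <= n by exact: normr_ge0.
have := linear_part_le (vc T th) TTT Xr; rewrite -/L -/n => lin.
have := pos (vc T th); rewrite -/n => quadn.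
have quadn' : n ^+ 2 * (2 * e) <= 2^-1 * quad (Gamma w) (vc T th).
  have -> : 2 * e = 2^-1 * r^-1 by rewrite /e; field; rewrite gt_eqF.
  by rewrite mulrCA ler_wpM2l// mulrC ler_pdivrMl.
have dsum0 : 0 <= \sum_(k in J0 J thstar) dt T w k * `|uc T th 0 k| `^ qe k.
  by apply: sumr_ge0 => k kJ; rewrite mulr_ge0 ?powR_ge0//; exact: dt_ge0.
have main : \sum_(k in J0 J thstar) dt T w k * `|uc T th 0 k| `^ qe k + n ^+ 2 * e
    <= (L + e) * n.
  exact: quadratic_bound ge0 ex lin quadn'.
(* the quadratic term is dominated by the linear one *)
have nC1 : n <= C1.
  have [->//|nn0] := eqVneq n 0.
  have npos : 0 < n by rewrite lt_neqAle eq_sym nn0.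
  have : n ^+ 2 * e <= (L + e) * n.
    by apply: le_trans main; rewrite lerDr.
  rewrite expr2 -mulrA [n * e]mulrC mulrA ler_pM2r// /C1 /e => h.
  move: h; rewrite ler_pdivrMr ?mulr_gt0// [_ * (4 * r)]mulrC.
  exact.
have sumC2 : \sum_(k in J0 J thstar) dt T w k * `|uc T th 0 k| `^ qe k <= C2.
  apply: (@le_trans _ _ ((L + e) * n)).
    by apply: le_trans main; rewrite lerDl mulr_ge0// ?sqr_ge0// ltW.
  by rewrite ler_wpM2l.
have Sge0 : 0 <= \sum_k (r * C2 + 1) `^ (qe k)^-1.
  by rewrite sumr_ge0// => k _; exact: powR_ge0.
apply: row_norm_le => [|j]; first by rewrite addr_ge0.
have case1 : uc T th 0 j = vc T th 0 j -> `|uc T th 0 j| <= C1 + \sum_k (r * C2 + 1) `^ (qe k)^-1.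
  move=> ->; rewrite -[leLHS]addr0 lerD//; apply: le_trans nC1; exact: mx_coord_le.
have [jJ|jJ] := boolP (j \in J0 J thstar); last first.
  by apply: case1; rewrite /uc /vc (@vcoord_notin _ _ J thstar rho).
have [rj|rj] := eqVneq (rho j) 1.
  apply: case1; rewrite /uc /vc (vcoord_in rho (fun i => haa i TTT) th jJ).
  by rewrite rj subrr powRr0 mul1r.
rewrite -[leLHS]add0r lerD// (bigD1 j)//= -[leLHS]addr0 lerD//; last first.
  by rewrite sumr_ge0// => k _; exact: powR_ge0.
have [jJ' _] := in_J0 jJ; have [qj _] := hpen jJ'.
have uq : `|uc T th 0 j| `^ qe j <= r * C2.
  apply: (@le_trans _ _ (r * (dt T w j * `|uc T th 0 j| `^ qe j))).
    by rewrite mulrA ler_peMl ?powR_ge0//; exact: hdt.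
  rewrite ler_wpM2l ?(ltW r0)//; apply: le_trans sumC2.
  rewrite (bigD1 j)//= lerDl sumr_ge0// => k /andP[kJ _].
  by rewrite mulr_ge0 ?powR_ge0//; exact: dt_ge0.
rewrite leNgt; apply/negP => lt_u.
have rC2 : 0 <= r * C2 by rewrite mulr_ge0// ltW.
have := gt0_ltr_powR qj (powR_ge0 _ _ : _ \in Num.nneg) (normr_ge0 _ : _ \in Num.nneg) lt_u.
rewrite -powRrM mulVf ?gt_eqF// powRr1 ?addr_ge0// ltNge => /negP; apply.
by rewrite (le_trans uq)// lerDl.
Qed.

(** * Approximation by the log-field *)

Let psi0 := psi J thstar rho qe pen.

Let cpsi0 : continuous psi0.
Proof. by apply: continuous_psi => k /in_J0[/hpen[]]. Qed.

Let ModE T w th : let u := uc T th in let v := vc T th in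
  let bu := u *m bmx J thstar rho in TT T ->
  Mod T w th - dotv (sT T w) (psi0 u) =
  dotv (sco T w tau0) (v - bu) - 2^-1 * (quad (Gamma w) v - quad (Gamma w) bu).
Proof.
move=> u v bu TTT; rewrite /Mod dotv_psi -/bu -/v -/u dotvBr.
have -> : \sum_(i in J1 J thstar) ct T w i * pd i * v 0 i =
    \sum_(i in J1 J thstar) ct T w i * derive1 (pen i) (thstar 0 i) * u 0 i.
  apply: eq_bigr => i iJ1; congr (_ * _); rewrite /v /vc (@vcoord_notin _ _ J _ rho)//.
  by move: iJ1; rewrite !inE => /andP[-> /negbTE ->].
rewrite /dt; ring.
Qed.

Let quad_sub_le (M : 'M[R]_p) (v v' : 'rV[R]_p) B : (forall i j, `|M i j| <= B) ->
  `|quad M v - quad M v'| <= p%:R ^+ 2 * B * ((`|v| + `|v'|) * `|v - v'|).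
Proof.
move=> MB; rewrite !quadE -sumrB (le_trans (ler_norm_sum _ _ _))//.
have term i j : `|v 0 i * M i j * v 0 j - v' 0 i * M i j * v' 0 j| <=
    B * ((`|v| + `|v'|) * `|v - v'|).
  have -> : v 0 i * M i j * v 0 j - v' 0 i * M i j * v' 0 j =
      M i j * (v 0 i * (v - v') 0 j + (v - v') 0 i * v' 0 j).
    by rewrite !mxE; ring.
  rewrite normrM ler_pM// (le_trans (ler_normD _ _))// mulrDl !normrM.
  apply: lerD; first by apply: ler_pM => //; exact: mx_coord_le.
  by rewrite mulrC; apply: ler_pM => //; exact: mx_coord_le.
have B0 : forall i j : 'I_p, 0 <= B * ((`|v| + `|v'|) * `|v - v'|).
  by move=> i j; apply: le_trans (term i j).
apply: (@le_trans _ _ (\sum_(i < p) \sum_(j < p) B * ((`|v| + `|v'|) * `|v - v'|))).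
  apply: ler_sum => i _; rewrite -sumrB (le_trans (ler_norm_sum _ _ _))//.
  by apply: ler_sum => j _; exact: term.
under eq_bigr do rewrite sumr_const card_ord -mulr_natr.
rewrite sumr_const card_ord -[leLHS]mulr_natr.
by rewrite le_eqVlt; apply/orP; left; apply/eqP; ring.
Qed.

(** The expansion is in the score coordinates v, the log-field in the coordinates u
of the estimator: the difference between v and bu tends to 0 on bounded sets. *)
Lemma approximation r e : 0 < e -> whp P F (fun T w => forall th, Theta th ->
  `|uc T th| <= r ->
  `|Pn T w th - Pn T w thstar - dotv (sT T w) (psi0 (uc T th))| <= e).
Proof.
move=> e0; apply: (whp_tightly (tightlyI tight_XT tight_Gv)) => B.
pose r' := `|r| + 1; have r'0 : 0 < r' by rewrite ltr_wpDl.
pose B' := `|B| + 1; have B'0 : 0 < B' by rewrite ltr_wpDl.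
have rr' : r <= r' by rewrite (le_trans (ler_norm _))// lerDl.
have BB' : B <= B' by rewrite (le_trans (ler_norm _))// lerDl.
pose C1 := 2 * r' + (2 * r') ^+ 2.
have r20 : 0 < 2 * r' by rewrite mulr_gt0.
have C10 : 0 < C1 by rewrite addr_gt0// exprn_gt0.
pose C2 := p%:R * B' + p%:R ^+ 2 * B' * (3 * r').
have p2B : 0 < p%:R ^+ 2 * B' by rewrite mulr_gt0// exprn_gt0 ?p0.
have r30 : 0 < 3 * r' by exact: mulr_gt0.
have C20 : 0 < C2 := addr_gt0 (mulr_gt0 p0 B'0) (mulr_gt0 p2B r30).
have e1 : 0 < e / 2 / C1 by rewrite !divr_gt0.
have k0 : 0 < Num.min 1 (e / 2 / C2 / r') by rewrite lt_min ltr01 !divr_gt0.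
(* the neighbourhood of the true parameter that contains the bounded
   coordinates; the last term makes its radius positive *)
pose dl T := \sum_j ra T j * r' + aa T 0 (Ordinal hp).
have ra0 T j : TT T -> 0 < ra T j by move=> TTT; apply: rate_gt0 => i; exact: haa.
have dl0 T : TT T -> 0 < dl T.
  move=> TTT; apply: ltr_wpDl; last exact: haa.
  by rewrite sumr_ge0// => j _; rewrite mulr_ge0// ltW// ra0.
have cdl : dl T @[T --> F] --> (0 : R).
  rewrite -[X in _ --> X]addr0; apply: cvgD; last exact: haa0.
  rewrite -[X in _ --> X](@big1 R 0 +%R 'I_p (index_enum 'I_p) xpredT (fun _ => 0))//.
  apply: cvg_sumr => j _; rewrite -[X in _ --> X](mul0r r').
  apply: cvgM; last exact: cvg_cst.
  apply/cvgrPdist_lt => x x0; apply: filterS2 near_TT (near_rate x0) => T TTT.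
  by move=> /(_ j); rewrite sub0r normrN gtr0_norm// ra0.
apply: whpS (expansion e1 dl0 cdl).
apply: filterS2 near_TT (near_kappa k0) => T TTT kap w ex [XB GB] th Dth ur.
have a0 j : 0 < aa T 0 j by exact: haa.
set u := uc T th in ur *; set v := vc T th in ex *.
have {}ur : `|u| <= r' by exact: le_trans rr'.
have thdl : `|th - thstar| < dl T.
  apply: le_lt_trans (dev_le_ucoord J thstar rho a0 th) _.
  rewrite /dl -[ltLHS]addr0; apply: ler_ltD; last exact: a0.
  by apply: ler_sum => j _; rewrite ler_wpM2l// ltW// ra0.
have {}ex := ex th Dth thdl.
set bu := u *m bmx J thstar rho.
have bur : `|bu| <= r' by apply: le_trans (bmx_norm_le _ _ _ _) ur.
have vbu : `|v - bu| <= Num.min 1 (e / 2 / C2 / r') * r'.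
  apply: le_trans (vcoord_sub_bmx a0 th hrho) _; rewrite -mulr_suml.
  by rewrite ler_pM// sumr_ge0// => k _; exact: powR_ge0.
have vbu1 : `|v - bu| <= r'.
  by apply: le_trans vbu _; rewrite ler_piMl ?(ltW r'0)// ge_min lexx.
have vbu2 : C2 * `|v - bu| <= e / 2.
  rewrite mulrC -ler_pdivlMr//; apply: le_trans vbu _.
  by rewrite -ler_pdivlMr// ge_min lexx orbT.
have vr : `|v| <= 2 * r'.
  by rewrite -[v](subrK bu) (le_trans (ler_normD _ _))//; lra.
have err1 : e / 2 / C1 * (`|v| + `|v| ^+ 2) <= e / 2.
  rewrite mulrAC ler_pdivrMr// ler_wpM2l//; first by rewrite divr_ge0// ltW.
  by rewrite lerD// lerXn2r ?nnegrE ?mulr_ge0// ltW.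
have err2 : `|Mod T w th - dotv (sT T w) (psi0 u)| <= C2 * `|v - bu|.
  rewrite ModE// -/u -/v -/bu (le_trans (ler_normB _ _))// /C2 mulrDl lerD//.
    rewrite (le_trans (dotv_le _ _))// -mulrA ler_wpM2l// ler_wpM2r//.
    exact: le_trans (sco_le T w) (le_trans XB BB').
  rewrite normrM ger0_norm ?invr_ge0//.
  have GB' i j : `|Gamma w i j| <= B'.
    exact: le_trans (Gamma_le_Gv w i j) (le_trans GB BB').
  apply: (@le_trans _ _ (p%:R ^+ 2 * B' * ((`|v| + `|bu|) * `|v - bu|))).
    apply: le_trans (quad_sub_le v bu GB').
    by rewrite ler_piMl// invf_le1 ?ler1n.
  rewrite -[leRHS]mulrA ler_wpM2l ?mulr_ge0 ?(ltW B'0)// ler_wpM2r//.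
  lra.
rewrite -[Pn T w th - Pn T w thstar](subrK (Mod T w th)) -addrA.
rewrite (le_trans (ler_normD _ _))// (splitr e) lerD//.
  exact: le_trans ex err1.
exact: le_trans err2 vbu2.
Qed.

(** * Near-maximizers *)

(** The constant in the bound of scalar products by sup norms. *)
Let M0 : R := (p + #|J1 J thstar| + #|J0 J thstar| + p * p)%:R.

Let near_maximizer (y : R -> Omega -> 'rV[R]_p) := forall r e, 0 < e ->
  whp P F (fun T w => `|y T w| <= r -> exists a, [/\ UU a, `|a - y T w| <= e &
    forall a', UU a' -> `|a'| <= r ->
      dotv (sT T w) (psi0 a') <= dotv (sT T w) (psi0 a) + e]).

Let yT T w := (thhat T w - thstar) *m invmx (amx J thstar rho aa T).

Let yTE T w : TT T -> yT T w = uc T (thhat T w).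
Proof. by move=> TTT; apply: ucoord_invmx => j; exact: haa. Qed.

Let UT_uc T th : TT T -> Theta th -> UT Theta J thstar rho aa T (uc T th).
Proof.
move=> TTT Dth; rewrite /UT /= [X in Theta X](_ : _ = th)//.
by apply: ucoordK => j; exact: haa.
Qed.

Let UT_inv T u : TT T -> UT Theta J thstar rho aa T u ->
  exists2 th, Theta th & uc T th = u.
Proof.
move=> TTT Uu; exists (thstar + u *m amx J thstar rho aa T) => //.
by apply: ucoord_add => j; exact: haa.
Qed.

(** The estimator is an exact maximizer over the local parameter set, which is
close to its limit on bounded sets, and its criterion is close to the log-field;
each of the four approximations costs e / 4. *)
Lemma near_maximizer_estimator : near_maximizer yT.
Proof.
move=> r e e0; apply: (whp_tightly (tightlyI tight_XT tight_Gv)) => B.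
pose B' := `|B| + 1; have B'0 : 0 < B' by rewrite ltr_wpDl.
have BB' : B <= B' by rewrite (le_trans (ler_norm _))// lerDl.
have M00 : 0 <= M0 by exact: ler0n.
have MB0 : 0 < 4 * (M0 * B' + 1) by rewrite mulr_gt0// ltr_wpDl// mulr_ge0// ltW.
pose e1 := Num.min 1 (e / (4 * (M0 * B' + 1))).
have e10 : 0 < e1 by rewrite lt_min ltr01 divr_gt0.
have e11 : e1 <= 1 by rewrite ge_min lexx.
have e1e : 4 * (M0 * B' + 1) * e1 <= e by rewrite mulrC -ler_pdivlMr// ge_min lexx orbT.
have MBe0 : 0 <= M0 * B' * e1 by rewrite !mulr_ge0// ltW.
have e40 : 0 < e / 4 by rewrite divr_gt0.
apply: whpS (whpI argmax_whp (approximation (r + 1) e40)).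
have sub1 := near_sub_Ulim A3 cpsi0 r e10.
have sub2 := near_Ulim_sub hTT A3 cpsi0 r e10.
apply: filterS3 near_TT sub1 sub2 => T TTT s1 s2 w [amax ap] [XB GB].
have [_ /(_ w) Dth] := hthhat TTT.
rewrite yTE// => ur; have [a [Ua au psia]] := s1 _ (UT_uc TTT Dth) ur.
have sB : `|sT T w| <= B'.
  apply: row_norm_le => [|j]; first exact: ltW.
  rewrite /sT; have [i ->|i ->] := split_ordP j.
    by rewrite row_mxEl; apply: le_trans (mx_coord_le _ _ _) (le_trans XB BB').
  by rewrite row_mxEr; apply: le_trans (mx_coord_le _ _ _) (le_trans GB BB').
have Fclose x x' : `|psi0 x - psi0 x'| <= e1 ->
    `|dotv (sT T w) (psi0 x) - dotv (sT T w) (psi0 x')| <= M0 * B' * e1.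
  move=> xx; rewrite -dotvBr (le_trans (dotv_le _ _))// -/M0 -mulrA.
  by rewrite ler_wpM2l// ler_pM.
exists a; split => //; first by apply: le_trans au _; lra.
move=> a' Ua' a'r; have [u' [Vu' ua' psiu']] := s2 a' Ua' a'r.
have [th' Dth' uth'] := UT_inv TTT Vu'.
have u'r : `|u'| <= r + 1.
  by rewrite -[u'](subrK a') addrC (le_trans (ler_normD _ _))// lerD// (le_trans ua').
have yr : `|uc T (thhat T w)| <= r + 1 by apply: le_trans ur _; rewrite lerDl.
have ap1 := ap _ Dth yr; have ap2 := ap _ Dth'; rewrite uth' in ap2.
have Me : M0 * B' * e1 <= e / 4 by lra.
exact: chain_bounds (le_trans (Fclose _ _ psiu') Me) (ap2 u'r) (amax _ Dth') ap1
  (le_trans (Fclose _ _ psia) Me).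
Qed.

(** * Convergence of the estimators *)

Let near_myT : \forall T \near F, measurable_row (yT T).
Proof.
apply: filterS near_TT => T TTT j; under eq_fun do rewrite yTE// !mxE.
by apply: measurable_funM => //; apply: measurable_funB => //; exact: mthhat.
Qed.

Let tight_yT : tightly P F (fun r T w => `|yT T w| <= r).
Proof.
apply: tightlyS tight_estimator; apply: nearW => r.
by apply: filterS near_TT => T TTT w; rewrite yTE.
Qed.

Let closed_UU : closed UU. Proof. exact: closed_Ulim hTT A3. Qed.

Let uniq_uhat : {ae P, forall w, forall u, UU u -> u != uhat w ->
  dotv (row_mx (Xoo w) (Gv w)) (psi0 u) < dotv (row_mx (Xoo w) (Gv w)) (psi0 (uhat w))}.
Proof.
apply: filterS A4_uniq => w h u Uu uu; have := h u Uu uu.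
by rewrite !quasi_fieldE ltr_expR.
Qed.

Let muhat : measurable_row uhat. Proof. exact: random_element_row. Qed.

Theorem estimator_stable : cvg_ds P G F yT uhat.
Proof.
exact: (stable_argmax hGsub near_mXT mXoo mGv XT_ds cpsi0 closed_UU muhat A4_U
  near_myT tight_yT uniq_uhat near_maximizer_estimator).
Qed.

Section SecondEstimator.
Context (T0 : R) (vhat : R -> Omega -> 'rV[R]_p).
Hypothesis hvhat : forall T, TT T -> T0 <= T ->
  [/\ random_element (vhat T), forall w, UU (vhat T w) &
      {ae P, forall w,
        let V := quasi_field J thstar rho pen qe
          (dH T w thstar (tauhat T w) *m diag_mx (aa T)) (Gamma w)
          (fun i => aa T 0 i * xi T i w)
          (fun k => aa T 0 k `^ (qe k * rho k) * xi T k w) in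
        (V (vhat T w))%:E = ereal_sup [set (V u)%:E | u in UU]}].
Hypothesis tvhat : tight P [set T | TT T /\ T0 <= T] vhat.

Let near_T0 : \forall T \near F, TT T /\ T0 <= T.
Proof. exact: near_at_infty. Qed.

Lemma tight_vhat : tightly P F (fun r T w => `|vhat T w| <= r).
Proof.
move=> eta eta0; have [K cK KP] := tvhat eta0.
have [B [_ KB]] := compact_bounded cK.
near=> r; apply: filterS near_T0 => T [TTT T0T].
have [mv _ _] := hvhat TTT T0T.
have mK : measurable [set w | ~ K (vhat T w)].
  have oK : open (~` K).
    by apply: closed_openC; apply: compact_closed => //; exact: norm_hausdorff.
  suff mB : (@open 'rV[R]_p).-sigma.-measurable (~` K).
    by have := mv measurableT _ mB; rewrite setTI.
  by apply: sub_gen_smallest.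
apply: le_trans (KP T (conj TTT T0T)); rewrite -measurable_mu_extE//.
apply: mu_extS => w /=; apply: contra_not => Kv; apply: (KB r) => //.
by near: r; apply: nbhs_pinfty_gt; exact: num_real.
Unshelve. all: by end_near. Qed.

(** The field maximized here has its score at the estimated nuisance parameter, and
this changes the coefficients by an amount that is negligible in probability. *)
Lemma near_maximizer_vhat : near_maximizer vhat.
Proof.
move=> r e e0.
have cK := @compact_norm_le R p r.
have [r0|r0] := ltP r 0.
  apply: whpW; apply: nearW => T w vr; exfalso.
  by have := le_trans (normr_ge0 _) vr; rewrite leNgt r0.
have K0 : [set x : 'rV[R]_p | `|x| <= r] !=set0 by exists 0; rewrite /= normr0.
have [xm _ [Bm Bmax]] := supKP cK K0 (continuous_norm cpsi0).
pose C := `|psi0 xm|; have C0 : 0 <= C by exact: normr_ge0.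
have psiC x : `|x| <= r -> `|psi0 x| <= C by move=> xr; rewrite /C -Bm; exact: Bmax.
have MC0 : 0 < 2 * (M0 * C) + 1 by rewrite ltr_wpDl// !mulr_ge0.
have e'0 : 0 < e / (2 * (M0 * C) + 1) by rewrite divr_gt0.
have argmax_v : whp P F (fun T w => forall u, UU u ->
    dotv (row_mx (coefs J thstar (sco T w (tauhat T w)) (ct T w) (dt T w)) (Gv w)) (psi0 u) <=
    dotv (row_mx (coefs J thstar (sco T w (tauhat T w)) (ct T w) (dt T w)) (Gv w))
      (psi0 (vhat T w))).
  move=> eta eta0; apply: filterS near_T0 => T [TTT T0T].
  have [_ _ vmax] := hvhat TTT T0T.
  rewrite mu_ext_negligible ?lee_fin ?ltW//.
  apply: negligibleS vmax => w /=; apply: contra_not => Vmax u Uu.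
  rewrite -ler_expR -!quasi_fieldE -lee_fin [X in (_ <= X)%E]Vmax.
  by apply: ereal_sup_ubound; exists u.
apply: whpS (whpI argmax_v (score_whp e'0)).
apply: filterS near_T0 => T [TTT T0T] w [vmax sc] vr.
have [_ /(_ w) Uv _] := hvhat TTT T0T.
exists (vhat T w); split => //; first by rewrite subrr normr0 ltW.
set s' := row_mx _ _ in vmax.
have ss' : `|sT T w - s'| <= e / (2 * (M0 * C) + 1).
  rewrite /sT /s' /XT /coefs !opp_row_mx !add_row_mx !subrr.
  apply: row_norm_le => [|j]; first exact: ltW.
  have [j1 ->|j1 ->] := split_ordP j; last by rewrite row_mxEr mxE normr0 ltW.
  rewrite row_mxEl; have [j2 ->|j2 ->] := split_ordP j1; last by rewrite row_mxEr mxE normr0 ltW.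
  rewrite row_mxEl; have [j3 ->|j3 ->] := split_ordP j2; last by rewrite row_mxEr mxE normr0 ltW.
  by rewrite row_mxEl (le_trans (mx_coord_le _ _ _))// distrC ltW.
have close x : `|x| <= r -> `|dotv (sT T w) (psi0 x) - dotv s' (psi0 x)| <= e / 2.
  move=> xr; rewrite -dotvBl (le_trans (dotv_le _ _))// -/M0.
  apply: (@le_trans _ _ (M0 * (e / (2 * (M0 * C) + 1) * C))).
    by rewrite ler_wpM2l ?ler0n// ler_pM// psiC.
  have -> : M0 * (e / (2 * (M0 * C) + 1) * C) = e / 2 * (2 * (M0 * C) / (2 * (M0 * C) + 1)).
    move: (2 * (M0 * C) + 1) MC0 => D D0; move: (M0) => m; field.
    by rewrite gt_eqF.
  by rewrite ler_piMr ?divr_ge0// ?(ltW e0)// ler_pdivrMr// mul1r lerDl.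
move=> a' Ua' a'r; have := close _ a'r; have := close _ vr; have := vmax _ Ua'.
move: (dotv _ _) (dotv _ _) (dotv _ _) (dotv _ _) => x1 x2 x3 x4 x12.
rewrite !ler_norml => /andP[? ?] /andP[? ?].
lra.
Qed.

(** The pair of the two estimators nearly maximizes a sum of two copies of the
field over U x U, whose maximizer is (uhat, uhat): the pair converges to it, so
that the difference converges to 0. *)
Theorem estimators_close : cvg_prob0 P F (fun T w => (fnorm (yT T w - vhat T w))%:E).
Proof.
pose psi2 (z : 'rV[R]_(p + p)) := psi0 (lsubmx z) + psi0 (rsubmx z).
pose U2 := [set z : 'rV[R]_(p + p) | UU (lsubmx z) /\ UU (rsubmx z)].
pose y2 T w := row_mx (yT T w) (vhat T w).
pose uhat2 w := row_mx (uhat w) (uhat w).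
have cl : continuous (fun z : 'rV[R]_(p + p) => lsubmx z).
  apply: continuous_row => j; rewrite (_ : (fun z : 'rV[R]_(p + p) => _) =
    (fun z : 'rV[R]_(p + p) => z 0 (lshift p j))); first exact: coord_continuous.
  by apply/funext => z; rewrite mxE.
have cr : continuous (fun z : 'rV[R]_(p + p) => rsubmx z).
  apply: continuous_row => j; rewrite (_ : (fun z : 'rV[R]_(p + p) => _) =
    (fun z : 'rV[R]_(p + p) => z 0 (rshift p j))); first exact: coord_continuous.
  by apply/funext => z; rewrite mxE.
have cpsi2 : continuous psi2.
  apply: continuous_row => j; rewrite (_ : (fun z : 'rV[R]_(p + p) => _) =
    (fun z : 'rV[R]_(p + p) => psi0 (lsubmx z) 0 j + psi0 (rsubmx z) 0 j)).
    apply: continuous_add; apply: continuous_coord.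
      exact: (continuous_compose cl cpsi0).
    exact: (continuous_compose cr cpsi0).
  by apply/funext => z; rewrite mxE.
have cU2 : closed U2.
  apply: closedI.
    exact: (@closed_comp _ _ (fun z : 'rV[R]_(p + p) => lsubmx z) UU (fun x _ => cl x)).
  exact: (@closed_comp _ _ (fun z : 'rV[R]_(p + p) => rsubmx z) UU (fun x _ => cr x)).
have dotvDr n (a b b' : 'rV[R]_n) : dotv a (b + b') = dotv a b + dotv a b'.
  by rewrite /dotv -big_split; apply: eq_bigr => i _; rewrite mxE mulrDr.
have mu2 : measurable_row uhat2 by exact: measurable_row_mx.
have Uu2 w : U2 (uhat2 w) by split; rewrite ?row_mxKl ?row_mxKr; exact: A4_U.
have my2 : \forall T \near F, measurable_row (y2 T).
  apply: filterS2 near_T0 near_myT => T [TTT T0T] my; apply: measurable_row_mx => //.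
  by have [mv _ _] := hvhat TTT T0T; exact: random_element_row.
have ty2 : tightly P F (fun r T w => `|y2 T w| <= r).
  apply: tightlyS (tightlyI tight_yT tight_vhat); apply: nearW => r; apply: nearW => T w [yr vr].
  apply: row_norm_le => [|j]; first exact: le_trans yr.
  have [i ->|i ->] := split_ordP j; rewrite ?row_mxEl ?row_mxEr.
    exact: le_trans (mx_coord_le _ _ _) yr.
  exact: le_trans (mx_coord_le _ _ _) vr.
have lsub_le (z : 'rV[R]_(p + p)) : `|lsubmx z| <= `|z|.
  by apply: row_norm_le => // j; rewrite mxE mx_coord_le.
have rsub_le (z : 'rV[R]_(p + p)) : `|rsubmx z| <= `|z|.
  by apply: row_norm_le => // j; rewrite mxE mx_coord_le.
have uniq2 : {ae P, forall w, forall z, U2 z -> z != uhat2 w ->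
    dotv (row_mx (Xoo w) (Gv w)) (psi2 z) < dotv (row_mx (Xoo w) (Gv w)) (psi2 (uhat2 w))}.
  apply: filterS uniq_uhat => w h z [Ul Ur] zu.
  rewrite /psi2 !dotvDr /uhat2 row_mxKl row_mxKr.
  have [el|nl] := eqVneq (lsubmx z) (uhat w); last first.
    apply: ltr_leD; first exact: h.
    by have [->//|nr] := eqVneq (rsubmx z) (uhat w); exact/ltW/h.
  rewrite el; apply: ler_ltD => //; apply: h => //.
  by apply: contra_neq zu => er; rewrite /uhat2 -{1}el -er hsubmxK.
have max2 r e : 0 < e -> whp P F (fun T w => `|y2 T w| <= r ->
    exists a, [/\ U2 a, `|a - y2 T w| <= e & forall a', U2 a' -> `|a'| <= r ->
      dotv (sT T w) (psi2 a') <= dotv (sT T w) (psi2 a) + e]).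
  move=> e0; have e20 : 0 < e / 2 by rewrite divr_gt0.
  apply: whpS (whpI (near_maximizer_estimator r e20) (near_maximizer_vhat r e20)).
  apply: nearW => T w [hy hv] yr.
  have [|a [Ua ay amax]] := hy.
    by have := lsub_le (y2 T w); rewrite row_mxKl => /le_trans; exact.
  have [|b [Ub bv bmax]] := hv.
    by have := rsub_le (y2 T w); rewrite row_mxKr => /le_trans; exact.
  exists (row_mx a b); split.
  - by split; rewrite ?row_mxKl ?row_mxKr.
  - rewrite /y2 opp_row_mx add_row_mx; apply: row_norm_le => [|j]; first exact: ltW.
    have e2e : e / 2 <= e by rewrite ler_pdivrMr// ler_peMr ?(ltW e0)// ler1n.
    have [i ->|i ->] := split_ordP j; rewrite ?row_mxEl ?row_mxEr.
      exact: le_trans (mx_coord_le _ _ _) (le_trans ay e2e).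
    exact: le_trans (mx_coord_le _ _ _) (le_trans bv e2e).
  - move=> a' [Ul Ur] a'r; rewrite /psi2 !dotvDr row_mxKl row_mxKr.
    rewrite [in leRHS](splitr e) addrACA lerD//.
      by apply: amax => //; exact: le_trans (lsub_le _) a'r.
    by apply: bmax => //; exact: le_trans (rsub_le _) a'r.
have ds2 : cvg_ds P G F y2 uhat2.
  exact: (stable_argmax hGsub near_mXT mXoo mGv XT_ds cpsi2 cU2 mu2 Uu2 my2 ty2 uniq2 max2).
pose h (z : 'rV[R]_(p + p)) := `|lsubmx z - rsubmx z|.
have ch : continuous h.
  apply: continuous_norm; apply: continuous_row => j.
  rewrite (_ : (fun z : 'rV[R]_(p + p) => _) =
    (fun z : 'rV[R]_(p + p) => lsubmx z 0 j - rsubmx z 0 j)).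
    by apply: continuous_sub; exact: continuous_coord.
  by apply/funext => z; rewrite !mxE.
have mh : \forall T \near F, measurable_fun setT (fun w => h (y2 T w)).
  by apply: filterS my2 => T my; exact: (measurable_row_comp my ch).
have mhoo : measurable_fun setT (fun w => h (uhat2 w)).
  exact: (measurable_row_comp mu2 ch).
apply/cvg_prob0_whp => e e0 eta eta0.
have pe0 : 0 < e / (p%:R + 1) by rewrite divr_gt0// ltr_wpDl.
(* the components of the limit of the pair coincide *)
have z0 : (mu_ext P [set w | ~ h (uhat2 w) <= e / (p%:R + 1) / 2]%R <= 0%:E)%E.
  rewrite (_ : [set w | _] = set0) ?mu_ext0//.
  apply/seteqP; split => w //=; rewrite /h /uhat2 row_mxKl row_mxKr subrr normr0.
  by case; rewrite divr_ge0// ltW.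
have lt2 : e / (p%:R + 1) / 2 < e / (p%:R + 1).
  by rewrite ltr_pdivrMr// ltr_pMr// ltr1n.
apply: filterS (cvg_ds_le ds2 ch mh mhoo lt2 eta0 z0) => T; rewrite add0r.
apply: le_trans; apply: mu_extS => w /=; apply: contra_not.
rewrite /h /y2 row_mxKl row_mxKr => hle; rewrite lte_fin ger0_norm ?fnorm_ge0//.
apply: (le_lt_trans (fnorm_le_norm _)).
apply: (@le_lt_trans _ _ (p%:R * (e / (p%:R + 1)))); first by rewrite ler_wpM2l.
by rewrite mulrCA gtr_pMr// ltr_pdivrMr ?mul1r ?ltrDl// ltr_wpDl.
Qed.

End SecondEstimator.

End Model.

Theorem theorem4p1 (R : realType) (d : measure_display)
  (Omega : measurableType d) (P : probability Omega R)
  (G : set (set Omega)) (p q : nat)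
  (Theta : set 'rV[R]_p) (Tau : set 'rV[R]_q) (thstar : 'rV[R]_p)
  (TT : set R)
  (H : R -> Omega -> 'rV[R]_p -> 'rV[R]_q -> R)
  (s : R -> Omega -> 'rV[R]_q -> R)
  (J : {set 'I_p}) (xi : R -> 'I_p -> Omega -> R)
  (pen : 'I_p -> R -> R) (qe : 'I_p -> R)
  (tauhat : R -> Omega -> 'rV[R]_q) (thhat : R -> Omega -> 'rV[R]_p)
  (N : set 'rV[R]_p)
  (dH : R -> Omega -> 'rV[R]_p -> 'rV[R]_q -> 'rV[R]_p)
  (ddH : R -> Omega -> 'rV[R]_p -> 'rV[R]_q -> 'M[R]_p)
  (aa : R -> 'rV[R]_p)
  (Y : Omega -> 'rV[R]_p -> R)
  (Delta : Omega -> 'rV[R]_p) (Gamma : Omega -> 'M[R]_p)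
  (rho : 'I_p -> R) (c dd : 'I_p -> Omega -> R)
  (uhat : Omega -> 'rV[R]_p)
  (* probability space, parameter spaces, index set *)
  (hG : sigma_algebra [set: Omega] G) (hGsub : G `<=` measurable)
  (hp : (0 < p)%N)
  (hTheta : compact Theta) (hTau : compact Tau) (hthstar : Theta thstar)
  (hTT : ereal_sup [set T%:E | T in TT] = +oo%E)
  (* quasi-log-likelihood and penalties *)
  (hH : forall T, TT T ->
    continuous_random_field (Theta `*` Tau) (fun w z => H T w z.1 z.2))
  (hs : forall T, TT T ->
    continuous_random_field [set: 'rV[R]_q] (s T) /\
    (forall w tau, 0 <= s T w tau))
  (hxi : forall T j, TT T -> j \in J ->
    measurable_fun [set: Omega] (xi T j) /\ (forall w, 0 <= xi T j w))
  (hpen : forall j, j \in J -> 0 < qe j /\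
    exists2 delta0 : R, 0 < delta0 & penalty_axioms (pen j) (qe j) delta0)
  (* estimators *)
  (htauhat : forall T, TT T ->
    random_element (tauhat T) /\ (forall w, Tau (tauhat T w)))
  (hthhat : forall T, TT T ->
    random_element (thhat T) /\ (forall w, Theta (thhat T w)))
  (hargmax :
    P [set w | (penalized J H xi pen s T w (thhat T w) (tauhat T w))%:E =
               ereal_sup [set (penalized J H xi pen s T w th (tauhat T w))%:E
                         | th in Theta]]
    @[T --> at_infty TT] --> 1%E)
  (* the set N and the derivatives of H *)
  (hNbounded : bounded_set N) (hNopen : open N)
  (hNTheta : exists2 delta : R, 0 < delta &
    Theta `&` [set th | fnorm (th - thstar) < delta] `<=` closure N)
  (hNstar : forall (th : 'rV[R]_p) (t : R), N th -> 0 < t <= 1 ->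
    N (t *: th + (1 - t) *: thstar))
  (hHN : forall T, TT T ->
    continuous_random_field (closure N `*` Tau) (fun w z => H T w z.1 z.2))
  (hHC2 : forall T w tau, TT T -> Tau tau ->
    C2_closure N (fun th => H T w th tau)
      (fun th => dH T w th tau) (fun th => ddH T w th tau))
  (* rates *)
  (haa : forall T j, TT T -> 0 < aa T 0 j)
  (haa0 : forall j, aa T 0 j @[T --> at_infty TT] --> (0 : R))
  (* limit objects *)
  (hY : continuous_random_field Theta Y)
  (hDelta : random_element Delta)
  (hGamma : random_element (Gamma : g_sigma_algebraType G -> 'M[R]_p))
  (hrho : forall k, k \in J0 J thstar -> 1 <= rho k)
  (hc : forall i, i \in J1 J thstar ->
    measurable_fun [set: Omega] (c i) /\ (forall w, 0 <= c i w))
  (hdd : forall k, k \in J0 J thstar ->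
    measurable_fun [set: Omega] (dd k) /\ (forall w, 0 <= dd k w))
  (* [C1] *)
  (C1_cvg : cvg_prob0 P (at_infty TT) (fun T w =>
    ereal_sup [set `| (bT aa T)^-1 * (H T w z.1 z.2 - H T w thstar z.2)
                      - Y w z.1 |%:E | z in Theta `*` Tau]))
  (C1_neg : {ae P, forall w, forall th, Theta th -> th != thstar -> Y w th < 0})
  (* [C2] *)
  (C2_score : exists tau0, [/\ Tau tau0,
    cvg_prob0 P (at_infty TT) (fun T w =>
      ereal_sup [set (fnorm (dH T w thstar tau *m diag_mx (aa T)
                             - dH T w thstar tau0 *m diag_mx (aa T)))%:E
                | tau in Tau]) &
    cvg_ds P G (at_infty TT)
      (fun T w =>
        (dH T w thstar tau0 *m diag_mx (aa T),
         (\row_(i < #|J1 J thstar|) (aa T 0 (enum_val i) * xi T (enum_val i) w)),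
         (\row_(k < #|J0 J thstar|)
            (aa T 0 (enum_val k) `^ (qe (enum_val k) * rho (enum_val k))
             * xi T (enum_val k) w))))
      (fun w =>
        (Delta w,
         (\row_(i < #|J1 J thstar|) c (enum_val i) w),
         (\row_(k < #|J0 J thstar|) dd (enum_val k) w)))])
  (C2_hessian : forall deltaT : R -> R,
    (forall T, TT T -> 0 < deltaT T) ->
    deltaT T @[T --> at_infty TT] --> (0 : R) ->
    cvg_prob0 P (at_infty TT) (fun T w =>
      ereal_sup [set (fnorm (diag_mx (aa T) *m ddH T w z.1 z.2
                             *m diag_mx (aa T) + Gamma w))%:E
                | z in [set z | (closure N `*` Tau) z /\
                                fnorm (z.1 - thstar) < deltaT T]]))
  (* [C3] *)
  (C3 : {ae P, forall w, posdef (Gamma w)})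
  (* [C4] *)
  (C4 : forall i, i \in J1 J thstar ->
    cvg_prob0 P (at_infty TT) (fun T w => (xi T i w * (bT aa T)^-1)%:E))
  (* [C5] *)
  (C5 : forall k, k \in J0 J thstar -> 1 < rho k -> {ae P, forall w, 0 < dd k w})
  (* [A3] *)
  (A3 : Ulimsup TT (UT Theta J thstar rho aa) `<=`
        Ulim TT (UT Theta J thstar rho aa))
  (* [A4] *)
  (A4_rv : random_element uhat)
  (A4_U : forall w, Ulim TT (UT Theta J thstar rho aa) (uhat w))
  (A4_max : {ae P, forall w,
    (quasi_field J thstar rho pen qe (Delta w) (Gamma w) (c ^~ w) (dd ^~ w)
       (uhat w))%:E =
    ereal_sup [set (quasi_field J thstar rho pen qe (Delta w) (Gamma w)
                      (c ^~ w) (dd ^~ w) u)%:E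
              | u in Ulim TT (UT Theta J thstar rho aa)]})
  (A4_uniq : {ae P, forall w, forall u,
    Ulim TT (UT Theta J thstar rho aa) u -> u != uhat w ->
    quasi_field J thstar rho pen qe (Delta w) (Gamma w) (c ^~ w) (dd ^~ w) u <
    quasi_field J thstar rho pen qe (Delta w) (Gamma w) (c ^~ w) (dd ^~ w)
      (uhat w)}) :
  cvg_ds P G (at_infty TT)
    (fun T w => (thhat T w - thstar) *m invmx (amx J thstar rho aa T)) uhat
  /\
  (* [A5] *)
  (forall (T0 : R) (vhat : R -> Omega -> 'rV[R]_p),
    TT T0 ->
    (forall T, TT T -> T0 <= T ->
      [/\ random_element (vhat T),
          forall w, Ulim TT (UT Theta J thstar rho aa) (vhat T w) &
          {ae P, forall w,
            let V := quasi_field J thstar rho pen qe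
              (dH T w thstar (tauhat T w) *m diag_mx (aa T)) (Gamma w)
              (fun i => aa T 0 i * xi T i w)
              (fun k => aa T 0 k `^ (qe k * rho k) * xi T k w) in
            (V (vhat T w))%:E =
            ereal_sup [set (V u)%:E
                      | u in Ulim TT (UT Theta J thstar rho aa)]}]) ->
    tight P [set T | TT T /\ T0 <= T] vhat ->
    cvg_prob0 P (at_infty TT) (fun T w =>
      (fnorm ((thhat T w - thstar) *m invmx (amx J thstar rho aa T)
              - vhat T w))%:E)).
Proof.
have [tau0 [htau0 C2_close C2_joint]] := C2_score.
split.
  exact: (estimator_stable hGsub hp hTheta hTau hthstar hTT hH hs hxi hpen
    htauhat hthhat hargmax hNopen hNTheta hNstar hHN hHC2 haa haa0 hY hDelta
    hGamma hrho hc hdd C1_cvg C1_neg htau0 C2_close C2_joint C2_hessian C3 C4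
    C5 A3 A4_rv A4_U A4_uniq).
move=> T0 vhat TT0 hvhat tvhat.
exact: (estimators_close hGsub hp hTheta hTau hthstar hTT hH hs hxi hpen
  htauhat hthhat hargmax hNopen hNTheta hNstar hHN hHC2 haa haa0 hY hDelta
  hGamma hrho hc hdd C1_cvg C1_neg htau0 C2_close C2_joint C2_hessian C3 C4
  C5 A3 A4_rv A4_U A4_uniq hvhat tvhat).
Qed.
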